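(* Let $K$ be a number field with ring of integers $\mathcal{O}_K$, let $r$ be the rank of the unit group $\mathcal{O}_K^*$, let $c>0$ and let $\alpha\in(0,1)$. There exists a constant $B>0$ depending only on $K$, $c$ and $\alpha$ such that the following holds. Let $H\ge 2$ be a real number and let $A\subseteq\{a\in\mathcal{O}_K: H(a)\le H\}$, where $H(\cdot)$ is the multiplicative height on $K$. If $$|A\bmod\mathfrak{p}|\le \alpha\,|\mathcal{O}_K/\mathfrak{p}|$$ for every prime ideal $\mathfrak{p}$ of $\mathcal{O}_K$ with $N\mathfrak{p}>c$, then $$|A|\le B\,H^{\alpha}(\log H)^r.$$
   Context: For a number field $K$, let $M_K$ be its set of places. For an Archimedean place $v$ associated with an embedding $\sigma:K\to\mathbb{C}$, $|\alpha|_v=|\sigma(\alpha)|$ (usual absolute value). For a non-Archimedean place $v$ associated with a prime ideal $\mathfrak{p}$ above the rational prime $p$, $|\alpha|_v=p^{-v_{\mathfrak{p}}(\alpha)/e_{\mathfrak{p}}}$, where $v_{\mathfrak{p}}(\alpha)$ is the exponent of $\mathfrak{p}$ in the factorization of $\alpha\mathcal{O}_K$ and $e_{\mathfrak{p}}$ is the ramification index (and $|0|_v=0$). Put $n_v=[K_v:\mathbb{Q}_v]$. The multiplicative height of $x\in K$ (relative to $K$, not normalized by the degree) is $H(x)=\prod_{v\in M_K}\max(1,|x|_v^{n_v})$. For a prime ideal $\mathfrak{p}$, $N\mathfrak{p}=|\mathcal{O}_K/\mathfrak{p}|$. The notation $|A\bmod\mathfrak{p}|$ is the number of distinct residue classes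 modulo $\mathfrak{p}$ occupied by elements of $A$. If $r=0$, $(\log H)^r$ is $1$. *)

(* Defs.v *)
From HB Require Import structures.
From mathcomp Require Import all_boot all_order all_algebra all_field.
From mathcomp Require Import mathcomp_extra boolp classical_sets functions.
From mathcomp Require Import cardinality fsbigop reals exp.
From mathcomp Require Import finmap complex.

Set Implicit Arguments.
Unset Strict Implicit.
Unset Printing Implicit Defensive.

Import Order.TTheory GRing.Theory Num.Theory.

Local Open Scope classical_set_scope.
Local Open Scope ring_scope.

(* A number field is a [fieldExtType rat]. *)

Definition algint (K : fieldExtType rat) : {pred K} :=
  fun x => `[< integralOver (intr : int -> K) x >].

Lemma algint_subring_closed (K : fieldExtType rat) : subring_closed (@algint K).
Proof.
split.
- by apply/asboolP; exact: integral1.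
- by move=> x y /asboolP xi /asboolP yi; apply/asboolP; exact: integral_sub.
- by move=> x y /asboolP xi /asboolP yi; apply/asboolP; exact: integral_mul.
Qed.

HB.instance Definition _ (K : fieldExtType rat) :=
  GRing.isSubringClosed.Build K (@algint K) (@algint_subring_closed K).

Record ringint (K : fieldExtType rat) :=
  RingInt { ringint_val :> K ; _ : ringint_val \in @algint K }.

HB.instance Definition _ (K : fieldExtType rat) :=
  [isSub for @ringint_val K].
HB.instance Definition _ (K : fieldExtType rat) :=
  [Choice of ringint K by <:].
HB.instance Definition _ (K : fieldExtType rat) :=
  [SubChoice_isSubComNzRing of ringint K by <:].

Definition ringint_unit (K : fieldExtType rat) : {pred ringint K} :=
  fun u => (val u != 0) && ((val u)^-1 \in @algint K).

Definition ringint_inv (K : fieldExtType rat) (u : ringint K) : ringint K :=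
  insubd u (val u)^-1.

Lemma ringint_mulVx (K : fieldExtType rat) :
  {in @ringint_unit K, left_inverse 1 (@ringint_inv K) *%R}.
Proof.
move=> u /andP[u0 ui]; apply: val_inj; rewrite rmorphM rmorph1 /=.
by rewrite /ringint_inv val_insubd ui mulVf.
Qed.

Lemma ringint_unitPl (K : fieldExtType rat) (u w : ringint K) :
  w * u = 1 -> ringint_unit u.
Proof.
move=> wu1; have wu : val w * val u = 1 := congr1 val wu1.
have u0 : val u != 0.
  by apply/eqP => u0; move/eqP: wu; rewrite u0 mulr0 eq_sym oner_eq0.
rewrite /ringint_unit u0 /=.
by rewrite -[_^-1]mul1r -wu mulfK //; exact: valP.
Qed.

Lemma ringint_inv_out (K : fieldExtType rat) :
  {in [predC @ringint_unit K], @ringint_inv K =1 id}.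
Proof.
move=> u; rewrite inE /= => nu; apply: val_inj.
rewrite /ringint_inv val_insubd; case: ifPn => // ui.
move: nu; rewrite unfold_in /= /ringint_unit ui andbT negbK => /eqP ->.
by rewrite invr0.
Qed.

HB.instance Definition _ (K : fieldExtType rat) :=
  GRing.ComNzRing_hasMulInverse.Build (ringint K)
    (@ringint_mulVx K) (@ringint_unitPl K) (@ringint_inv_out K).

Section UnitRank.
Variable K : fieldExtType rat.

Definition indep_units (n : nat) (u : 'I_n -> ringint K) : Prop :=
  (forall i, u i \is a GRing.unit) /\
  (forall z : 'I_n -> int, \prod_(i < n) u i ^ z i = 1 -> forall i, z i = 0).

(* The rank of an abelian group is the maximal size of a Z-independent family. *)
Definition unit_group_rank (r : nat) : Prop :=
  (exists u : 'I_r -> ringint K, indep_units u) /\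
  (forall (n : nat) (u : 'I_n -> ringint K), indep_units u -> (n <= r)%N).

End UnitRank.

Section Ideals.
Variable K : fieldExtType rat.
Implicit Types (I J P : set (ringint K)).

(* As usual in a Dedekind domain, the prime ideals are the nonzero ones. *)
Definition prime_ideal P : Prop :=
  [/\ idealr_closed [in P], prime_idealr_closed [in P] & P <> [set 0]].

Definition ideal_mul I J : set (ringint K) :=
  [set x | exists n (a b : 'I_n -> ringint K),
     [/\ forall i, I (a i), forall i, J (b i) & x = \sum_(i < n) a i * b i]].

Definition ideal_prod (s : seq (set (ringint K))) : set (ringint K) :=
  foldr ideal_mul setT s.

(* The fractional ideal x O_K factors as the product of the primes in s times
   the inverses of the primes in t, with multiplicity. *)
Definition fractional_factorization (x : K)
    (s t : seq (set (ringint K))) : Prop :=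
  (forall P, P \in s ++ t -> prime_ideal P) /\
  [set x * val y | y in ideal_prod t] = [set val y | y in ideal_prod s].

(* v_P(x), meaningful only for x <> 0. *)
Definition prime_val P (x : K) : int :=
  xget 0 [set m : int | exists s t, fractional_factorization x s t /\
    m = (count_mem P s)%:Z - (count_mem P t)%:Z].

Definition residue_class P (a : ringint K) : set (ringint K) :=
  [set b | P (b - a)].

(* |A mod P| *)
Definition card_mod P (A : set (ringint K)) : nat :=
  #|` fset_set (residue_class P @` A)|.

(* NP = |O_K / P| *)
Definition ideal_norm P : nat := card_mod P setT.

Definition residue_char P : nat :=
  xget 0%N [set p : nat | prime p /\ P p%:R].

Definition ramification_index P : int := prime_val P (residue_char P)%:R.

End Ideals.

Section Places.
Variables (R : realType) (K : fieldExtType rat).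

Definition arch_abs (sigma : {rmorphism K -> R[i]}) (x : K) : R :=
  Normc.normc (sigma x).

Definition nonarch_abs (P : set (ringint K)) (x : K) : R :=
  if x == 0 then 0
  else (residue_char P)%:R `^
         (- ((prime_val P x)%:~R / (ramification_index P)%:~R)).

(* A place is identified with its normalized absolute value; in particular two
   conjugate embeddings define the same place. *)
Definition places : set (K -> R) :=
  [set v | (exists sigma : {rmorphism K -> R[i]}, v = arch_abs sigma) \/
           (exists P, prime_ideal P /\ v = nonarch_abs P)].

End Places.

Section LocalDegree.
Variable R : realType.

Definition absolute_value (L : fieldType) (v : L -> R) : Prop :=
  [/\ forall x, 0 <= v x,
      forall x, v x = 0 <-> x = 0,
      forall x y, v (x * y) = v x * v y &
      forall x y, v (x + y) <= v x + v y].

Definition abs_complete (L : fieldType) (v : L -> R) : Prop :=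
  forall u : nat -> L,
    (forall e : R, 0 < e -> exists N, forall m n,
       (N <= m)%N -> (N <= n)%N -> v (u m - u n) < e) ->
    exists l, forall e : R, 0 < e -> exists N, forall n,
       (N <= n)%N -> v (u n - l) < e.

Definition abs_closure (L : fieldType) (v : L -> R) (S : set L) : set L :=
  [set x | forall e : R, 0 < e -> exists2 y, S y & v (x - y) < e].

(* (L, w) is the completion K_v, with K embedded by iota. *)
Definition is_completion (K : fieldType) (v : K -> R)
    (L : fieldType) (w : L -> R) (iota : {rmorphism K -> L}) : Prop :=
  [/\ absolute_value w, abs_complete w, forall x, w (iota x) = v x &
      abs_closure w (range iota) = setT].

(* [L : F] = n for a subset F that is a subfield of L. *)
Definition has_degree (L : fieldType) (F : set L) (n : nat) : Prop :=
  exists b : 'I_n -> L, forall x : L,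
    exists! c : {ffun 'I_n -> L},
      (forall i, F (c i)) /\ x = \sum_(i < n) c i * b i.

(* n_v = [K_v : Q_v], where Q_v is the closure of Q in K_v. *)
Definition local_degree (K : fieldExtType rat) (v : K -> R) : nat :=
  xget 0%N [set n : nat |
    exists (L : fieldType) (w : L -> R) (iota : {rmorphism K -> L}),
      is_completion v w iota /\
      has_degree (abs_closure w (range (ratr : rat -> L))) n].

(* All but finitely many factors are 1, so this finitely supported product is
   the product over all places. *)
Definition height (K : fieldExtType rat) (x : K) : R :=
  \big[*%R/1]_(v \in @places R K) Num.max 1 (v x ^+ local_degree v).

End LocalDegree.

(* Main.v *)
(* Gallagher's larger sieve. If distinct elements of a finite set A of integers
   have differences of norm at most M, the primes containing a - b have norms
   whose product is at most M; counting congruent pairs modulo all P with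
   c < NP <= Q by Cauchy-Schwarz gives |A| = O(M^alpha) for a suitable
   Q = O(M^alpha), provided the sum of ln NP / NP over NP <= Q is at least
   ln Q - O(1). That bound follows from estimating the sum of ln |N x| over a
   box of lattice points x of O_K from below through the embeddings, and from
   above prime by prime.

   Integers of height at most H are classified by the dyadic size of all but
   one of their archimedean absolute values. Two elements of a class differ by
   an element of norm at most 3^n H, so the sieve bounds each class by
   O(H^alpha). There are O((ln H)^m) classes, m + 1 being the number of
   archimedean places, and m <= r: the pigeonhole principle produces for each
   place a unit of absolute value less than 1 at all the others, and any m of
   these units are independent. *)

From HB Require Import structures.
Require Import Defs.
From mathcomp Require Import all_boot all_order all_algebra all_field.
From mathcomp Require Import mathcomp_extra boolp classical_sets functions.
From mathcomp Require Import cardinality fsbigop reals exp.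
From mathcomp Require Import sequences.
From mathcomp Require Import finmap complex ring lra zify.

Set Implicit Arguments.
Unset Strict Implicit.
Unset Printing Implicit Defensive.

Import Order.TTheory GRing.Theory Num.Theory.

Local Open Scope complex_scope.
Local Open Scope classical_set_scope.
Local Open Scope ring_scope.

Local Notation nc := (@Normc.normc _).

(** * Complex embeddings *)

(** Finite index plays the part of the chain condition: strict inclusion of nonzero ideals lowers
    [ideal_norm], and the factorization of ideals, the inverses of primes and the integrality
    arguments rest on this descent.

    The delicate point of the Mertens bound is the count of box points in a prime P. Powers P^k with
    k >= 2 tolerate a constant factor, because the sum of ln NP / NP^2 converges. For k = 1 the
    density must be 1/NP with coefficient exactly 1: a larger coefficient would weaken the bound to
    a fraction of ln Q and spoil the exponent alpha. Hence the classes modulo P receive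
    representatives in a box of side O(NP^(1/n)), and the relative error O(NP^(1/n) / X) is summed
    over NP <= (C X)^n by a Chebyshev bound and summation by parts, for a total of O(1).

    The height enters through its lower bound by the product of max(1, |x|) over all complex
    embeddings. As [local_degree] and [prime_val] are values chosen by [xget], the facts behind it
    are proved for every completion and for every factorization. *)

Definition deg (K : fieldExtType rat) : nat := \dim {:K}.

Lemma deg_gt0 (K : fieldExtType rat) : (0 < deg K)%N.
Proof. exact: adim_gt0. Qed.

Section ComplexNorm.
Variable R : realType.
Implicit Types z : R[i].

Lemma normcR z : `|z| = (nc z)%:C.
Proof. by rewrite normc_def; case: z. Qed.

Lemma nc_ge0 z : 0 <= nc z.
Proof. by case: z => a b /=; rewrite sqrtr_ge0. Qed.

Lemma nc_eq0 z : (nc z == 0) = (z == 0).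
Proof.
apply/eqP/eqP => [/Normc.eq0_normc //|->]; exact: Normc.normc0.
Qed.

Lemma nc_gt0 z : (0 < nc z) = (z != 0).
Proof. by rewrite lt_def nc_ge0 andbT nc_eq0. Qed.

Lemma nc0 : nc (0 : R[i]) = 0. Proof. exact: Normc.normc0. Qed.
Lemma nc1 : nc (1 : R[i]) = 1. Proof. exact: Normc.normc1. Qed.

Lemma nc_prod (I : Type) (s : seq I) (F : I -> R[i]) :
  nc (\prod_(i <- s) F i) = \prod_(i <- s) nc (F i).
Proof.
by elim/big_rec2: _ => [|i x y _ <-]; rewrite ?nc1 ?Normc.normcM.
Qed.

Lemma ncD z1 z2 : nc (z1 + z2) <= nc z1 + nc z2.
Proof. by have := ler_normD z1 z2; rewrite !normcR -rmorphD lecR. Qed.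

Lemma ncN z : nc (- z) = nc z.
Proof. by case: z => a b /=; rewrite !sqrrN. Qed.

Lemma nc_sum (I : Type) (s : seq I) (F : I -> R[i]) :
  nc (\sum_(i <- s) F i) <= \sum_(i <- s) nc (F i).
Proof.
elim/big_rec2: _ => [|i x y _ h]; rewrite ?nc0 //.
by apply: le_trans (ncD _ _) _; rewrite lerD2l.
Qed.

Lemma nc_real (x : R) : nc (x%:C : R[i]) = `|x|.
Proof. by rewrite /= expr0n /= addr0 sqrtr_sqr. Qed.

Lemma ratrC (q : rat) : ratr q = (ratr q : R)%:C :> R[i].
Proof.
by rewrite -[LHS](fmorph_eq_rat (@real_complex R \o ratr)).
Qed.

Lemma nc_int (m : int) : nc (m%:~R : R[i]) = `|m|%:~R.
Proof. by rewrite -(rmorph_int (@real_complex R)) nc_real -intr_norm. Qed.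

Lemma nc_nat (m : nat) : nc (m%:R : R[i]) = m%:R.
Proof. by rewrite -(rmorph_nat (@real_complex R)) nc_real ger0_norm. Qed.

Lemma ge_Re_nc z : `|complex.Re z| <= nc z.
Proof.
case: z => a b /=; rewrite -sqrtr_sqr ler_wsqrtr // lerDl sqr_ge0 //.
Qed.

Lemma ge_Im_nc z : `|complex.Im z| <= nc z.
Proof.
case: z => a b /=; rewrite -sqrtr_sqr ler_wsqrtr // lerDr sqr_ge0 //.
Qed.

Lemma nc_conj z : nc (z^*)%C = nc z.
Proof. by case: z => a b /=; rewrite sqrrN. Qed.

End ComplexNorm.

Lemma primitive_element (K : fieldExtType rat) :
  exists (t : K) (p : {poly rat}),
  [/\ p \is monic, size p = (deg K).+1, separable_poly p,
      forall q, root (map_poly (in_alg K) q) t = (p %| q) &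
      forall x, exists q, x = (map_poly (in_alg K) q).[t]].
Proof.
have pcharQ : [pchar K] =i pred0 := ftrans (pchar_lalg K) (pchar_num _).
have sepQ : separable (1%AS : {subfield K}) {:K}.
  by apply/separableP=> u _; apply: pcharf0_separable.
pose t := separable_generator 1 {:K}.
have gen : (<<1; t>> = {:K})%VS.
  by rewrite -eq_adjoin_separable_generator ?sub1v.
have /polyOver1P [p Dp] := minPolyOver (1%AS : {subfield K}) t.
have sz : size p = (deg K).+1.
  rewrite -(size_map_poly (in_alg K)) -Dp size_minPoly /deg -gen.
  by rewrite dim_Fadjoin dimv1 muln1.
exists t, p; split => //.
- by rewrite -(map_monic (in_alg K)) -Dp monic_minPoly.
- rewrite -(separable_map (in_alg K)) -Dp.
  exact: separable_generatorP.
- move=> q; apply/idP/idP => [rq|].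
    rewrite -(dvdp_map (in_alg K)) -Dp; apply: minPoly_dvdp => //.
    exact: alg_polyOver.
  rewrite -(dvdp_map (in_alg K)) -Dp => d.
  apply: root_dvdp d _; exact: root_minPoly.
- move=> x; have : x \in <<1; t>>%VS by rewrite gen memvf.
  by move/Fadjoin1_polyP.
Qed.

Section Embeddings.
Variables (R : realType) (K : fieldExtType rat).

Lemma emb_horner (s : {rmorphism K -> R[i]}) (q : {poly rat}) t :
  s (map_poly (in_alg K) q).[t] = (map_poly ratr q).[s t].
Proof.
rewrite -horner_map -map_poly_comp; congr horner.
by apply: eq_map_poly => a /=; rewrite -(fmorph_eq_rat (s \o in_alg K)).
Qed.

(** Embeddings correspond to the complex roots of the minimal polynomial p of a primitive element t.
    As p is separable there are deg K of them, taking distinct values at t, and this gives their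
    linear independence. *)
Lemma embeddings_exist :
  exists e : 'I_(deg K) -> {rmorphism K -> R[i]},
  [/\ forall s : {rmorphism K -> R[i]}, exists i, s =1 e i,
      forall c : 'I_(deg K) -> R[i],
        (forall x, \sum_i c i * e i x = 0) -> forall i, c i = 0 &
      exists t : K, forall i j, e i t = e j t -> i = j].
Proof.
have [t [p [pmon psz psep pt gen]]] := primitive_element K.
have ex_emb z : root (map_poly ratr p) z ->
    exists s : {rmorphism K -> R[i]}, s t = z.
  move=> rz.
  have [rep repE] := choice gen.
  have wd q1 q2 : (map_poly (in_alg K) q1).[t] = (map_poly (in_alg K) q2).[t] ->
      (map_poly ratr q1).[z] = (map_poly ratr q2).[z] :> R[i].
    move=> eq12; apply/eqP; rewrite -subr_eq0 -hornerN -hornerD -rmorphB /=.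
    rewrite -/(root _ _); have : p %| q1 - q2.
      by rewrite -pt /root rmorphB /= hornerD hornerN eq12 subrr.
    by rewrite -(dvdp_map (ratr : rat -> R[i])) => /root_dvdp; apply.
  pose f x : R[i] := (map_poly ratr (rep x)).[z].
  have fE q : f (map_poly (in_alg K) q).[t] = (map_poly ratr q).[z].
    by apply: wd; rewrite -repE.
  have fB : zmod_morphism f.
    move=> x y; rewrite {1}(repE x) {1}(repE y) -hornerN -hornerD -rmorphB /=.
    by rewrite fE rmorphB /= hornerD hornerN.
  have fM : monoid_morphism f.
    split.
      have -> : (1 : K) = (map_poly (in_alg K) 1).[t] by rewrite rmorph1 hornerC.
      by rewrite fE rmorph1 hornerC.
    move=> x y; rewrite {1}(repE x) {1}(repE y) -hornerM -rmorphM /=.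
    by rewrite fE rmorphM /= hornerM.
  pose faM := GRing.isZmodMorphism.Build _ _ _ fB.
  pose fmM := GRing.isMonoidMorphism.Build _ _ _ fM.
  pose fRM : {rmorphism K -> R[i]} := HB.pack f faM fmM.
  exists fRM => /=.
  have {1}-> : t = (map_poly (in_alg K) 'X).[t] by rewrite map_polyX hornerX.
  by rewrite fE map_polyX hornerX.
have [r Dr] := closed_field_poly_normal (map_poly ratr p : {poly R[i]}).
have pm : map_poly (ratr : rat -> R[i]) p \is monic by rewrite map_monic.
rewrite (monicP pm) scale1r in Dr.
have szr : size r = deg K.
  apply: succn_inj; rewrite -psz -(size_map_poly (ratr : rat -> R[i])) Dr.
  by rewrite size_prod_XsubC.
have ur : uniq r.
  by rewrite -separable_prod_XsubC -Dr separable_map.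
have rr (i : 'I_(deg K)) : root (map_poly ratr p) r`_i.
  by rewrite Dr root_prod_XsubC mem_nth // szr.
have [e et] := choice (fun i => ex_emb _ (rr i)).
have einj i j : e i t = e j t -> i = j.
  rewrite !et => /eqP; rewrite nth_uniq ?szr // => /eqP; exact: val_inj.
exists e; split; last by exists t.
- move=> s; have : root (map_poly ratr p) (s t).
    rewrite /root -emb_horner; have : root (map_poly (in_alg K) p) t.
      by rewrite pt.
    by rewrite /root => /eqP ->; rewrite rmorph0.
  rewrite Dr root_prod_XsubC => sr; have [j] := nthP 0 sr; rewrite szr => ilt eqj.
  exists (Ordinal ilt) => x; have [q ->] := gen x.
  by rewrite !emb_horner et /= eqj.
- move=> c cP i.
  have cq (q : {poly R[i]}) : \sum_j c j * q.[e j t] = 0.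
    transitivity (\sum_j \sum_(k < size q) q`_k * (c j * e j (t ^+ k))).
      apply: eq_bigr => j _; rewrite horner_coef mulr_sumr; apply: eq_bigr => k _.
      by rewrite rmorphXn /=; ring.
    rewrite exchange_big big1 // => k _.
    by rewrite -mulr_sumr cP mulr0.
  (* Lagrange interpolation: this polynomial vanishes at every [e j t] with j different from i and
     isolates [c i]. *)
  have := cq (\prod_(j | j != i) ('X - (e j t)%:P)).
  rewrite [X in X = _ -> _](bigD1 i) //= [X in _ + X]big1 ?addr0 => [|j ji].
    move/eqP; rewrite mulf_eq0 horner_prod => /orP[/eqP //|].
    rewrite prodf_seq_eq0 => /hasP[j _ /andP[ji]].
    by rewrite hornerXsubC subr_eq0 => /eqP/einj ij; rewrite ij eqxx in ji.
  by rewrite horner_prod (bigD1 j) //= hornerXsubC subrr mul0r mulr0.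
Qed.

Definition emb : 'I_(deg K) -> {rmorphism K -> R[i]} := sval (cid embeddings_exist).

Lemma embP (s : {rmorphism K -> R[i]}) : exists i, s =1 emb i.
Proof. by rewrite /emb; case: cid => e [h ? ?] /=; exact: h. Qed.

Lemma emb_indep (c : 'I_(deg K) -> R[i]) :
  (forall x, \sum_i c i * emb i x = 0) -> forall i, c i = 0.
Proof. by rewrite /emb; case: cid => e [? h ?] /=; exact: h. Qed.

Lemma emb_inj : exists t : K, forall i j, emb i t = emb j t -> i = j.
Proof. by rewrite /emb; case: cid => e [? ? h] /=; exact: h. Qed.

End Embeddings.

(** * Integral bases and the norm *)

Section RationalIntegers.

(** Gauss's lemma: the factor X - q of a monic integer polynomial is a rational multiple of an
    integer polynomial whose leading coefficient is a unit, and the constant term of the latter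
    gives q. *)
Lemma monic_root_int (p : {poly int}) (q : rat) :
  p \is monic -> root (map_poly intr p) q -> exists m : int, q = m%:~R.
Proof.
move=> pm; rewrite -dvdp_XsubCl => /dvdpP_rat_int [p1 [a a0 Dp1] [s Dp]].
have l1 : lead_coef p1 * lead_coef s = 1 by rewrite -lead_coefM -Dp (monicP pm).
have al : a * (lead_coef p1)%:~R = 1.
  have := lead_coefXsubC q; rewrite Dp1 lead_coefZ lead_coef_map_inj //.
  exact: intr_inj.
have Da : a = (lead_coef s)%:~R.
  have l1q := congr1 (intr : int -> rat) l1; rewrite rmorphM /= in l1q.
  have p10 : (lead_coef p1)%:~R != 0 :> rat.
    by apply/eqP => z; rewrite z mulr0 in al; move: al; apply/eqP; rewrite eq_sym oner_eq0.
  by apply: (mulIf p10); rewrite al mulrC l1q.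
exists (- (lead_coef s * p1`_0)).
have := congr1 (fun r : {poly rat} => r`_0) Dp1.
rewrite coefB coefX coefC /= sub0r coefZ coef_map /= Da => h.
by rewrite rmorphN /= rmorphM /= -h opprK.
Qed.

Lemma integral_rat_int (F : numFieldType) (q : rat) :
  integralOver (intr : int -> F) (ratr q) -> exists m : int, q = m%:~R.
Proof.
case=> p pm; have -> : map_poly (intr : int -> F) p = map_poly ratr (map_poly (intr : int -> rat) p).
  by rewrite -map_poly_comp; apply: eq_map_poly => m /=; rewrite ratr_int.
by rewrite fmorph_root; apply: monic_root_int.
Qed.

Lemma integral_multiple (K : fieldExtType rat) (x : K) :
  exists2 d : int, d != 0 & d%:~R * x \in @algint K.
Proof.
have : integralOver (in_alg K) x.
  have /polyOver1P [p Dp] := minPolyOver (1%AS : {subfield K}) x.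
  exists p; last by rewrite -Dp root_minPoly.
  by rewrite -(map_monic (in_alg K)) -Dp monic_minPoly.
case=> p pm rp; have [q [a a0 Dq]] := rat_poly_scale p.
have a0q : a%:~R != 0 :> rat by rewrite intr_eq0.
have qE i : (q`_i)%:~R = a%:~R * p`_i.
  by rewrite Dq coefZ coef_map /= mulrA divff // mul1r.
have p0 : (0 < size p)%N by rewrite size_poly_gt0 monic_neq0.
exists a => //; apply/asboolP.
pose m := (size p).-1.
(* With q = a p of leading coefficient a, this is a^(m-1) q(X/a): monic, with integer coefficients,
   and with root a x. *)
exists (\poly_(i < m.+1) (if (i == m :> nat) then 1 else a ^+ (m - i).-1 * q`_i)).
  apply/monicP; rewrite lead_coef_poly ?eqxx //.
pose P := map_poly (intr : int -> K)
  (\poly_(i < m.+1) (if (i == m :> nat) then 1 else a ^+ (m - i).-1 * q`_i)).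
have szP : (size P <= m.+1)%N.
  by apply: leq_trans (size_poly _ _) _; exact: size_poly.
have szp : size (map_poly (in_alg K) p) = m.+1 by rewrite size_map_poly prednK.
rewrite -/P /root (horner_coef_wide _ szP).
suff -> : \sum_(i < m.+1) P`_i * (a%:~R * x) ^+ i =
          a%:~R ^+ m * (map_poly (in_alg K) p).[x].
  by rewrite (eqP rp) mulr0.
rewrite horner_coef szp mulr_sumr; apply: eq_bigr => i _.
rewrite !coef_map /= coef_poly ltn_ord exprMn; case: ifPn => [/eqP ->|im].
  have -> : p`_m = 1 by move/monicP: pm.
  by rewrite scale1r !mul1r.
have {}im : (i < m)%N by rewrite ltn_neqAle im -ltnS ltn_ord.
have qiE : (q`_i)%:~R = a%:~R * in_alg K p`_i :> K.
  have := congr1 (in_alg K) (qE i).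
  by rewrite rmorphM /= -!/(in_alg K _) !rmorph_int.
rewrite rmorphM rmorphXn /= qiE.
have -> : a%:~R ^+ m = a%:~R ^+ (m - i).-1 * a%:~R * a%:~R ^+ i :> K.
  by rewrite -exprSr prednK ?subn_gt0 // -exprD subnK // ltnW.
by rewrite /=; ring.
Qed.

End RationalIntegers.

Section IntegralBasis.
Variables (R : realType) (K : fieldExtType rat).
Local Notation n := (deg K).
Local Notation e := (@emb R K).

Lemma embZ i (q : rat) (x : K) : e i (q *: x) = ratr q * e i x.
Proof.
rewrite -mulr_algl rmorphM /= -[e i (q%:A)]/((e i \o in_alg K) q).
by rewrite (fmorph_eq_rat (e i \o in_alg K)).
Qed.

(** The square of its determinant is the discriminant of the family [w]. *)
Definition emb_mx (w : 'I_n -> K) : 'M[R[i]]_n := \matrix_(j, i) e i (w j).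

Lemma emb_mx_unit (w : 'I_n -> K) :
  (forall x, exists q : 'I_n -> rat, x = \sum_j q j *: w j) ->
  emb_mx w \in unitmx.
Proof.
move=> span; rewrite -unitmx_tr -row_free_unit -kermx_eq0.
apply/rowV0P => v /sub_kermxP vW; apply/rowP => i; rewrite mxE.
apply: (@emb_indep R K (fun i => v 0 i)) => x; have [q ->] := span x.
under eq_bigr do rewrite rmorph_sum mulr_sumr.
rewrite exchange_big big1 // => j _.
have := congr1 (fun M : 'rV_n => ratr (q j) * M 0 j) vW.
rewrite !mxE mulr0 mulr_sumr => h; rewrite -[RHS]h.
by apply: eq_bigr => k _; rewrite !mxE embZ; ring.
Qed.

Lemma emb_mx_span (w : 'I_n -> K) : \det (emb_mx w) != 0 ->
  forall x, exists q : 'I_n -> rat, x = \sum_j q j *: w j.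
Proof.
move=> d0 x; pose X := [tuple w j | j < n].
have fX : free X.
  apply/freeP => k kX j.
  have : \row_j ratr (k j) *m emb_mx w = 0.
    apply/rowP => i; rewrite !mxE; have := congr1 (e i) kX.
    rewrite rmorph0 rmorph_sum => h; rewrite -[RHS]h; apply: eq_bigr => l _.
    by rewrite !mxE embZ (nth_map l) ?size_enum_ord // nth_ord_enum.
  have U : emb_mx w \in unitmx by rewrite unitmxE unitfE.
  move/(congr1 (mulmxr (invmx (emb_mx w)))); rewrite /= mulmxK // mul0mx.
  by move/rowP/(_ j); rewrite !mxE => /eqP; rewrite fmorph_eq0 => /eqP.
have bX : basis_of {:K} X.
  by rewrite basisEfree fX subvf size_tuple leqnn.
have xX : x \in <<X>>%VS by rewrite (span_basis bX) memvf.
exists (fun j => coord X j x); rewrite {1}(coord_span xX).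
by apply: eq_bigr => j _; rewrite (nth_map j) ?size_enum_ord // nth_ord_enum.
Qed.

(** The sum is the trace of x: [emb_mx] of a Q-basis conjugates the rational matrix of
    multiplication by x to the diagonal matrix of the values [e i x]. *)
Lemma emb_sum_rat (x : K) : exists q : rat, \sum_i e i x = ratr q.
Proof.
pose w (j : 'I_n) : K := (vbasis {:K})`_j.
have span y : y = \sum_j coord (vbasis {:K}) j y *: w j.
  by apply: coord_vbasis; rewrite memvf.
have U : emb_mx w \in unitmx.
  apply: emb_mx_unit => y; exists (fun j => coord (vbasis {:K}) j y); exact: span.
pose M : 'M[rat]_n := \matrix_(j, k) coord (vbasis {:K}) k (x * w j).
pose D := diag_mx (\row_i e i x).
have MW : map_mx ratr M *m emb_mx w = emb_mx w *m D.
  apply/matrixP => j i; rewrite mul_mx_diag !mxE -rmorphM mulrC (span (x * w j)).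
  by rewrite rmorph_sum; apply: eq_bigr => k _; rewrite !mxE embZ.
exists (\tr M); rewrite -(trace_map_mx (ratr : {rmorphism rat -> R[i]})).
have <- : \tr D = \sum_i e i x by rewrite mxtrace_diag; apply: eq_bigr => i _; rewrite mxE.
have -> : D = invmx (emb_mx w) *m (map_mx ratr M *m emb_mx w) by rewrite MW mulKmx.
by rewrite mxtrace_mulC -mulmxA mulmxV // mulmx1.
Qed.

Lemma emb_integral i (x : K) : x \in @algint K -> integralOver (intr : int -> R[i]) (e i x).
Proof.
move=> /asboolP [p pm rp]; exists p => //.
have -> : map_poly (intr : int -> R[i]) p = map_poly (e i) (map_poly intr p).
  by rewrite -map_poly_comp; apply: eq_map_poly => m /=; rewrite rmorph_int.
by rewrite fmorph_root.
Qed.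

Lemma emb_sum_int (x : K) : x \in @algint K -> exists m : int, \sum_i e i x = m%:~R.
Proof.
move=> xi; have [q qE] := emb_sum_rat x.
have : integralOver (intr : int -> R[i]) (ratr q).
  rewrite -qE; elim/big_ind: _ => [|y z|i _]; first exact: integral0.
    exact: integral_add.
  exact: emb_integral.
by move=> /integral_rat_int [m qm]; exists m; rewrite qE qm ratr_int.
Qed.

(** The squared determinant is the determinant of the trace form, whose entries are integers by
    [emb_sum_int]. *)
Lemma disc_int (w : 'I_n -> K) : (forall j, w j \in @algint K) ->
  exists m : int, \det (emb_mx w) ^+ 2 = m%:~R.
Proof.
move=> wi; have ww j k : exists m : int, \sum_i e i (w j * w k) = m%:~R.
  by apply: emb_sum_int; rewrite rpredM ?wi.
have /choice [T TE] : forall jk : 'I_n * 'I_n, exists m : int, \sum_i e i (w jk.1 * w jk.2) = m%:~R.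
  by case=> j k; apply: ww.
exists (\det (\matrix_(j, k) T (j, k))).
rewrite -det_map_mx expr2 -{2}det_tr -det_mulmx; congr determinant.
apply/matrixP => j k; rewrite !mxE; have /= <- := TE (j, k); apply: eq_bigr => i _.
by rewrite !mxE -rmorphM.
Qed.

(** Descent on the discriminant, a nonzero integer: if an integral x has a coordinate with
    fractional part f > 0 over the basis w, exchanging that basis vector for x minus an integer
    multiple of it multiplies the determinant by f < 1. *)
Lemma integral_basis :
  exists w : 'I_n -> ringint K, emb_mx (fun j => val (w j)) \in unitmx /\
    forall x : ringint K, exists c : 'I_n -> int, x = \sum_j w j *~ c j.
Proof.
suff [w [wi W wspan]] : exists w : 'I_n -> K, [/\ forall j, w j \in @algint K,
    emb_mx w \in unitmx & forall x, x \in @algint K -> exists c : 'I_n -> int, x = \sum_j w j *~ c j].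
  exists (fun j => RingInt (wi j)); split=> // x.
  have [c xc] := wspan (val x) (valP x); exists c; apply: val_inj.
  by rewrite xc raddf_sum; apply: eq_bigr => j _; rewrite raddfMz.
have [w0 [w0i W0]] : exists w : 'I_n -> K, (forall j, w j \in @algint K) /\ emb_mx w \in unitmx.
  have /choice [d dP] : forall j : 'I_n, exists d : int, d != 0 /\ d%:~R * (vbasis {:K})`_j \in @algint K.
    by move=> j; have [d d0 h] := integral_multiple (vbasis {:K})`_j; exists d.
  exists (fun j => (d j)%:~R * (vbasis {:K})`_j); split=> [j|]; first by case: (dP j).
  apply: emb_mx_unit => x; exists (fun j => coord (vbasis {:K}) j x / (d j)%:~R).
  rewrite {1}(coord_vbasis (memvf x)); apply: eq_bigr => j _.
  have d0 : (d j)%:~R != 0 :> rat by rewrite intr_eq0; case: (dP j).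
  have -> : ((d j)%:~R : K) = ((d j)%:~R : rat)%:A by rewrite scaler_int.
  by rewrite mulr_algl scalerA divfK.
have [m mE] := disc_int w0i.
elim/ltn_ind: {m}`|m|%N {-2}m (erefl `|m|%N) w0 w0i W0 mE => N IH m Nm w wi W mE.
have d0 : \det (emb_mx w) != 0 by rewrite -unitfE -unitmxE.
have [ok|/existsNP [x /not_implyP [xi nx]]] :=
  pselect (forall x, x \in @algint K -> exists c : 'I_n -> int, x = \sum_j w j *~ c j).
  by exists w.
have [q qE] := emb_mx_span d0 x.
have [j nj] : exists j, (Num.floor (q j))%:~R != q j.
  apply/existsP; rewrite -negb_forall; apply/forallP => h; apply: nx.
  exists (fun j => Num.floor (q j)); rewrite qE; apply: eq_bigr => j _.
  by rewrite -{1}(eqP (h j)) -scaler_int.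
pose f := q j - (Num.floor (q j))%:~R.
have f0 : 0 < f.
  by rewrite subr_gt0 lt_neqAle nj; case/andP: (floor_itv (q j)).
have f1 : f < 1.
  by rewrite ltrBlDl; case/andP: (floor_itv (q j)) => _; rewrite rmorphD /=.
pose w' k := if k == j then x - w j *~ Num.floor (q j) else w k.
have w'i k : w' k \in @algint K.
  rewrite /w'; case: eqP => _; last exact: wi.
  by rewrite rpredB // rpredMz ?wi.
(* Row j of [emb_mx w'] is f times row j of [emb_mx w] plus row j of [C], which depends linearly on
   the other rows. *)
pose C := \matrix_(k, i) (if k == j then \sum_(l | l != j) ratr (q l) * emb_mx w l i else emb_mx w k i).
have detC : \det C = 0.
  apply/eqP/det0P; exists (\row_k (if k == j then 1 else - ratr (q k))).
    by apply/eqP => /rowP/(_ j)/eqP; rewrite !mxE eqxx oner_eq0.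
  apply/rowP => i; rewrite !mxE (bigD1 j) //= !mxE eqxx mul1r -big_split /= big1 // => k kj.
  by rewrite !mxE (negPf kj) mulNr subrr.
have det' : \det (emb_mx w') = ratr f * \det (emb_mx w).
  rewrite (determinant_multilinear (A := emb_mx w') (B := emb_mx w) (C := C) (i0 := j) (b := ratr f) (c := 1)).
  - by rewrite detC mulr0 addr0.
  - apply/rowP => i; rewrite !mxE /w' eqxx rmorphB /= raddfMz /= qE rmorph_sum (bigD1 j) //=.
    rewrite embZ /f rmorphB /= ratr_int mulrBl mul1r -mulrzl addrAC; congr (_ + _).
    by apply: eq_bigr => l _; rewrite mxE embZ.
  - by apply/matrixP => k i; rewrite !mxE /w' eq_sym (negPf (neq_lift _ _)).
  - by apply/matrixP => k i; rewrite !mxE /w' eq_sym (negPf (neq_lift _ _)).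
have W' : emb_mx w' \in unitmx.
  by rewrite unitmxE unitfE det' mulf_neq0 // fmorph_eq0 lt0r_neq0.
have [m' m'E] := disc_int w'i.
apply: (IH `|m'|%N _ m' erefl w' w'i W' m'E).
have m0 : m != 0.
  by apply: contraNneq d0 => m0; move: mE; rewrite m0 => /eqP; rewrite sqrf_eq0.
rewrite -Nm -ltz_nat !abszE -(ltr_int rat) !intr_norm.
have -> : m'%:~R = f ^+ 2 * m%:~R :> rat.
  apply: (fmorph_inj (ratr : {rmorphism rat -> R[i]})).
  by rewrite rmorphM rmorphXn /= !ratr_int -mE -m'E det' exprMn.
rewrite normrM ger0_norm ?sqr_ge0 // gtr_pMl ?normr_gt0 ?intr_eq0 //.
by rewrite expr_lt1 // ltW.
Qed.

End IntegralBasis.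

Section Coordinates.
Variables (R : realType) (K : fieldExtType rat).
Local Notation n := (deg K).
Local Notation e := (@emb R K).
Local Notation O := (ringint K).

Definition bas : 'I_n -> O := sval (cid (integral_basis R K)).

Lemma bas_unit : emb_mx R (fun j => val (bas j)) \in unitmx.
Proof. by rewrite /bas; case: cid => w []. Qed.

Lemma bas_span (x : O) : exists c : 'I_n -> int, x = \sum_j bas j *~ c j.
Proof. by rewrite /bas; case: cid => w [? h] /=; exact: h. Qed.

Definition ofc (c : 'rV[int]_n) : O := \sum_j bas j *~ c 0 j.

Lemma ofcB c d : ofc (c - d) = ofc c - ofc d.
Proof.
by rewrite /ofc -sumrB; apply: eq_bigr => j _; rewrite !mxE mulrzBr.
Qed.

HB.instance Definition _ := GRing.isZmodMorphism.Build _ _ ofc ofcB.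

Lemma emb_ofc i c : e i (val (ofc c)) = \sum_j (c 0 j)%:~R * e i (val (bas j)).
Proof.
rewrite /ofc !raddf_sum; apply: eq_bigr => j _.
by rewrite !raddfMz /= -mulrzl.
Qed.

Lemma ofc_inj : injective ofc.
Proof.
move=> c d /eqP; rewrite -subr_eq0 -raddfB => /eqP cd0; apply/eqP.
rewrite -subr_eq0; move: {c d}(c - d) cd0 => c c0; apply/eqP.
have : map_mx (intr : int -> R[i]) c *m emb_mx R (fun j => val (bas j)) = 0.
  apply/rowP => i; have := emb_ofc i c; rewrite c0 !raddf0 => h.
  by rewrite !mxE [RHS]h; apply: eq_bigr => j _; rewrite !mxE.
move/(congr1 (mulmxr (invmx (emb_mx R (fun j => val (bas j)))))).
rewrite /= mulmxK ?bas_unit // mul0mx => /rowP c00; apply/rowP => j.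
by have /eqP := c00 j; rewrite !mxE intr_eq0 => /eqP.
Qed.

Lemma zcoord_ex (x : O) : exists c, ofc c = x.
Proof.
have [c ->] := bas_span x; exists (\row_j c j).
by rewrite /ofc; apply: eq_bigr => j _; rewrite mxE.
Qed.

Definition zcoord (x : O) : 'rV[int]_n := sval (cid (zcoord_ex x)).

Lemma zcoordK : cancel zcoord ofc.
Proof. by move=> x; rewrite /zcoord; case: cid. Qed.

Lemma ofcK : cancel ofc zcoord.
Proof. by move=> c; apply: ofc_inj; rewrite zcoordK. Qed.

Lemma zcoordB x y : zcoord (x - y) = zcoord x - zcoord y.
Proof. by apply: ofc_inj; rewrite raddfB /= !zcoordK. Qed.

HB.instance Definition _ := GRing.isZmodMorphism.Build _ _ zcoord zcoordB.

Definition mulmat (x : O) : 'M[int]_n := \matrix_j zcoord (bas j * x).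

Lemma zcoordM y x : zcoord (y * x) = zcoord y *m mulmat x.
Proof.
rewrite -{1}(zcoordK y) /ofc mulr_suml raddf_sum; apply/rowP => k.
rewrite summxE mxE; apply: eq_bigr => j _.
by rewrite mxE mulrzAl raddfMz /= -scaler_int mxE intz.
Qed.

(** The absolute norm |N(x)|, a natural number so that it can be compared with indices of ideals. *)
Definition nrm (x : O) : nat := `|\det (mulmat x)|%N.

(** The embedding matrix of the basis diagonalizes all multiplication matrices at once, so that the
    norm becomes the product of the conjugates. *)
Lemma mulmat_emb x :
  map_mx intr (mulmat x) *m emb_mx R (fun j => val (bas j)) =
  emb_mx R (fun j => val (bas j)) *m diag_mx (\row_i e i (val x)).
Proof.
apply/matrixP => j i; rewrite mul_mx_diag !mxE -rmorphM -[val _ * val x]/(val (bas j * x)).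
have := emb_ofc i (zcoord (bas j * x)); rewrite zcoordK => ->; apply: eq_bigr => k _.
by rewrite !mxE.
Qed.

Lemma det_mulmat x : (\det (mulmat x))%:~R = \prod_i e i (val x).
Proof.
have U := bas_unit; have := congr1 determinant (mulmat_emb x).
rewrite !det_mulmx det_map_mx det_diag => h.
rewrite unitmxE unitfE in U; apply: (mulIf U); rewrite h mulrC; congr (_ * _).
by apply: eq_bigr => i _; rewrite mxE.
Qed.

Lemma nrmE x : (nrm x)%:R = \prod_i nc (e i (val x)) :> R.
Proof.
by rewrite -nc_prod -det_mulmat nc_int /nrm natr_absz.
Qed.

Lemma nrm_gt0 x : (0 < nrm x)%N = (x != 0).
Proof.
rewrite -(ltr_nat R) nrmE; case: (eqVneq x 0) => [->|x0].
  rewrite (bigD1 (Ordinal (deg_gt0 K))) //=.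
  by rewrite (rmorph0 (e _)) nc0 mul0r ltxx.
apply: prodr_gt0 => i _; rewrite nc_gt0 fmorph_eq0.
by apply: contra x0 => /eqP h; apply/eqP/val_inj.
Qed.

(** The adjugate of the multiplication matrix provides an integral cofactor y with x y = N(x); the
    sign is then adjusted. *)
Lemma nrm_mem x : exists y, (nrm x)%:R = x * y.
Proof.
pose y := ofc (zcoord 1 *m \adj (mulmat x)).
have xy : x * y = (\det (mulmat x))%:~R.
  apply: (can_inj zcoordK); rewrite mulrC zcoordM ofcK -mulmxA mul_adj_mx.
  by rewrite mul_mx_scalar -[_%:~R]mul1r mulrzr raddfMz -scaler_int intz.
rewrite /nrm; case: (intP (\det (mulmat x))) xy => [|m|m] xy.
- by exists 0; rewrite mulr0.
- by exists y; rewrite xy.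
- by exists (- y); rewrite mulrN xy rmorphN opprK.
Qed.

End Coordinates.

Arguments nrm R {K} x.

(** * Finite index of nonzero ideals *)

Section Index.
Variables (R : realType) (K : fieldExtType rat).
Local Notation n := (deg K).
Local Notation O := (ringint K).
Implicit Types (I J P : set O).

(** Unlike [idealr_closed], this admits the unit ideal, which occurs as an empty product or
    intersection. *)
Definition ideal I := [/\ I 0, forall x y, I x -> I y -> I (x + y) &
  forall a x, I x -> I (a * x)].

Lemma ideal0 I : ideal I -> I 0. Proof. by case. Qed.
Lemma idealD I x y : ideal I -> I x -> I y -> I (x + y).
Proof. by case=> _ h _; apply: h. Qed.
Lemma idealMl I a x : ideal I -> I x -> I (a * x).
Proof. by case=> _ _ h; apply: h. Qed.
Lemma idealMr I a x : ideal I -> I x -> I (x * a).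
Proof. by move=> iI Ix; rewrite mulrC; apply: idealMl. Qed.
Lemma idealN I x : ideal I -> I x -> I (- x).
Proof. by move=> iI Ix; rewrite -mulN1r; apply: idealMl. Qed.
Lemma idealB I x y : ideal I -> I x -> I y -> I (x - y).
Proof. by move=> iI Ix Iy; apply: idealD => //; apply: idealN. Qed.

(** The quotient by I is presented by a classifying map and a system of representatives, so that
    comparisons of indices become injections between ordinals. *)
Definition has_index I (N : nat) := exists (f : O -> 'I_N) (g : 'I_N -> O),
  cancel g f /\ forall x y, f x = f y <-> I (x - y).

Lemma has_indexT I (T : finType) (f : O -> T) (g : T -> O) :
  cancel g f -> (forall x y, f x = f y <-> I (x - y)) -> has_index I #|T|.
Proof.
move=> gK fI; exists (fun x => enum_rank (f x)), (fun i => g (enum_val i)).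
split=> [i|x y]; first by rewrite gK enum_valK.
by rewrite -fI; split=> [/enum_rank_inj|->].
Qed.

(** The labelling only refines congruence modulo I, so a class is encoded by the set of labels that
    its elements carry. *)
Lemma has_index_label I (T : finType) (h : O -> T) : ideal I ->
  (forall x y, h x = h y -> I (x - y)) -> exists N, has_index I N.
Proof.
move=> iI hI; pose D x := [set t | `[< exists y, h y = t /\ I (x - y) >]]%SET.
have DI x y : D x = D y <-> I (x - y).
  split=> [/setP/(_ (h y))|Ixy].
    rewrite !inE => /esym h1; have : `[< exists z, h z = h y /\ I (y - z) >].
      by apply/asboolP; exists y; rewrite subrr; split=> //; apply: ideal0.
    rewrite h1 => /asboolP [z [hz Ixz]].
    by rewrite -(subrK z x) -addrA; apply: idealD => //; apply: hI.
  apply/setP => t; rewrite !inE; apply/asboolP/asboolP => -[z [hz Iz]]; exists z; split=> //.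
    have -> : y - z = (x - z) - (x - y) by ring.
    exact: idealB.
  have -> : x - z = (y - z) + (x - y) by ring.
  exact: idealD.
pose S := [set s | `[< exists x, D x = s >]]%SET.
have DS x : D x \in S by rewrite inE; apply/asboolP; exists x.
have /choice [g gS] : forall i : 'I_#|S|, exists x, D x = enum_val i.
  by move=> i; have := enum_valP i; rewrite inE => /asboolP.
exists #|S|, (fun x => enum_rank_in (DS 0) (D x)), g; split=> [i|x y].
  by rewrite gS enum_valK_in.
rewrite -DI; split=> [h1|->//].
by rewrite -(enum_rankK_in (DS 0) (DS x)) h1 enum_rankK_in.
Qed.

Lemma card_modE I N f (g : 'I_N -> O) (A : set O) : ideal I -> cancel g f ->
  (forall x y, f x = f y <-> I (x - y)) ->
  card_mod I A = #|[set i | `[< exists2 a, A a & f a = i >]]%SET|.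
Proof.
move=> iI gK fI; set E := [set i | _]%SET.
have rcE a : residue_class I a = residue_class I (g (f a)).
  apply/seteqP; split=> b; rewrite /residue_class /= => Ib.
    have -> : b - g (f a) = (b - a) + (a - g (f a)) by ring.
    by apply: idealD => //; apply/fI; rewrite gK.
  have -> : b - a = (b - g (f a)) + (g (f a) - a) by ring.
  by apply: idealD => //; apply/fI; rewrite gK.
pose phi i := residue_class I (g i).
have phi_inj : injective phi.
  move=> i j pij; have : phi i (g i) by rewrite /phi /residue_class /= subrr; apply: ideal0.
  by rewrite pij /phi /residue_class /= => /fI; rewrite !gK.
have imE : residue_class I @` A = [set` map phi (enum E)].
  apply/seteqP; split=> [_ [a Aa <-]|s] /=.
    apply/mapP; exists (f a); last by rewrite rcE.
    by rewrite mem_enum inE; apply/asboolP; exists a.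
  by move=> /mapP [ i ]; rewrite mem_enum inE => /asboolP [a Aa <-] ->; exists a.
have fin : finite_set (residue_class I @` A) by rewrite imE; apply/finite_seqP; eexists.
rewrite /card_mod cardE -(size_map phi); apply/perm_size/uniq_perm.
- exact: fset_uniq.
- by rewrite map_inj_uniq ?enum_uniq.
- by move=> s; rewrite in_fset_set // imE; apply/idP/idP => [/set_mem|h] //; apply: mem_set.
Qed.

Lemma has_index_norm I N : ideal I -> has_index I N -> ideal_norm I = N.
Proof.
move=> iI [f [g [gK fI]]]; rewrite /ideal_norm (card_modE _ iI gK fI).
rewrite -[RHS]card_ord -cardsT; apply: eq_card => i; rewrite !inE.
by apply/asboolP; exists (g i).
Qed.

Definition nzideal I := ideal I /\ exists2 x, x != 0 & I x.

(** I contains the positive integer m = |N(x)|, hence m O, and the coordinates modulo m label the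
    elements finely enough. *)
Lemma norm_index I : nzideal I -> has_index I (ideal_norm I).
Proof.
move=> [iI [x x0 Ix]]; suff [N hN] : exists N, has_index I N.
  by rewrite (has_index_norm iI hN).
have m0 := nrm_gt0 R x; rewrite x0 in m0.
have [y my] := nrm_mem R x; move: (nrm R x) m0 my => m m0 my.
pose h z : {ffun 'I_n -> 'I_m.-1.+1} :=
  [ffun j => inord `|((zcoord R z 0%R j) %% m)%Z|%N].
apply: (has_index_label (h := h)) => // z w /ffunP hzw.
have dv j : (m %| zcoord R (z - w)%R 0%R j)%Z.
  rewrite raddfB !mxE -eqz_mod_dvd; apply/eqP.
  have := hzw j; rewrite !ffunE => /(congr1 val) /=.
  have mpos : 0 < m%:Z by rewrite ltz_nat.
  have mz : m%:Z != 0 by rewrite gt_eqF.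
  have lt t : (`|(t %% m)%Z| < m.-1.+1)%N.
    by rewrite prednK // -ltz_nat gez0_abs ?modz_ge0 // ltz_pmod.
  rewrite !inordK // => h1; have := congr1 Posz h1.
  by rewrite !gez0_abs ?modz_ge0.
have -> : z - w = m%:R * ofc R (\row_j ((zcoord R (z - w)%R 0%R j) %/ m)%Z).
  apply: (can_inj (@zcoordK R K)); rewrite mulr_natl raddfMn /= ofcK.
  apply/rowP => j; rewrite mulmxnE mxE -mulr_natr.
  by rewrite natz (divzK (dv j)).
by rewrite my -mulrA; apply: idealMr.
Qed.

End Index.

Lemma absz_unit (u : int) : u \is a GRing.unit -> `|u|%N = 1%N.
Proof. by rewrite unfold_in => /orP[] /eqP ->. Qed.

Lemma val_eq0 (K : fieldExtType rat) (x : ringint K) : (val x == 0) = (x == 0).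
Proof. by rewrite -(inj_eq val_inj). Qed.

Lemma ringint_mulf_eq0 (K : fieldExtType rat) (x y : ringint K) :
  (x * y == 0) = (x == 0) || (y == 0).
Proof. by rewrite -!val_eq0 -mulf_eq0. Qed.

Section IndexBounds.
Variables (R : realType) (K : fieldExtType rat).
Local Notation n := (deg K).
Local Notation O := (ringint K).
Implicit Types (I J P : set O).

Lemma ideal_norm_gt0 I : nzideal I -> (0 < ideal_norm I)%N.
Proof.
by move=> /(norm_index R) [f [g _]]; case: (ideal_norm I) f => // f; case: (f 0).
Qed.

Definition pid (x : O) : set O := [set y | exists a, y = x * a].

Lemma pid_ideal x : ideal (pid x).
Proof.
split; first by exists 0; rewrite mulr0.
  by move=> _ _ [a ->] [b ->]; exists (a + b); rewrite mulrDr.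
by move=> c _ [a ->]; exists (c * a); rewrite mulrCA.
Qed.

Lemma pid_nz x : x != 0 -> nzideal (pid x).
Proof. by move=> x0; split; [exact: pid_ideal | exists x => //; exists 1; rewrite mulr1]. Qed.

(** Let L D Q be the Smith form of the multiplication matrix. In the coordinates twisted by Q^-1,
    membership in x O means divisibility of the i-th one by d_i, so the index is the product of the
    |d_i|, that is |N(x)|. *)
Lemma pid_norm (x : O) : x != 0 -> ideal_norm (pid x) = nrm R x.
Proof.
move=> x0; apply: has_index_norm; first exact: pid_ideal.
have [L Lu [Q Qu [d _ MD]]] := int_Smith_normal_form (mulmat R x).
set D := \matrix_(i, j) _ in MD.
have DE i j : D i j = d`_i *+ (i == j) by rewrite mxE -val_eqE.
have detD : \det D = \prod_(i < n) d`_i.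
  have -> : D = diag_mx (\row_i d`_i).
    by apply/matrixP => i j; rewrite DE !mxE.
  by rewrite det_diag; apply: eq_bigr => i _; rewrite mxE.
have nE : nrm R x = (\prod_(i < n) `|(d`_i)%R|)%N.
  rewrite /nrm MD !det_mulmx !abszM detD.
  rewrite (absz_unit Lu) (absz_unit Qu) mul1n muln1.
  by elim/big_rec2: _ => // i a b _ <-; rewrite abszM.
pose m (i : 'I_n) := `|(d`_i)%R|%N.
have m0 i : (0 < m i)%N.
  have := nrm_gt0 R x; rewrite x0 nE (bigD1 i) //= muln_gt0.
  by case/andP.
have d0 i : d`_(i : 'I_n) != 0 by rewrite -absz_gt0; exact: m0.
(* [(m i).-1.+1] equals [m i]; the successor form makes the ordinals visibly inhabited for
   [inord]. *)
pose T := {dffun forall i : 'I_n, 'I_(m i).-1.+1}.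
pose cc z := zcoord R z *m invmx Q.
pose f z : T := finfun (fun i : 'I_n => (inord `|(cc z 0%R i %% (d`_i)%R)%Z|%N : 'I_(m i).-1.+1)).
pose g (t : T) : O := ofc R ((\row_i (t i : nat)%:Z) *m Q).
have lt t (i : 'I_n) : (`|(t %% (d`_i)%R)%Z| < (m i).-1.+1)%N.
  rewrite prednK // -ltz_nat gez0_abs ?modz_ge0 //.
  by rewrite /m abszE; apply: ltz_mod.
have -> : nrm R x = #|T|.
  rewrite nE card_dep_ffun foldrE big_map big_enum /=.
  by apply: eq_bigr => i _; rewrite card_ord prednK.
apply: (has_indexT (f := f) (g := g)).
  move=> t; apply/ffunP => i; rewrite ffunE; apply: val_inj.
  rewrite /= inordK // /cc /g ofcK mulmxK // mxE -modz_abs modz_small ?absz_nat //.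
  by rewrite ltz_nat /= -/(m i) -{2}(prednK (m0 i)) ltn_ord.
move=> z w; have ccB i : cc z 0 i - cc w 0 i = cc (z - w) 0 i.
  by rewrite /cc raddfB mulmxBl !mxE.
have fE : f z = f w <-> forall i, ((d`_(i : 'I_n))%R %| cc (z - w)%R 0%R i)%Z.
  split=> [/ffunP h i|h].
    have := h i; rewrite !ffunE => /(congr1 val) /=; rewrite !inordK // => h1.
    have := congr1 Posz h1; rewrite !gez0_abs ?modz_ge0 // => /eqP.
    by rewrite eqz_mod_dvd ccB.
  apply/ffunP => i; rewrite !ffunE; congr (inord (absz _)); apply/eqP.
  by rewrite eqz_mod_dvd ccB.
rewrite fE; split=> [h|[a zw] i].
  exists (ofc R (\row_i (cc (z - w)%R 0%R i %/ (d`_i)%R)%Z *m invmx L)).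
  apply: (can_inj (@zcoordK R K)); rewrite mulrC zcoordM ofcK MD !mulmxA mulmxKV //.
  rewrite -[LHS](mulmxKV Qu); congr (_ *m _); apply/rowP => i.
  rewrite [RHS]mxE (bigD1 i) //= DE mxE eqxx mulr1n (divzK (h i)) big1 ?addr0 // => j ji.
  by rewrite DE (negPf ji) mulr0n mulr0.
rewrite zw mulrC /cc zcoordM MD !mulmxA mulmxK //.
rewrite mxE (bigD1 i) //= big1 => [|j ji].
  by rewrite addr0 DE eqxx mulr1n dvdz_mull.
by rewrite DE (negPf ji) mulr0n mulr0.
Qed.

Lemma ideal_norm_sub I J : nzideal I -> ideal J -> I `<=` J ->
  (ideal_norm J <= ideal_norm I)%N.
Proof.
move=> nI iJ IJ; have nJ : nzideal J.
  by split=> //; case: nI => _ [x x0 Ix]; exists x => //; apply: IJ.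
have [f [g [gK fI]]] := norm_index R nI; have [f' [g' [gK' fI']]] := norm_index R nJ.
have inj : injective (fun i => f (g' i)).
  by move=> i j /fI/IJ/fI'; rewrite !gK'.
by have := leq_card _ inj; rewrite !card_ord.
Qed.

Lemma ideal_norm_lt I J : nzideal I -> ideal J -> I `<=` J ->
  (exists2 x, J x & ~ I x) -> (ideal_norm J < ideal_norm I)%N.
Proof.
move=> nI iJ IJ [x Jx nIx]; have nJ : nzideal J.
  by split=> //; case: nI => _ [y y0 Iy]; exists y => //; apply: IJ.
have [f [g [gK fI]]] := norm_index R nI; have [f' [g' [gK' fI']]] := norm_index R nJ.
(* The zero class modulo J contains two classes modulo I, that of its representative and that of the
   translate by x; the latter is the value at [None]. *)
pose h (t : option 'I_(ideal_norm J)) :=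
  if t is Some i then f (g' i) else f (x + g' (f' 0)).
have iI : ideal I by case: nI.
have Jg : J (g' (f' 0)).
  by rewrite -[g' _]subr0; apply/fI'; rewrite gK'.
have inj : injective h.
  have no i : f (g' i) <> f (x + g' (f' 0)).
    move=> fg; have := fg => /fI/IJ Jd.
    have Jgi : J (g' i).
      rewrite -(subrK (x + g' (f' 0)) (g' i)); do 2!apply: idealD => //.
    have i0 : i = f' 0 by rewrite -[ i ]gK'; apply/fI'; rewrite subr0.
    have := idealN iI ((fI _ _).1 fg); rewrite i0.
    by have -> : - (g' (f' 0) - (x + g' (f' 0))) = x by ring.
  case=> [i|] [j|] //=; first by move=> /fI/IJ/fI'; rewrite !gK' => ->.
    by move=> /no.
  by move=> /esym/no.
by have := leq_card _ inj; rewrite card_option !card_ord.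
Qed.

Lemma ideal_norm_coprime I J : nzideal I -> nzideal J ->
  (exists a b, [/\ I a, J b & a + b = 1]) ->
  nzideal (I `&` J) /\ (ideal_norm I * ideal_norm J <= ideal_norm (I `&` J))%N.
Proof.
move=> nI nJ [a [b [Ia Jb ab]]].
have [iI [x x0 Ix]] := nI; have [iJ [y y0 Jy]] := nJ.
have nIJ : nzideal (I `&` J).
  split; last first.
    exists (x * y); last by split; [apply: idealMr | apply: idealMl].
    by rewrite ringint_mulf_eq0 negb_or x0 y0.
  split; first by split; apply: ideal0.
    by move=> u v [? ?] [? ?]; split; apply: idealD.
  by move=> c u [? ?]; split; apply: idealMl.
split=> //.
have [f [g [gK fI]]] := norm_index R nI; have [f' [g' [gK' fI']]] := norm_index R nJ.
have [h [k [hK hI]]] := norm_index R nIJ.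
(* Chinese remainders: as a + b = 1, the element b u + a v is u modulo I and v modulo J. *)
pose F (t : 'I_(ideal_norm I) * 'I_(ideal_norm J)) := h (b * g t.1 + a * g' t.2).
have E1 u v : I (b * u + a * v - u).
  have -> : b * u + a * v - u = a * (v - u) + (a + b - 1) * u by ring.
  by rewrite ab subrr mul0r addr0; apply: idealMr.
have E2 u v : J (b * u + a * v - v).
  have -> : b * u + a * v - v = b * (u - v) + (a + b - 1) * v by ring.
  by rewrite ab subrr mul0r addr0; apply: idealMr.
have inj : injective F.
  move=> [i j] [i' j'] /hI /= [Id Jd]; congr pair.
    rewrite -[ i ]gK -[i']gK; apply/fI.
    rewrite (_ : _ - _ = - (b * g i + a * g' j - g i) + (b * g i + a * g' j - (b * g i' + a * g' j')) + (b * g i' + a * g' j' - g i')); last by ring.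
    by apply: idealD => //; apply: idealD => //; apply: idealN.
  rewrite -[j]gK' -[j']gK'; apply/fI'.
  rewrite (_ : _ - _ = - (b * g i + a * g' j - g' j) + (b * g i + a * g' j - (b * g i' + a * g' j')) + (b * g i' + a * g' j' - g' j')); last by ring.
  by apply: idealD => //; apply: idealD => //; apply: idealN.
by have := leq_card _ inj; rewrite card_prod !card_ord.
Qed.

End IndexBounds.

(** * Factorization of ideals into primes *)

Section PrimeIdeals.
Variables (R : realType) (K : fieldExtType rat).
Local Notation O := (ringint K).
Implicit Types (I J P Q : set O) (s : seq (set O)).

Lemma prime_idealP P : prime_ideal P <->
  [/\ nzideal P, ~ P 1 & forall x y, P (x * y) -> P x \/ P y].
Proof.
split=> [[[h0 h1 hl] hp hn]|[[[h0 hD hM] [x x0 Px]] h1 hp]].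
  have P0 : P 0 by move: h0; rewrite in_setE.
  have lin a x y : P x -> P y -> P (a * x + y).
    by move=> Px Py; have := hl a x y; rewrite !in_setE; apply.
  have iP : ideal P.
    split=> // [x y Px Py|a x Px]; first by rewrite -[x]mul1r; apply: lin.
    by rewrite -[_ * _]addr0; apply: lin.
  split.
  - split=> //; apply: contrapT => no; apply: hn; apply/seteqP; split=> [x Px|_ -> //].
    by apply/eqP; apply: contrapT => /negP x0; apply: no; exists x.
  - by move: h1; rewrite notin_setE.
  - by move=> x y Pxy; have := hp x y; rewrite !in_setE => /(_ Pxy) /orP[]; rewrite !in_setE; [left|right].
split.
- split; rewrite ?in_setE ?notin_setE // => a u v; rewrite !in_setE => Pu Pv.
  by apply: hD => //; apply: hM.
- move=> u v; rewrite in_setE => /hp [] h; apply/orP; [left|right]; by rewrite in_setE.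
- by move=> PE; move: Px; rewrite PE => /eqP; rewrite (negPf x0).
Qed.

Lemma prime_nz P : prime_ideal P -> nzideal P.
Proof. by move=> /prime_idealP[]. Qed.

Lemma prime_is_ideal P : prime_ideal P -> ideal P.
Proof. by move=> /prime_nz[]. Qed.

Lemma prime_not1 P : prime_ideal P -> ~ P 1.
Proof. by move=> /prime_idealP[]. Qed.

Lemma prime_mulP P x y : prime_ideal P -> P (x * y) -> P x \/ P y.
Proof. by move=> /prime_idealP[_ _ h]; apply: h. Qed.

(** The finite domain O / P is a field: multiplication by x permutes its classes. *)
Lemma prime_maximal P x : prime_ideal P -> ~ P x -> exists a, P (1 - a * x).
Proof.
move=> pP Px; have [f [g [gK fI]]] := norm_index R (prime_nz pP).
have iP := prime_is_ideal pP.
pose h i := f (g i * x).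
have hinj : injective h.
  move=> i j /fI; rewrite -mulrBl => /(prime_mulP pP) [/fI|//]; by rewrite !gK.
have /codomP [ i fi ] : f 1 \in codom h by apply: injF_onto.
by exists (g i); apply/fI.
Qed.

Lemma prime_sub P Q : prime_ideal P -> prime_ideal Q -> Q `<=` P -> Q = P.
Proof.
move=> pP pQ QP; apply/seteqP; split=> // x Px; apply: contrapT => Qx.
have [a /QP Pa] := prime_maximal pQ Qx.
apply: (prime_not1 pP); rewrite -(subrK (a * x) 1).
by have iP := prime_is_ideal pP; apply: idealD => //; apply: idealMl.
Qed.

Lemma prime_sep P Q : prime_ideal P -> prime_ideal Q -> Q <> P -> exists2 q, Q q & ~ P q.
Proof.
move=> pP pQ QP; apply: contrapT => no; apply: QP; apply: prime_sub => // q Qq.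
by apply: contrapT => Pq; apply: no; exists q.
Qed.

Lemma ideal_mul_in I J a b : I a -> J b -> ideal_mul I J (a * b).
Proof.
by move=> Ia Jb; exists 1%N, (fun=> a), (fun=> b); split=> //; rewrite big_ord1.
Qed.

Lemma ideal_mul_min I J (L : set O) : ideal L ->
  (forall a b, I a -> J b -> L (a * b)) -> ideal_mul I J `<=` L.
Proof.
move=> iL h _ [m [a [b [Ia Jb ->]]]]; elim/big_ind: _ => [||i _]; first exact: ideal0.
  by move=> x y; apply: idealD.
exact: h.
Qed.

Lemma ideal_mul_ideal I J : ideal I -> ideal (ideal_mul I J).
Proof.
move=> iI; split.
- by exists 0%N, (fun=> 0), (fun=> 0); split; [case | case | rewrite big_ord0].
- move=> _ _ [m [a [b [Ia Jb ->]]]] [k [a' [b' [Ia' Jb' ->]]]].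
  exists (m + k)%N, (fun i => match fintype.split i with inl j => a j | inr j => a' j end),
    (fun i => match fintype.split i with inl j => b j | inr j => b' j end); split.
  + by move=> i; case: (fintype.split i).
  + by move=> i; case: (fintype.split i).
  + rewrite big_split_ord; congr (_ + _); apply: eq_bigr => i _.
      by rewrite (unsplitK (inl i)).
    by rewrite (unsplitK (inr i)).
- move=> c _ [m [a [b [Ia Jb ->]]]]; exists m, (fun i => c * a i), b; split=> //.
    by move=> i; apply: idealMl.
  by rewrite mulr_sumr; apply: eq_bigr => i _; rewrite mulrA.
Qed.

Definition primes_seq s := forall P, P \in s -> prime_ideal P.

Lemma primes_cons P s : primes_seq (P :: s) -> prime_ideal P /\ primes_seq s.
Proof.
by move=> h; split=> [|Q Qs]; apply: h; rewrite in_cons ?eqxx ?Qs ?orbT.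
Qed.

Lemma setT_ideal : ideal [set: O]. Proof. by []. Qed.

Lemma ideal_prod_ideal s : primes_seq s -> ideal (ideal_prod s).
Proof.
case: s => [|P s]; first by move=> _; exact: setT_ideal.
by move=> /primes_cons [/prime_is_ideal iP _]; apply: ideal_mul_ideal.
Qed.

Lemma ideal_prod_nz s : primes_seq s -> nzideal (ideal_prod s).
Proof.
move=> ps; split; first exact: ideal_prod_ideal.
elim: s ps => [|P s IH] ps; first by exists 1 => //; rewrite oner_neq0.
have [/prime_nz [_ [x x0 Px]] /IH [y y0 sy]] := primes_cons ps.
by exists (x * y); [rewrite ringint_mulf_eq0 negb_or x0 y0 | apply: ideal_mul_in].
Qed.

Lemma ideal_mul_subr I J : ideal J -> ideal_mul I J `<=` J.
Proof. by move=> iJ; apply: ideal_mul_min => // a b _; apply: idealMl. Qed.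

Lemma ideal_mul_subl I J : ideal I -> ideal_mul I J `<=` I.
Proof. by move=> iI; apply: ideal_mul_min => // a b Ia _; apply: idealMr. Qed.

Lemma ideal_prod_rem P s p y : primes_seq s -> P \in s -> P p ->
  ideal_prod (rem P s) y -> ideal_prod s (p * y).
Proof.
elim: s y => // Q s IH y ps; rewrite in_cons /=.
case: eqVneq => [->|QP] /=; first by move=> _ Pp sy; apply: ideal_mul_in.
move=> Ps Pp.
have [pQ ps'] := primes_cons ps.
pose L := [set z | ideal_mul Q (ideal_prod s) (p * z)].
have iM := ideal_mul_ideal (ideal_prod s) (prime_is_ideal pQ).
have iL : ideal L.
  split; rewrite /L /=; first by rewrite mulr0; apply: ideal0.
    by move=> u v Lu Lv; rewrite mulrDr; apply: idealD.
  by move=> c u Lu; rewrite mulrCA; apply: idealMl.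
apply: (ideal_mul_min iL) => a b Qa sb; rewrite /L /= mulrCA.
by apply: ideal_mul_in => //; apply: IH.
Qed.

Lemma ideal_prod_prime P s : prime_ideal P -> primes_seq s ->
  ideal_prod s `<=` P -> P \in s.
Proof.
move=> pP ps sP; apply: contrapT => Ps.
suff [x sx Px] : exists2 x, ideal_prod s x & ~ P x by apply: Px; apply: sP.
elim: s ps Ps {sP} => [|Q s IH] ps Ps; first by exists 1 => //; apply: prime_not1.
have [pQ /IH [|x sx Px]] := primes_cons ps.
  by move=> h; apply: Ps; rewrite in_cons h orbT.
have [|q Qq Pq] := prime_sep pP pQ.
  by move=> QP; apply: Ps; rewrite in_cons QP eqxx.
by exists (q * x); [apply: ideal_mul_in | case/(prime_mulP pP)].
Qed.

Definition ideal_adj I x : set O := [set y | exists2 i, I i & exists a, y = i + a * x].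

Lemma ideal_adj_ideal I x : ideal I -> ideal (ideal_adj I x).
Proof.
move=> iI; split.
- by exists 0; [apply: ideal0 | exists 0; rewrite mul0r addr0].
- move=> _ _ [i Ii [a ->]] [j Ij [b ->]]; exists (i + j); first exact: idealD.
  by exists (a + b); rewrite mulrDl addrACA.
- move=> c _ [i Ii [a ->]]; exists (c * i); first exact: idealMl.
  by exists (c * a); rewrite mulrDr mulrA.
Qed.

Lemma ideal_adj_norm I x : nzideal I -> ~ I x ->
  nzideal (ideal_adj I x) /\ (ideal_norm (ideal_adj I x) < ideal_norm I)%N.
Proof.
move=> nI Ix; have [iI [y y0 Iy]] := nI.
have sub : I `<=` ideal_adj I x by move=> i Ii; exists i => //; exists 0; rewrite mul0r addr0.
have iA := ideal_adj_ideal x iI.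
split; first by split=> //; exists y => //; apply: sub.
apply: (ideal_norm_lt R) => //; exists x => //; exists 0; first exact: ideal0.
by exists 1; rewrite mul1r add0r.
Qed.

Lemma not_prime I : nzideal I -> ~ I 1 -> ~ prime_ideal I ->
  exists x y, [/\ I (x * y), ~ I x & ~ I y].
Proof.
move=> nI I1 nP; apply: contrapT => no; apply: nP; apply/prime_idealP; split=> // x y Ixy.
by apply: contrapT => /not_orP [Ix Iy]; apply: no; exists x, y.
Qed.

(** Induction on the index. If x y lies in I but x and y do not, I + (x) has smaller index and is
    proper, since 1 = i + a x would put y in I. *)
Lemma exists_prime I : nzideal I -> ~ I 1 -> exists2 P, prime_ideal P & I `<=` P.
Proof.
move: {2}(ideal_norm I).+1 (ltnSn (ideal_norm I)) => N.
elim: N I => // N IH I; rewrite ltnS => leN nI I1.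
have [pI|/(not_prime nI I1) [x [y [Ixy Ix Iy]]]] := pselect (prime_ideal I).
  by exists I.
have [nA ltA] := ideal_adj_norm nI Ix.
have iI : ideal I by case: nI.
have [|P pP AP] := IH _ (leq_trans ltA leN) nA.
  move=> [ i Ii [a e1] ]; apply: Iy; rewrite -[y]mul1r e1 mulrDl -mulrA; apply: idealD => //.
    exact: idealMr.
  exact: idealMl.
by exists P => // i Ii; apply: AP; exists i => //; exists 0; rewrite mul0r addr0.
Qed.

(** Induction on the index: if x y lies in I but x and y do not, the product of the larger ideals I
    + (x) and I + (y) still lies in I. *)
Lemma prod_primes_sub I : nzideal I -> exists s, primes_seq s /\ ideal_prod s `<=` I.
Proof.
move: {2}(ideal_norm I).+1 (ltnSn (ideal_norm I)) => N.
elim: N I => // N IH I; rewrite ltnS => leN nI.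
have iI : ideal I by case: nI.
have [I1|I1] := pselect (I 1).
  by exists [::]; split=> // x _; rewrite -[x]mulr1; apply: idealMl.
have [pI|/(not_prime nI I1) [x [y [Ixy Ix Iy]]]] := pselect (prime_ideal I).
  exists [:: I]; split; last exact: ideal_mul_subl.
  by move=> P; rewrite in_cons orbF => /eqP ->.
have [nA ltA] := ideal_adj_norm nI Ix; have [nB ltB] := ideal_adj_norm nI Iy.
have [s [ps sA]] := IH _ (leq_trans ltA leN) nA.
have [t [pt tB]] := IH _ (leq_trans ltB leN) nB.
have pst : primes_seq (s ++ t).
  by move=> P; rewrite mem_cat => /orP[/ps|/pt].
exists (s ++ t); split=> //.
have mulst : ideal_prod (s ++ t) `<=` ideal_mul (ideal_prod s) (ideal_prod t).
  elim: s ps pst {sA} => [|P s IHs] ps pst /=.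
    by move=> z tz; rewrite -[z]mul1r; apply: ideal_mul_in.
  have [pP ps'] := primes_cons ps; have [_ pst'] := primes_cons pst.
  have iM := ideal_mul_ideal (ideal_prod s) (prime_is_ideal pP).
  apply: ideal_mul_min => [|a b Pa /(IHs ps' pst')]; first exact: ideal_mul_ideal.
  case=> m [c [d [sc td ->]]]; rewrite mulr_sumr.
  exists m, (fun i => a * c i), d; split=> // [i|]; first exact: ideal_mul_in.
  by apply: eq_bigr => i _; rewrite mulrA.
apply: (subset_trans mulst); apply: ideal_mul_min => // a b /sA [i Ii [u ->]] /tB [j Ij [v ->]].
have -> : (i + u * x) * (j + v * y) = i * (j + v * y) + (u * x * j + u * v * (x * y)) by ring.
by apply: idealD => //; [exact: idealMr | apply: idealD => //; exact: idealMl].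
Qed.

(** The ideals [J k] of the integers of the form c_0 m + c_1 t m + ... + c_k t^k m, with integral
    c_i, increase with k. Their indices cannot decrease forever, and a repetition expresses t^(k+1)
    m through lower powers, a monic equation for t. *)
Lemma bounded_powers_integral (t : K) (m : O) : m != 0 ->
  (forall k, t ^+ k * val m \in @algint K) -> t \in @algint K.
Proof.
move=> m0 tm.
pose J k : set O := [set y | exists c : 'I_k.+1 -> O, val y = \sum_i val (c i) * (t ^+ i * val m)].
have iJ k : ideal (J k).
  split.
  - by exists (fun=> 0); rewrite big1 // => i _; rewrite mul0r.
  - move=> x y [c xc] [d yd]; exists (fun i => c i + d i).
    by rewrite /= xc yd -big_split /=; apply: eq_bigr => i _; rewrite mulrDl.
  - move=> a x [c xc]; exists (fun i => a * c i).
    by rewrite /= xc mulr_sumr /=; apply: eq_bigr => i _; rewrite mulrA.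
have Jsub k : J k `<=` J k.+1.
  move=> y [c yc]; exists (fun i => if insub (i : nat) is Some j then c j else 0).
  rewrite big_ord_recr /= insubF ?ltnn // mul0r addr0 yc; apply: eq_bigr => i _ /=.
  by rewrite insubT //= => ilt; congr (val (c _) * _); apply: val_inj.
have nJ k : nzideal (J k).
  split=> //; exists m => //; exists (fun i => (i == 0)%:R).
  rewrite big_ord_recl /= expr0 !mul1r big1 ?addr0 // => i _; by rewrite /= mul0r.
pose z k : O := RingInt (tm k).
have [[k Jk]|no] := pselect (exists k, J k (z k.+1)).
  case: Jk => c /= zc; apply/asboolP.
  pose co (i : nat) : K := if insub i is Some j then val (c j) else 0.
  pose p : {poly K} := 'X^(k.+1) - \poly_(i < k.+1) co i.
  have szq : (size (\poly_(i < k.+1) co i) < k.+2)%N.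
    by rewrite ltnS size_poly.
  apply: (@integral_root_monic _ _ _ t p).
  - by apply/monicP; rewrite /p lead_coefDl ?lead_coefXn // size_polyN size_polyXn.
  - rewrite /root /p hornerD hornerN hornerXn horner_poly subr_eq0; apply/eqP.
    have mv : val m != 0 by rewrite val_eq0.
    apply: (mulIf mv); rewrite zc mulr_suml; apply: eq_bigr => i _.
    rewrite /co insubT //= => ilt; rewrite -mulrA; congr (val (c _) * _); exact: val_inj.
  - have pi i : integralOver (intr : int -> K) p`_i.
      apply/asboolP; rewrite -[asbool _]/(p`_i \in @algint K) /p coefB coefXn coef_poly rpredB ?rpred_nat //.
      case: ifP => _; last exact: rpred0.
      by rewrite /co; case: (insub i : option 'I_k.+1) => [j|]; [exact: valP | exact: rpred0].
    by apply/integral_poly.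
exfalso.
have dec k : (ideal_norm (J k) + k <= ideal_norm (J 0%N))%N.
  elim: k => [|k IH]; first by rewrite addn0.
  apply: leq_trans IH; rewrite addnS -addSn leq_add2r; apply: (ideal_norm_lt R) => //.
  exists (z k.+1); last by move=> Jz; apply: no; exists k.
  exists (fun i => (i == ord_max)%:R); rewrite big_ord_recr /= eqxx mul1r big1 ?add0r // => i _.
  by rewrite -val_eqE /= ltn_eqF //= mul0r.
have := dec (ideal_norm (J 0%N)).+1; rewrite addnS ltnNge.
by rewrite leq_addl.
Qed.

(** A multiplier t of P^-1 outside O. It comes as y / x, where x lies in P, a shortest product of
    primes inside (x) has P as a factor, and y lies in the product of the remaining factors but not
    in (x). The relation a + t b = 1 expresses that P is invertible. *)
Lemma prime_inverse P : prime_ideal P -> exists t : K,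
  [/\ t \notin @algint K, forall p, P p -> t * val p \in @algint K &
      exists a b, [/\ P a, P b & val a + t * val b = 1]].
Proof.
move=> pP; have [iP [x x0 Px]] := prime_nz pP.
pose good m := `[< exists s, [/\ primes_seq s, size s = m & ideal_prod s `<=` pid x] >].
have exg : exists m, good m.
  have [s [ps sx]] := prod_primes_sub (pid_nz x0).
  by exists (size s); apply/asboolP; exists s.
case: (ex_minnP exg) => m /asboolP [s [ps szs sx]] minm.
have sP : ideal_prod s `<=` P.
  by apply: subset_trans sx _ => _ [a ->]; apply: idealMr.
have Ps := ideal_prod_prime pP ps sP.
have [y sy nxy] : exists2 y, ideal_prod (rem P s) y & ~ pid x y.
  apply: contrapT => no.
  have : (m <= (size s).-1)%N.
    apply: minm; apply/asboolP; exists (rem P s); rewrite size_rem //; split=> //.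
      by move=> Q /mem_rem /ps.
    by move=> y sy; apply: contrapT => nxy; apply: no; exists y.
  by rewrite szs; case: m szs {minm} => [|m] szs; rewrite ?ltnn //; case: s szs Ps {ps sx sP no}.
have vx : val x != 0 by rewrite val_eq0.
pose t := val y / val x.
have tP p : P p -> t * val p \in @algint K.
  move=> Pp; have /sx [a pa] := ideal_prod_rem ps Ps Pp sy.
  have -> : t * val p = val a.
    rewrite /t mulrAC [val y * _]mulrC -[_ * val y]/(val (p * y)) pa /= mulrC mulKf //.
  exact: valP.
have tn : t \notin @algint K.
  apply/negP => ti; apply: nxy; exists (RingInt ti); apply: val_inj.
  by rewrite /= /t mulrC divfK.
exists t; split=> //.
(* If t P were contained in P, all t^k x would be integral and t with them; so some t b0 is a unit
   modulo P. *)
have [b0 Pb0 nb0] : exists2 b0, P b0 & forall c : O, val c = t * val b0 -> ~ P c.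
  apply: contrapT => no; move/negP: tn; apply.
  apply: (bounded_powers_integral x0) => k.
  suff [c [Pc <-]] : exists c, P c /\ val c = t ^+ k * val x by exact: valP.
  elim: k => [|k [c [Pc ck]]]; first by exists x; rewrite expr0 mul1r.
  exists (RingInt (tP c Pc)); split; last by rewrite /= ck exprS mulrA.
  by apply: contrapT => nc0; apply: no; exists c => // d dE; suff -> : d = RingInt (tP c Pc) by []; apply: val_inj.
have [c Pc] := prime_maximal pP (nb0 (RingInt (tP b0 Pb0)) erefl).
exists (1 - c * RingInt (tP b0 Pb0)), (c * b0); split=> //; first exact: idealMl.
by rewrite /=; ring.
Qed.

End PrimeIdeals.

Lemma ringint_valX (K : fieldExtType rat) (x : ringint K) k :
  ringint_val (x ^+ k) = ringint_val x ^+ k.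
Proof. exact: (rmorphXn (val : {rmorphism ringint K -> K})). Qed.

(** * Factorization of ideals and multiplicativity of the index *)

Section Factorization.
Variables (R : realType) (K : fieldExtType rat).
Local Notation O := (ringint K).
Implicit Types (I J P Q : set O) (s : seq (set O)).

Lemma sub_ideal_norm_lt I J : nzideal I -> ideal J -> I `<=` J ->
  ~ (J `<=` I) -> (ideal_norm J < ideal_norm I)%N.
Proof.
move=> nI iJ IJ JI; apply: (ideal_norm_lt R) => //; apply: contrapT => no; apply: JI => x Jx.
by apply: contrapT => Ix; apply: no; exists x.
Qed.

(** Induction on the index: I' = I + t I, with t the multiplier of a prime P containing I, is
    strictly larger than I and satisfies P I' = I. *)
Lemma ideal_factorization I : nzideal I -> exists s, primes_seq s /\ I = ideal_prod s.
Proof.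
move: {2}(ideal_norm I).+1 (ltnSn (ideal_norm I)) => N.
elim: N I => // N IH I; rewrite ltnS => leN nI.
have [iI [x x0 Ix]] := nI.
have [I1|I1] := pselect (I 1).
  exists [::]; split=> //; apply/seteqP; split=> // y _.
  by rewrite -[y]mulr1; apply: idealMl.
have [P pP IP] := exists_prime R nI I1; have iP := prime_is_ideal pP.
have [t [tn tP [a [b [Pa Pb ab]]]]] := prime_inverse R pP.
pose I' : set O := [set y | exists u v, [/\ I u, I v & val y = val u + t * val v]].
have II' : I `<=` I'.
  move=> y Iy; exists y, 0; split=> //; first exact: ideal0.
  by rewrite mulr0 addr0.
have iI' : ideal I'.
  split; first by apply: II'; apply: ideal0.
  - move=> y z [u [v [Iu Iv ye]]] [u' [v' [Iu' Iv' ze]]].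
    exists (u + u'), (v + v'); split; [exact: idealD|exact: idealD|].
    by rewrite /= ye ze /=; ring.
  - move=> c y [u [v [Iu Iv ye]]]; exists (c * u), (c * v).
    split; [exact: idealMl|exact: idealMl|].
    by rewrite /= ye /=; ring.
have tI v (Iv : I v) : exists2 w : O, val w = t * val v & I' w.
  exists (RingInt (tP v (IP _ Iv))) => //; exists 0, v; split=> //; first exact: ideal0.
  by rewrite add0r.
have nI' : nzideal I' by split=> //; exists x => //; apply: II'.
have lt : (ideal_norm I' < ideal_norm I)%N.
  apply: sub_ideal_norm_lt => // I'I; move/negP: tn; apply.
  apply: (bounded_powers_integral R x0) => k.
  suff [c [Ic <-]] : exists c, I c /\ val c = t ^+ k * val x by exact: valP.
  elim: k => [|k [c [Ic ck]]]; first by exists x; rewrite expr0 mul1r.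
  have [w wE /I'I Iw] := tI c Ic.
  by exists w; split=> //; rewrite wE ck exprS mulrA.
have [s [ps I's]] := IH I' (leq_trans lt leN) nI'.
exists (P :: s); split.
  by move=> Q; rewrite in_cons => /orP[/eqP ->|/ps].
rewrite /= -I's; apply/seteqP; split; last first.
  apply: ideal_mul_min => // p y Pp [u [v [Iu Iv ye]]].
  have -> : p * y = p * u + RingInt (tP p Pp) * v.
    by apply: val_inj; rewrite /= ye /=; ring.
  by apply: idealD => //; apply: idealMl.
move=> i Ii; have [w wE I'w] := tI i Ii.
have -> : i = a * i + b * w.
  by apply: val_inj; rewrite /= wE -[LHS]mul1r -ab /=; ring.
have iM := ideal_mul_ideal I' iP.
by apply: idealD => //; apply: ideal_mul_in => //; apply: II'.
Qed.

(** Multiplication by t embeds J / PJ into O / P, where J is the product of s. For t one takes a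
    product of multipliers of [prime_inverse], one for each occurrence of P in s. *)
Lemma residue_multiplier P s : prime_ideal P -> primes_seq s -> exists t : K,
  forall y, ideal_prod s y -> exists2 z : O, val z = t * val y &
    (P z -> ideal_mul P (ideal_prod s) y).
Proof.
move=> pP; have iP := prime_is_ideal pP; elim: s => [|Q s IH] ps.
  exists 1 => y _; exists y; rewrite ?mul1r // => Py.
  by rewrite -[y]mulr1; apply: ideal_mul_in.
have [pQ ps'] := primes_cons ps; have [t tP] := IH ps'.
have iQ := prime_is_ideal pQ; have is' := ideal_prod_ideal ps'.
have iJ : ideal (ideal_prod (Q :: s)) := ideal_prod_ideal ps.
have iPJ := ideal_mul_ideal (ideal_prod (Q :: s)) iP.
have iPs := ideal_mul_ideal (ideal_prod s) iP.
have [QP|QP] := eqVneq Q P.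
  have [u [un uP [a [b [Pa Pb ab]]]]] := prime_inverse R pP.
  exists (t * u) => y Jy.
  have [w wE sw] : exists2 w : O, val w = u * val y & ideal_prod s w.
    move: y Jy; rewrite QP; apply: ideal_mul_min => [|p y Pp sy].
      split.
      - by exists 0; [rewrite /= mulr0|exact: ideal0].
      - move=> y1 y2 [w1 E1 h1] [w2 E2 h2]; exists (w1 + w2); last exact: idealD.
        by rewrite /= E1 E2 /=; ring.
      - move=> c y1 [w1 E1 h1]; exists (c * w1); last exact: idealMl.
        by rewrite /= E1 /=; ring.
    exists (RingInt (uP p Pp) * y); last exact: idealMl.
    by rewrite /=; ring.
  have [z zE Pz] := tP w sw; exists z; first by rewrite zE wE mulrA.
  move=> /Pz Psw.
  have -> : y = a * y + b * w.
    by apply: val_inj; rewrite /= wE -[LHS]mul1r -ab /=; ring.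
  by apply: idealD => //; apply: ideal_mul_in => //=; rewrite QP.
(* Distinct primes are comaximal, so a factor Q different from P leaves t unchanged: y splits as p0
   y + q0 y. *)
have [p0 [q0 [Pp0 Qq0 pq]]] : exists p q, [/\ P p, Q q & 1 = p + q].
  have [q Qq Pq] := prime_sep R pP pQ (elimN eqP QP).
  have [a Pa] := prime_maximal R pP Pq.
  by exists (1 - a * q), (a * q); split=> //; [exact: idealMl | rewrite subrK].
exists t => y Jy.
have sy : ideal_prod s y by move: Jy; apply: ideal_mul_subr.
have [z zE Pz] := tP y sy; exists z => // /Pz Psy.
have -> : y = p0 * y + q0 * y by rewrite -mulrDl -pq mul1r.
apply: idealD => //; first exact: ideal_mul_in.
move: y Psy {Jy sy z zE Pz}; apply: ideal_mul_min => [|p y Pp sy].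
  split.
  - by rewrite mulr0; apply: ideal0.
  - by move=> y1 y2 h1 h2; rewrite mulrDr; apply: idealD.
  - by move=> c y1 h1; rewrite mulrCA; apply: idealMl.
by rewrite mulrCA; apply: ideal_mul_in => //; apply: ideal_mul_in.
Qed.

(** J / PJ has exactly NP classes: [residue_multiplier] embeds it into O / P, and c -> c y0 embeds O
    / P into it for any y0 in J outside PJ. *)
Lemma ideal_norm_mul P s : prime_ideal P -> primes_seq s ->
  ideal_norm (ideal_mul P (ideal_prod s)) = (ideal_norm P * ideal_norm (ideal_prod s))%N.
Proof.
move=> pP ps; set J := ideal_prod s.
have iP := prime_is_ideal pP; have iJ : ideal J := ideal_prod_ideal ps.
have nJ : nzideal J := ideal_prod_nz ps.
have nPJ : nzideal (ideal_mul P J).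
  apply: (@ideal_prod_nz _ (P :: s)) => Q.
  by rewrite in_cons => /orP[/eqP ->|/ps].
have iPJ : ideal (ideal_mul P J) by case: nPJ.
have [t [tn tP [a [b [Pa Pb ab]]]]] := prime_inverse R pP.
have PJJ := ideal_mul_subr (I := P) iJ.
have [f [g [gK fI]]] := norm_index R nJ.
have [fP [gP [gKP fIP]]] := norm_index R (prime_nz pP).
have [h [k [hK hI]]] := norm_index R nPJ.
apply/eqP; rewrite eqn_leq; apply/andP; split.
  have [u uP] := residue_multiplier pP ps.
  have /choice [v vP] : forall y, exists z : O, J y -> val z = u * val y /\ (P z -> ideal_mul P J y).
    move=> y; have [/uP [z zE zP]|nJy] := pselect (J y); first by exists z.
    by exists 0.
  pose F i := (fP (v (k i - g (f (k i)))), f (k i)).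
  have Jd y : J (y - g (f y)) by apply/fI; rewrite gK.
  have inj : injective F.
    move=> i j [e1 e2]; rewrite -[ i ]hK -[j]hK; apply/hI.
    have [v1 _] := vP _ (Jd (k i)); have [v2 _] := vP _ (Jd (k j)).
    have Jk : J (k i - k j) by apply/fI.
    have [v3 PJ3] := vP _ Jk; apply: PJ3.
    have -> : v (k i - k j) = v (k i - g (f (k i))) - v (k j - g (f (k j))).
      apply: val_inj; rewrite [RHS]/= v1 v2 v3 e2 /=; ring.
    exact/fIP.
  by have := leq_card _ inj; rewrite card_prod !card_ord.
(* If J = PJ, then t maps J into itself, and t would be integral. *)
have [y0 Jy0 PJy0] : exists2 y, J y & ~ ideal_mul P J y.
  apply: contrapT => no.
  have sub y : J y -> ideal_mul P J y.
    by move=> Jy; apply: contrapT => nh; apply: no; exists y.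
  have [_ [x x0 Jx]] := nJ; move/negP: tn; apply.
  apply: (bounded_powers_integral R x0) => m.
  suff [c [Jc <-]] : exists c, J c /\ val c = t ^+ m * val x by exact: valP.
  elim: m => [|m [c [Jc ck]]]; first by exists x; rewrite expr0 mul1r.
  have [w wE Jw] : exists2 w : O, val w = t * val c & J w.
    have := sub c Jc; move: c {ck Jc}; apply: ideal_mul_min => [|p y Pp sy].
      split.
      - by exists 0; [rewrite /= mulr0|exact: ideal0].
      - move=> y1 y2 [w1 E1 h1] [w2 E2 h2]; exists (w1 + w2); last exact: idealD.
        by rewrite /= E1 E2 /=; ring.
      - move=> c y1 [w1 E1 h1]; exists (c * w1); last exact: idealMl.
        by rewrite /= E1 /=; ring.
    exists (RingInt (tP p Pp) * y); last exact: idealMl.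
    by rewrite /=; ring.
  by exists w; split=> //; rewrite wE ck exprS mulrA.
have colon c : ideal_mul P J (c * y0) -> P c.
  move=> h1; apply: contrapT => Pc; have [d Pd] := prime_maximal R pP Pc.
  apply: PJy0; have -> : y0 = (1 - d * c) * y0 + d * (c * y0) by ring.
  by apply: idealD => //; [exact: ideal_mul_in | exact: idealMl].
pose F (ij : 'I_(ideal_norm P) * 'I_(ideal_norm J)) := h (g ij.2 + gP ij.1 * y0).
have inj : injective F.
  move=> [i1 j1] [i2 j2] /hI /= d.
  have j12 : j1 = j2.
    rewrite -[j1]gK -[j2]gK; apply/fI.
    rewrite (_ : _ - _ = (g j1 + gP i1 * y0 - (g j2 + gP i2 * y0)) + (gP i2 - gP i1) * y0); last by ring.
    by apply: idealD => //; [exact: PJJ | exact: idealMl].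
  move: d; rewrite j12 (_ : _ - _ = (gP i1 - gP i2) * y0); last by ring.
  by move/colon/fIP; rewrite !gKP => ->.
by have := leq_card _ inj; rewrite card_prod !card_ord.
Qed.

Lemma ideal_norm_prod s : primes_seq s ->
  ideal_norm (ideal_prod s) = (\prod_(P <- s) ideal_norm P)%N.
Proof.
elim: s => [|P s IH] ps.
  rewrite big_nil; apply: has_index_norm; first exact: setT_ideal.
  exists (fun=> ord0), (fun=> 0); split=> [i|x y]; first by rewrite [RHS]ord1.
  by [].
by have [pP ps'] := primes_cons ps; rewrite big_cons /= ideal_norm_mul // IH.
Qed.

Lemma ideal_norm_prime_gt1 P : prime_ideal P -> (1 < ideal_norm P)%N.
Proof.
move=> pP; have := ideal_norm_lt R (prime_nz pP) (setT_ideal K).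
have -> : ideal_norm [set: O] = 1%N by rewrite (@ideal_norm_prod [::]) ?big_nil.
by apply=> //; exists 1 => //; apply: prime_not1.
Qed.

Lemma ideal_prod_nseq P s k : prime_ideal P -> primes_seq s -> (k <= count_mem P s)%N ->
  ideal_prod s `<=` ideal_prod (nseq k P).
Proof.
move=> pP; have iP := prime_is_ideal pP.
have pk k' : primes_seq (nseq k' P) by move=> Q; rewrite mem_nseq => /andP[_ /eqP ->].
elim: s k => [|Q s IH] k ps /=; first by rewrite leqn0 => /eqP ->.
have [pQ ps'] := primes_cons ps.
case: k => [|k]; first by move=> _ x _.
case: eqVneq => [->|QP] /= le.
  apply: ideal_mul_min => [|a b Pa sb]; first exact: (ideal_prod_ideal (pk k.+1)).
  by apply: ideal_mul_in => //; apply: IH sb.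
apply: subset_trans (ideal_mul_subr _) _; first exact: ideal_prod_ideal.
exact: (IH k.+1).
Qed.

Definition prime_pow P k := ideal_prod (nseq k P).

Lemma nseq_primes P k : prime_ideal P -> primes_seq (nseq k P).
Proof. by move=> pP Q; rewrite mem_nseq => /andP[_ /eqP ->]. Qed.

Lemma prime_pow_nz P k : prime_ideal P -> nzideal (prime_pow P k).
Proof. by move=> pP; apply/ideal_prod_nz/nseq_primes. Qed.

Lemma prime_pow_norm P k : prime_ideal P -> ideal_norm (prime_pow P k) = (ideal_norm P ^ k)%N.
Proof.
by move=> pP; rewrite ideal_norm_prod ?big_nseq ?iter_muln_1 //; apply: nseq_primes.
Qed.

Lemma prime_pow1 P : prime_ideal P -> prime_pow P 1 = P.
Proof.
move=> pP; have iP := prime_is_ideal pP; apply/seteqP; split.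
  exact: ideal_mul_subl.
by move=> x Px; rewrite -[x]mulr1; apply: ideal_mul_in.
Qed.

(** [prime_val] reads the exponents off an arbitrary factorization, so the inequality is needed for
    all of them. Let m be the exponent of P in s and w = u b, which is outside P. The product of s
    contains some b^m j with j outside P; a larger exponent in t would make u w^k j integral for
    some k, and w^k j = a w^k j + b (u w^k j) would lie in P. *)
Lemma count_le_of_integral_mul P s t (x : K) : prime_ideal P -> primes_seq s -> primes_seq t ->
  x \in @algint K -> [set val y | y in ideal_prod s] `<=` [set x * val y | y in ideal_prod t] ->
  (count_mem P t <= count_mem P s)%N.
Proof.
move=> pP ps pt xi sub; have iP := prime_is_ideal pP.
have [u [un uP [a [b [Pa Pb ab]]]]] := prime_inverse R pP.
pose w := RingInt (uP b Pb).
have Pw : ~ P w.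
  move=> Pw; apply: (prime_not1 pP).
  have -> : 1 = a + w by apply: val_inj; rewrite /= -ab.
  exact: idealD.
have [j Pj sj] : exists2 j, ~ P j & ideal_prod s (b ^+ count_mem P s * j).
  elim: s ps {sub} => [|Q s IH] ps /=.
    by exists 1 => //; exact: prime_not1.
  have [pQ /IH [j Pj sj]] := primes_cons ps.
  case: eqVneq => [->|/eqP QP].
    by exists j => //; rewrite add1n exprS -mulrA; apply: ideal_mul_in.
  have [q Qq Pq] := prime_sep R pP pQ QP.
  exists (q * j); first by case/(prime_mulP pP).
  by rewrite mulrCA; apply: ideal_mul_in.
have tint y : ideal_prod t y -> u ^+ count_mem P t * val y \in @algint K.
  elim: t pt {sub} y => [|Q t IH] pt y /=.
    by rewrite expr0 mul1r => _; exact: valP.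
  have [pQ /IH {}IH] := primes_cons pt; move: y; apply: ideal_mul_min.
    split.
    - by rewrite mulr0 rpred0.
    - by move=> y z h1 h2; rewrite /= mulrDr rpredD.
    - by move=> c y h1; rewrite /= mulrCA; apply: rpredM => //; exact: valP.
  move=> p y; case: eqVneq => [->|_] Qp ty.
    rewrite add1n exprS (_ : _ * _ = (u * val p) * (u ^+ count_mem P t * val y)); last by rewrite /=; ring.
    by apply: rpredM; [exact: (uP _ Qp) | exact: IH].
  by rewrite /= mulrCA; apply: rpredM; [exact: valP | exact: IH].
rewrite leqNgt; apply/negP => lt.
have /sub [y ty /= xy] : [set val y | y in ideal_prod s] (val (b ^+ count_mem P s * j)) by exists (b ^+ count_mem P s * j).
have := rpredM xi (tint y ty); rewrite mulrCA xy /=.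
move: (count_mem P t - count_mem P s)%N (subnK (ltnW lt)) (lt) => l <- ltl.
have {ltl} l0 : (0 < l)%N by rewrite -(ltn_add2r (count_mem P s)).
set m := count_mem P s; rewrite exprD ringint_valX /= => hi.
pose w1 := w ^+ m * j.
have Pw1 i : ~ P (w ^+ i * w1).
  have Pwi i' : ~ P (w ^+ i').
    by elim: i' => [|i' IH]; [rewrite expr0; exact: prime_not1 | rewrite exprS => /(prime_mulP pP) []].
  by move=> /(prime_mulP pP) [/Pwi|/(prime_mulP pP) [/Pwi|]].
have {}hi : u ^+ l * val w1 \in @algint K.
  rewrite (_ : _ * _ = u ^+ l * u ^+ m * (val b ^+ m * val j)) //.
  by rewrite /= ringint_valX /= exprMn; ring.
have h2 : u * val (w ^+ l.-1 * w1) \in @algint K.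
  rewrite (_ : _ * _ = val b ^+ l.-1 * (u ^+ l * val w1)); last first.
    by rewrite -[in RHS](prednK l0) exprS /= ringint_valX /= exprMn; ring.
  by apply: rpredM => //; apply: rpredX; exact: valP.
apply: (Pw1 l.-1); set z := w ^+ l.-1 * w1 in h2 *.
have -> : z = a * z + b * RingInt h2.
  by apply: val_inj; rewrite /= -[LHS]mul1r -ab /=; ring.
by apply: idealD => //; [exact: idealMr | exact: idealMr].
Qed.

Lemma prime_val_ge0 P (x : K) : prime_ideal P -> x \in @algint K -> 0 <= prime_val P x.
Proof.
move=> pP xi; rewrite /prime_val; case: xgetP => // m -> [s [t [[pst E] ->]]].
rewrite subr_ge0 lez_nat; apply: (count_le_of_integral_mul (x := x)) => //.
- by move=> Q Qs; apply: pst; rewrite mem_cat Qs.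
- by move=> Q Qt; apply: pst; rewrite mem_cat Qt orbT.
- by rewrite E.
Qed.

Lemma nonarch_abs_le1 P (x : K) : prime_ideal P -> x \in @algint K -> nonarch_abs R P x <= 1.
Proof.
move=> pP xi; rewrite /nonarch_abs; case: ifP => // _.
have v0 : 0 <= (prime_val P x)%:~R / (ramification_index P)%:~R :> R.
  by rewrite divr_ge0 // ler0z prime_val_ge0 // rpred_nat.
(* The case of base 0 is included: there the power is 1 at exponent 0 and 0 elsewhere. *)
set r := _ / _ in v0 *; case: (residue_char P) => [|p].
  by have [->|r0] := eqVneq r 0; [rewrite oppr0 powRr0 | rewrite powR0 ?oppr_eq0].
by rewrite -[leRHS](powRr0 p.+1%:R); apply: ler_powR; rewrite ?ler1n // oppr_le0.
Qed.

Definition icap s : set O := [set x | forall Q, Q \in s -> Q x].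

Lemma icap_norm s : primes_seq s -> uniq s ->
  nzideal (icap s) /\ (\prod_(P <- s) ideal_norm P <= ideal_norm (icap s))%N.
Proof.
elim: s => [|P s IH] ps.
  split; last first.
    rewrite big_nil; apply: (ideal_norm_gt0 R).
    by split; [by [] | exists 1; rewrite ?oner_neq0].
  by split; [by [] | exists 1; rewrite ?oner_neq0].
rewrite /= => /andP[Ps us]; have [pP ps'] := primes_cons ps.
have [nI leI] := IH ps' us; have [iI [x x0 Ix]] := nI.
have iP := prime_is_ideal pP.
have -> : icap (P :: s) = P `&` icap s.
  apply/seteqP; split=> [y h|y [Py h] Q]; last by rewrite in_cons => /orP[/eqP ->|/h].
  by split=> [|Q Qs]; apply: h; rewrite in_cons ?eqxx ?Qs ?orbT.
have [b Ib Pb] : exists2 b, icap s b & ~ P b.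
  elim: s ps' Ps {IH ps us nI leI iI x x0 Ix} => [|Q s IH] ps.
    by exists 1 => //; exact: prime_not1.
  rewrite in_cons negb_or => /andP[PQ Ps]; have [pQ ps'] := primes_cons ps.
  have [b sb Pb] := IH ps' Ps; have [q Qq Pq] := prime_sep R pP pQ (nesym (elimN eqP PQ)).
  exists (q * b); last by case/(prime_mulP pP).
  move=> Q'; rewrite in_cons => /orP[/eqP ->|Q's].
    by apply: idealMr => //; exact: prime_is_ideal.
  by apply: idealMl; [exact/prime_is_ideal/ps' | exact: sb].
have [c Pc] := prime_maximal R pP Pb.
have [|nc lec] := ideal_norm_coprime R (prime_nz pP) nI.
  by exists (1 - c * b), (c * b); split=> //; [exact: (idealMl c iI Ib) | rewrite subrK].
by split=> //; apply: leq_trans lec; rewrite big_cons leq_mul2l leI orbT.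
Qed.

(** (x) is contained in the intersection of the primes, whose index is at least the product of their
    norms by Chinese remainders. *)
Lemma prod_primes_norm_le s (x : O) : primes_seq s -> uniq s -> x != 0 ->
  (forall P, P \in s -> P x) -> (\prod_(P <- s) ideal_norm P <= nrm R x)%N.
Proof.
move=> ps us x0 sx; have [nI leI] := icap_norm ps us; have [iI _] := nI.
apply: leq_trans leI _; rewrite -(pid_norm R x0).
apply: (ideal_norm_sub R) => //; first exact: pid_nz.
by move=> _ [a ->]; exact: (idealMr a iI sx).
Qed.

End Factorization.

(** * Chebyshev-type sums over the primes *)

Section Chebyshev.

Lemma prod_distinct_primes_dvd (s : seq nat) m :
  uniq s -> all prime s -> all (fun p => p %| m)%N s -> (\prod_(p <- s) p %| m)%N.
Proof.
elim: s => [|p s IH]; first by rewrite big_nil dvd1n.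
move=> /= /andP[ps us] /andP[pp psp] /andP[pm sm]; rewrite big_cons Gauss_dvd.
  by rewrite pm IH.
rewrite prime_coprime // Euclid_dvd_prod // big_has; apply/hasPn => q qs.
rewrite dvdn_prime2 //; last exact: (allP psp).
by apply: contraNneq ps => ->.
Qed.

Lemma central_binomial_le k : ('C(k.*2, k) <= 4 ^ k)%N.
Proof.
have -> : (4 ^ k = (1 + 1) ^ k.*2)%N by rewrite -muln2 mulnC expnM.
rewrite expnDn; under eq_bigr do rewrite !exp1n !muln1.
have lk : (k < k.*2.+1)%N by rewrite ltnS -addnn leq_addl.
by rewrite (bigD1 (Ordinal lk)) //= leq_addr.
Qed.

(** The primes in (k, 2k] divide the central binomial coefficient, which is at most 4^k. Strong
    induction halves m, with k = [uphalf m], and the base 16 leaves room for the rounding. *)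
Lemma primorial_le m : (\prod_(0 <= p < m.+1 | prime p) p <= 16 ^ m)%N.
Proof.
elim/ltn_ind: m => m IH.
have [m2|m1] := ltnP m 2.
  rewrite big_nat_cond big_pred0 ?expn_gt0 // => p; apply/negP => /andP[/andP[_ pm] /prime_gt1].
  by lia.
case: m IH m1 => [|[|m]] // IH _; have [k [kM k2 leM kle]] : exists k, [/\ k < m.+2, 1 < k.*2, m.+2 <= k.*2 & k.*2 <= m.+3]%N.
  by exists (uphalf m.+2); split; lia.
move: {m}m.+2 (isT : 1 < m.+2)%N IH kM leM kle => M M1 IH kM leM kle.
have le1 : (\prod_(0 <= p < M.+1 | prime p) p <=
   \prod_(0 <= p < k.+1 | prime p) p * \prod_(k.+1 <= p < k.*2.+1 | prime p) p)%N.
  rewrite -(@big_cat_nat _ _ _ k.+1) //=; last by rewrite ltnS -addnn leq_addr.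
  rewrite (@big_cat_nat _ _ _ M.+1 0 k.*2.+1) //=.
  by apply: leq_pmulr; apply: prodn_cond_gt0 => p /prime_gt0.
apply: (leq_trans le1).
have le2 : (\prod_(k.+1 <= p < k.*2.+1 | prime p) p <= 4 ^ k)%N.
  apply: leq_trans (central_binomial_le k); apply: dvdn_leq.
    by rewrite bin_gt0 -addnn leq_addr.
  rewrite -big_filter; apply: prod_distinct_primes_dvd.
  - by rewrite filter_uniq // iota_uniq.
  - exact: filter_all.
  - apply/allP => p; rewrite mem_filter mem_index_iota => /andP[pp /andP[kp pk]].
    have k2k : (k <= k.*2)%N by rewrite -addnn leq_addr.
    have : (p %| k.*2`!)%N by rewrite dvdn_fact // prime_gt0.
    rewrite -(bin_fact k2k) -addnn addnK !Euclid_dvdM // orbb.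
    case/orP=> // pk1; exfalso; move: pk1.
    rewrite fact_prod Euclid_dvd_prod // big_has => /hasP[ i ].
    rewrite mem_index_iota => /andP[i0 ik] /(dvdn_leq i0); lia.
apply: (leq_trans (leq_mul (IH _ kM) le2)).
have -> : (4 ^ k = 2 ^ (2 * k))%N by rewrite expnM.
have E j : (16 ^ j = 2 ^ (4 * j))%N by rewrite expnM.
rewrite !E -expnD leq_exp2l //; lia.
Qed.

End Chebyshev.

Section RealSums.
Variable R : realType.

Lemma sum_ln (I : eqType) (s : seq I) (P : pred I) (F : I -> nat) :
  (forall i, i \in s -> 0 < F i)%N ->
  \sum_(i <- s | P i) ln ((F i)%:R : R) = ln ((\prod_(i <- s | P i) F i)%N%:R).
Proof.
move=> F0; rewrite [LHS]big_seq_cond [X in ln X%:R]big_seq_cond.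
have : (0 < \prod_(i <- s | (i \in s) && P i) F i)%N.
  by apply: prodn_cond_gt0 => i /andP[/F0].
elim/big_rec2: _ => [|i x y /andP[/F0 Fi _] IH]; first by rewrite ln1.
rewrite muln_gt0 => /andP[_ y0].
by rewrite IH // natrM lnM // posrE ltr0n.
Qed.

Lemma ler_ln_nat (a b : nat) : (0 < a)%N -> (a <= b)%N -> ln (a%:R : R) <= ln b%:R.
Proof.
move=> a0 ab; rewrite ler_ln ?posrE ?ltr0n ?ler_nat //.
exact: leq_trans ab.
Qed.

(* Summation by parts: replacing the sequence [a] by the constant [C], which
   dominates it on average, increases the sum against a nonincreasing weight. *)
Lemma sum_weight_le (a w : nat -> R) (C : R) (N : nat) :
  (forall m, (m <= N)%N -> \sum_(1 <= i < m.+1) a i <= C * m%:R) ->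
  (forall m, (0 < m)%N -> w m.+1 <= w m) -> (forall m, 0 <= w m) ->
  \sum_(1 <= i < N.+1) a i * w i <= C * \sum_(1 <= i < N.+1) w i.
Proof.
move=> hA hw w0.
(* The boundary term of the summation by parts is kept so that the induction closes. *)
suff : \sum_(1 <= i < N.+1) a i * w i <= C * \sum_(1 <= i < N.+1) w i
   - w N * (C * N%:R - \sum_(1 <= i < N.+1) a i).
  by move=> h; apply: (le_trans h); rewrite lerBlDr lerDl mulr_ge0 // subr_ge0 hA.
elim: N hA => [|N IH] hA; first by rewrite !big_geq // !mulr0 subr0 mulr0 subr0.
have {}IH := IH (fun m hm => hA m (leqW hm)).
have key : w N.+1 * (C * N%:R - \sum_(1 <= i < N.+1) a i) <=
           w N * (C * N%:R - \sum_(1 <= i < N.+1) a i).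
  have [->|N0] := posnP N; first by rewrite big_geq // mulr0 subrr !mulr0.
  by rewrite ler_wpM2r ?hw // subr_ge0 hA.
rewrite !(big_nat_recr N.+1) //= -[N.+1%:R]natr1; move: IH key.
set S := \sum_(_ <= _ < _) (_ * _); set W := \sum_(_ <= _ < _) w _; set A := \sum_(_ <= _ < _) _.
by lra.
Qed.

Lemma sum_inv_sqr_le N : \sum_(1 <= m < N.+1) (m%:R ^- 2 : R) <= 2.
Proof.
suff : \sum_(1 <= m < N.+1) (m%:R ^- 2 : R) <= 2 - N%:R^-1.
  by move=> h; apply: (le_trans h); rewrite lerBlDr lerDl invr_ge0.
elim: N => [|[|N] IH]; first by rewrite big_geq // invr0 subr0.
  by rewrite big_nat1 expr1n invr1; lra.
rewrite big_nat_recr //=; apply: (le_trans (lerD IH (lexx _))).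
have n0 : 0 < N.+1%:R :> R by rewrite ltr0n.
rewrite -[N.+2%:R]natr1; move: (N.+1%:R : R) n0 => x x0.
have -> : (x + 1)^-1 = x^-1 - (x * (x + 1))^-1 by field; lra.
rewrite opprB addrA [2 - _ + _]addrAC lerD2r lerD2l.
rewrite lef_pV2 ?posrE ?exprn_gt0 ?mulr_gt0 ?addr_gt0 //; nra.
Qed.

End RealSums.

Section PrimeCounting.
Variables (R : realType) (K : fieldExtType rat).
Local Notation n := (deg K).
Local Notation O := (ringint K).
Implicit Types (P Q : set O) (s : seq (set O)).

Lemma nrm_nat m : nrm R (m%:R : O) = (m ^ n)%N.
Proof.
apply/eqP; rewrite -(eqr_nat R) nrmE natrX; apply/eqP.
under eq_bigr do rewrite raddfMn /= !rmorph_nat nc_nat.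
by rewrite big_const_ord iter_mulr_1.
Qed.

Lemma natr_ringint_eq0 m : ((m%:R : O) == 0) = (m == 0%N).
Proof.
apply/negb_inj; rewrite -(nrm_gt0 R) nrm_nat expn_gt0 lt0n.
by rewrite [(_ == _ :> nat) in X in _ || X]gtn_eqF ?deg_gt0 // orbF.
Qed.

(** Translation by 1 permutes the classes; summing g i + 1 - g (h i) over them cancels the
    representatives and leaves NP. *)
Lemma ideal_norm_mem P : nzideal P -> P (ideal_norm P)%:R.
Proof.
move=> nP; have [f [g [gK fI]]] := norm_index R nP; have [iP _] := nP.
pose h i := f (g i + 1).
have hinj : injective h.
  move=> i j /fI; rewrite opprD addrACA subrr addr0 => /fI; by rewrite !gK.
have : P (\sum_i ((g i + 1) - g (h i))).
  elim/big_ind: _ => [|x y|i _]; [exact: ideal0|exact: idealD|].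
  by apply/fI; rewrite gK.
rewrite sumrB big_split /= [X in _ - X](_ : _ = \sum_i g i).
  by rewrite addrAC subrr add0r sumr_const card_ord.
by rewrite [RHS](reindex_inj hinj).
Qed.

(** NP itself lies in P, so one of its rational prime factors does, and it is at most NP. *)
Lemma rational_prime P : prime_ideal P ->
  exists p, [/\ prime p, (p <= ideal_norm P)%N & P p%:R].
Proof.
move=> pP; have := ideal_norm_mem (prime_nz pP).
have := ideal_norm_prime_gt1 R pP; move: (ideal_norm P) => N N1.
rewrite {1}(prod_prime_decomp (ltnW N1)) prime_decompE big_map /=.
rewrite natr_prod => PN.
have [q qN Pq] : exists2 q, q \in primes N & P (q ^ logn q N)%:R.
  apply: contrapT => no; move: PN; rewrite big_seq.
  apply: (big_ind (fun x => ~ P x)); [exact: prime_not1|by move=> x y ? ? /(prime_mulP pP) []|].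
  by move=> q qN Pq; apply: no; exists q.
move: qN; rewrite mem_primes => /and3P[pq _ qN].
exists q; split=> //; first by rewrite dvdn_leq // ltnW.
move: Pq; rewrite natrX; elim: (logn q N) => [|k IH].
  by rewrite expr0 => /(prime_not1 pP).
by rewrite exprS => /(prime_mulP pP) [].
Qed.

Lemma finite_primes_containing (x : O) : x != 0 ->
  finite_set [set P | prime_ideal P /\ P x].
Proof.
move=> x0; apply: contrapT => /(infinite_set_fset (nrm R x)) [B sB leB].
have pB : primes_seq (enum_fset B) by move=> P /sB [].
have := prod_primes_norm_le R pB (fset_uniq B) x0 (fun P hP => (sB P hP).2).
apply/negP; rewrite -ltnNge; apply: (leq_trans (ltn_expl (nrm R x) (ltnSn 1))).
apply: (leq_trans (leq_pexp2l (isT : 0 < 2)%N leB)).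
have -> : (2 ^ #|` B| = \prod_(P <- enum_fset B) 2)%N.
  by rewrite big_const_seq count_predT iter_muln_1.
rewrite big_seq [X in (_ <= X)%N]big_seq.
by apply: leq_prod => P /pB /(ideal_norm_prime_gt1 R).
Qed.

Definition primes_le N : seq (set O) :=
  enum_fset (fset_set [set P | prime_ideal P /\ (ideal_norm P <= N)%N]).

Lemma finite_primes_le N : finite_set [set P : set O | prime_ideal P /\ (ideal_norm P <= N)%N].
Proof.
have h : (N`!%:R : O) != 0 by rewrite natr_ringint_eq0 -lt0n fact_gt0.
apply: sub_finite_set (finite_primes_containing h) => P [pP leP]; split=> //.
have iP := prime_is_ideal pP; have [p [pp lep Pp]] := rational_prime pP.
have /dvdnP[k ->] : (p %| N`!)%N by rewrite dvdn_fact // prime_gt0 // (leq_trans lep).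
by rewrite natrM; apply: idealMl.
Qed.

Lemma mem_primes_le N P : (P \in primes_le N) <-> prime_ideal P /\ (ideal_norm P <= N)%N.
Proof.
rewrite /primes_le -[P \in enum_fset _]/(P \in fset_set _) in_fset_set; last exact: finite_primes_le.
by split=> [/set_mem|h] //; apply: mem_set.
Qed.

Lemma primes_le_uniq N : uniq (primes_le N). Proof. exact: fset_uniq. Qed.

Lemma primes_le_primes N : primes_seq (primes_le N).
Proof. by move=> P /mem_primes_le []. Qed.

Definition theta_const : R := n%:R * ln 16.

Lemma theta_const_ge0 : 0 <= theta_const.
Proof. by rewrite mulr_ge0 // ln_ge0 // ler1n. Qed.

(** Chebyshev's bound. The primes are grouped by a rational prime p <= N inside them: those
    containing p have norms with product at most |N(p)| = p^n, and [primorial_le] sums the n ln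
    p. *)
Lemma theta_bound s N : uniq s -> primes_seq s ->
  (forall P, P \in s -> (ideal_norm P <= N)%N) ->
  \sum_(P <- s) ln (ideal_norm P)%:R <= theta_const * N%:R.
Proof.
move=> us ps sN.
have /choice [p pP] : forall P, exists p, prime_ideal P ->
    [/\ prime p, (p <= ideal_norm P)%N & P p%:R].
  move=> P; have [/rational_prime [p hp]|np] := pselect (prime_ideal P).
    by exists p.
  by exists 0%N => /np.
have pos P : P \in s -> (0 < ideal_norm P)%N.
  by move=> /ps/(ideal_norm_prime_gt1 R)/ltnW.
pose J P : 'I_N.+1 := inord (p P).
have Jp P : P \in s -> J P = p P :> nat.
  move=> sP; rewrite /J inordK // ltnS; apply: leq_trans (sN P sP).
  by case: (pP P (ps P sP)).
rewrite big_seq /=.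
rewrite (partition_big J (fun j : 'I_N.+1 => prime j)) /=; last first.
  by move=> P sP; rewrite Jp //; case: (pP P (ps P sP)).
apply: (@le_trans _ _ (\sum_(j < N.+1 | prime j) n%:R * ln j%:R)); last first.
  rewrite -mulr_sumr /theta_const -mulrA ler_wpM2l //.
  rewrite -(big_mkord (fun j => prime j) (fun j => ln (j%:R : R))) /=.
  rewrite -big_filter (sum_ln _ _ (F := id)); last first.
    by move=> j; rewrite mem_filter => /andP[/prime_gt0].
  rewrite big_filter; apply: (@le_trans _ _ (ln (16 ^ N)%N%:R)).
    by apply: ler_ln_nat; [apply: prodn_cond_gt0 => j /prime_gt0 | exact: primorial_le].
  by rewrite natrX lnXn ?ltr0n // mulr_natr.
apply: ler_sum => j pj.
have -> : \sum_(P <- s | (P \in s) && (J P == j)) ln (ideal_norm P)%:R =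
    \sum_(P <- [seq P <- s | J P == j]) ln ((ideal_norm P)%:R : R).
  by rewrite big_filter [RHS]big_seq_cond.
rewrite sum_ln => [|P]; last by rewrite mem_filter => /andP[_ /pos].
have -> : n%:R * ln j%:R = ln ((nrm R (j%:R : O))%:R) :> R.
  by rewrite nrm_nat natrX lnXn ?ltr0n ?prime_gt0 // mulr_natl.
apply: ler_ln_nat.
  by rewrite big_seq; apply: prodn_cond_gt0 => P; rewrite mem_filter => /andP[_ /pos].
apply: prod_primes_norm_le.
- by move=> P; rewrite mem_filter => /andP[_ /ps].
- by rewrite filter_uniq.
- by rewrite natr_ringint_eq0 -lt0n prime_gt0.
- move=> P; rewrite mem_filter => /andP[/eqP jP sP].
  by rewrite -jP Jp //; case: (pP P (ps P sP)).
Qed.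

Lemma sum_primes_weight_le s N (w : nat -> R) : uniq s -> primes_seq s ->
  (forall P, P \in s -> (ideal_norm P <= N)%N) ->
  (forall m, (0 < m)%N -> w m.+1 <= w m) -> (forall m, 0 <= w m) ->
  \sum_(P <- s) ln (ideal_norm P)%:R * w (ideal_norm P) <=
  theta_const * \sum_(1 <= m < N.+1) w m.
Proof.
move=> us ps sN wdec w0.
pose a m : R := \sum_(P <- s | ideal_norm P == m) ln (ideal_norm P)%:R.
have part (F : nat -> R) m : (m <= N)%N ->
    \sum_(1 <= i < m.+1) a i * F i =
    \sum_(P <- s | (ideal_norm P <= m)%N) ln (ideal_norm P)%:R * F (ideal_norm P).
  move=> mN; under eq_bigr do rewrite mulr_suml.
  rewrite (exchange_big_dep (fun P => true)) //= [RHS]big_mkcond /=.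
  apply: eq_big_seq => P sP; rewrite (eq_bigl (fun i => i == ideal_norm P)); last first.
    by move=> i; rewrite eq_sym.
  rewrite big_nat1_eq ltnS (ltnW (ideal_norm_prime_gt1 R (ps P sP))) /=.
  by case: ifP.
have allN : \sum_(P <- s | (ideal_norm P <= N)%N) ln (ideal_norm P)%:R * w (ideal_norm P) =
    \sum_(P <- s) ln (ideal_norm P)%:R * w (ideal_norm P).
  by rewrite big_seq_cond [RHS]big_seq; apply: eq_bigl => P; case sP: (P \in s) => //=; rewrite sN.
rewrite -allN -part //; apply: sum_weight_le => // m mN.
under eq_bigr do rewrite -[a _]mulr1.
rewrite (part (fun=> 1)) //; under eq_bigr do rewrite mulr1.
rewrite -big_filter; apply: theta_bound.
- by rewrite filter_uniq.
- by move=> P; rewrite mem_filter => /andP[_ /ps].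
- by move=> P; rewrite mem_filter => /andP[].
Qed.

End PrimeCounting.

(** * Lattice points in boxes *)

Lemma ringint_val_nat (K : fieldExtType rat) m : ringint_val (m%:R : ringint K) = m%:R.
Proof. exact: (rmorph_nat (val : {rmorphism ringint K -> K})). Qed.

Section Boxes.
Variables (R : realType) (K : fieldExtType rat).
Local Notation n := (deg K).
Local Notation O := (ringint K).
Implicit Types (I P : set O).

Definition inbox (X : nat) (x : O) := forall j, `|zcoord R x 0 j| <= X%:Z.

Local Notation T X := {ffun 'I_n -> 'I_(X.*2.+1)}.

Definition box_pt X (t : T X) : O := ofc R (\row_j ((t j : nat)%:Z - X%:Z)).

Lemma card_box X : #|{: T X}| = (X.*2.+1 ^ n)%N.
Proof. by rewrite card_ffun !card_ord. Qed.

Lemma box_pt_inj X : injective (@box_pt X).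
Proof.
move=> t u /(can_inj (@ofcK R K)) /rowP h; apply/ffunP => j; apply: val_inj.
by have := h j; rewrite !mxE => /(addIr _) [].
Qed.

Lemma box_pt_inbox X (t : T X) : inbox X (box_pt t).
Proof. by move=> j; rewrite ofcK mxE; have := ltn_ord (t j); lia. Qed.

Lemma inboxP X x : inbox X x -> exists t : T X, box_pt t = x.
Proof.
move=> bx; exists [ffun j => inord `|(zcoord R x 0%R j + X%:Z)%R|%N].
apply: (can_inj (@zcoordK R K)); rewrite ofcK; apply/rowP => j.
rewrite !mxE ffunE; have := bx j; move: (zcoord R x 0 j) => z bz.
by rewrite inordK; lia.
Qed.

Lemma inboxD X Y x y : inbox X x -> inbox Y y -> inbox (X + Y) (x + y).
Proof.
move=> bx by_ j; rewrite raddfD mxE PoszD; apply: le_trans (ler_normD _ _) _.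
by apply: lerD.
Qed.

Lemma inboxW X Y x : (X <= Y)%N -> inbox X x -> inbox Y x.
Proof. by move=> XY bx j; apply: le_trans (bx j) _; rewrite lez_nat. Qed.

Lemma inboxMn X x k : inbox X x -> inbox (k * X) (x *+ k).
Proof.
by move=> bx j; rewrite raddfMn mulmxnE normrMn PoszM -mulr_natl natz ler_wpM2l.
Qed.

Lemma inbox_ex x : exists X, inbox X x.
Proof.
exists (\max_j `|zcoord R x 0%R j|%N) => j; rewrite -abszE lez_nat.
exact: (@leq_bigmax _ (fun j => `|zcoord R x 0%R j|%N)).
Qed.

(** Pigeonhole on the (m+1)^n points with coordinates in [0, m], whose differences have coordinates
    in [-m, m]. *)
Lemma small_element I m : nzideal I -> (ideal_norm I < m.+1 ^ n)%N ->
  exists x, [/\ I x, x != 0 & inbox m x].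
Proof.
move=> nI lt; have [f [g [gK fI]]] := norm_index R nI.
pose p (t : {ffun 'I_n -> 'I_m.+1}) : O := ofc R (\row_j (t j : nat)%:Z).
have /injectivePn [t [u tu ftu]] : ~~ injectiveb (fun t => f (p t)).
  apply/injectiveP => /leq_card; rewrite card_ffun !card_ord leqNgt; exact/negP/negPn.
exists (p t - p u); split; first exact/fI.
  rewrite subr_eq0; apply: contra tu => /eqP /(can_inj (@ofcK R K)) /rowP h.
  by apply/eqP/ffunP => j; apply: val_inj; have := h j; rewrite !mxE => -[].
move=> j; rewrite -raddfB ofcK !mxE.
move: (nat_of_ord (t j)) (ltn_ord (t j)) (nat_of_ord (u j)) (ltn_ord (u j)) => a la b lb.
clear -la lb; lia.
Qed.

(** The total size of the multiplication table of the basis; it controls the column sums of [mulmat]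
    on a box. *)
Definition structure_const : nat :=
  \sum_(j < n) \sum_(l < n) \sum_(k < n) `|zcoord R (bas R j * bas R l)%R 0%R k|%N.

Lemma mulmat_le m x k : inbox m x ->
  \sum_j `|mulmat R x j k| <= (structure_const * m)%:Z.
Proof.
move=> bx; apply: (@le_trans _ _ (\sum_(j < n) (\sum_(l < n)
    `|zcoord R (bas R j * bas R l) 0 k|) * m%:Z)).
  apply: ler_sum => j _; rewrite mxE mulrC zcoordM mxE.
  apply: le_trans (ler_norm_sum _ _ _) _; rewrite mulr_suml; apply: ler_sum => l _.
  by rewrite normrM mulrC mxE [bas R l * _]mulrC ler_wpM2l.
rewrite -mulr_suml PoszM ler_wpM2r // /structure_const.
rewrite (big_morph Posz PoszD (erefl _)); apply: ler_sum => j _.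
rewrite (big_morph Posz PoszD (erefl _)); apply: ler_sum => l _.
by rewrite (bigD1 k) //= PoszD abszE lerDl.
Qed.

(** Reduction into the fundamental parallelepiped of x O: the integer parts of the coordinates of y
    / x, which are v / d by the adjugate, are removed, and what is left is r / d times M with 0 <=
    r_j < |d|. *)
Lemma small_residue I m x : ideal I -> I x -> x != 0 -> inbox m x ->
  forall y, exists y', I (y - y') /\ inbox (structure_const * m) y'.
Proof.
move=> iI Ix x0 bx y; set M := mulmat R x; set d := \det M.
have d0 : d != 0 by have := nrm_gt0 R x; rewrite x0 /nrm absz_gt0.
pose v := zcoord R y *m \adj M.
pose a : 'rV[int]_n := \row_j (v 0%R j %/ d)%Z; pose r : 'rV[int]_n := \row_j (v 0%R j %% d)%Z.
have vE : v = d *: a + r.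
  by apply/rowP => j; rewrite !mxE mulrC -divz_eq.
exists (y - ofc R a * x); split; first by rewrite opprB addrC subrK; apply: idealMl.
have E : d *: zcoord R (y - ofc R a * x) = r *m M.
  rewrite raddfB /= zcoordM ofcK -/M scalerBr scalemxAl.
  have -> : d *: zcoord R y = v *m M.
    by rewrite /v -mulmxA mul_adj_mx mul_mx_scalar.
  by rewrite -mulmxBl vE addrAC subrr add0r.
move=> k; set z := zcoord R _; have := congr1 (fun B : 'rV_n => `|B 0 k|) E.
rewrite !mxE normrM -/z => zE; rewrite -(@ler_pM2l _ `|d|) ?normr_gt0 // zE.
apply: le_trans (ler_norm_sum _ _ _) _.
apply: le_trans (_ : `|d| * \sum_j `|M j k| <= _); last first.
  by rewrite ler_pM2l ?normr_gt0 // mulmat_le.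
rewrite mulr_sumr; apply: ler_sum => j _; rewrite normrM ler_wpM2r // mxE.
by rewrite ger0_norm ?modz_ge0 // ltW // ltz_mod.
Qed.

Definition box_count X I : nat := #|[set t : T X | `[< I (box_pt t) >]]%SET|.

(** Box points of I translated by representatives of all the classes are pairwise distinct and stay
    in a box enlarged by D. *)
Lemma box_count_residue I X D : nzideal I ->
  (forall y, exists y', I (y - y') /\ inbox D y') ->
  (ideal_norm I * box_count X I <= (X + D).*2.+1 ^ n)%N.
Proof.
move=> nI rep; have [f [g [gK fI]]] := norm_index R nI; have [iI _] := nI.
have /choice [h hP] : forall i, exists y', I (g i - y') /\ inbox D y' by move=> i; apply: rep.
have /choice [q qP] : forall it : 'I_(ideal_norm I) * T X, exists u : T (X + D),
    box_pt u = box_pt it.2 + h it.1.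
  move=> [i t]; apply: inboxP; apply: inboxD; first exact: box_pt_inbox.
  by case: (hP i).
pose S := finset.setX [set: 'I_(ideal_norm I)]%SET [set t : T X | `[< I (box_pt t) >]]%SET.
have qinj : {in S &, injective q}.
  move=> [i t] [j u]; rewrite !finset.in_setX !inE /= => /asboolP It /asboolP Iu /(congr1 (@box_pt _)).
  rewrite !qP /= => e.
  have ij : i = j.
    rewrite -[ i ]gK -[j]gK; apply/fI.
    rewrite (_ : _ - _ = (g i - h i) - (g j - h j) + (box_pt u - box_pt t)).
      by apply: idealD; [| apply: idealB => //; [case: (hP i)|case: (hP j)] | apply: idealB].
    have -> : h i = box_pt u + h j - box_pt t by rewrite -e; ring.
    by ring.
  by move: e; rewrite ij => /addIr/box_pt_inj ->.
have := max_card (q @: S)%SET; rewrite card_in_imset // card_box.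
by rewrite /S cardsX cardsT card_ord.
Qed.

Lemma box_count_le I X m : nzideal I -> (ideal_norm I < m.+1 ^ n)%N ->
  (ideal_norm I * box_count X I <= (X + structure_const * m).*2.+1 ^ n)%N.
Proof.
move=> nI lt; have [x [Ix x0 bx]] := small_element nI lt.
apply: box_count_residue => //; apply: (small_residue _ Ix) => //; by case: nI.
Qed.

(* The elements of the box where an embedding is small stay distinct after
   translation by the multiples of a fixed rational integer. *)
Lemma box_small_emb : exists C : nat, forall (i : 'I_n) (X : nat) (d : R), (0 < X)%N -> 0 <= d ->
  #|[set t : T X | nc (emb R i (val (box_pt t))) <= d]%SET|%:R * X%:R <=
  C%:R * (2 * d + 1) * #|{: T X}|%:R :> R.
Proof.
have [D bD] := inbox_ex 1.
exists ((1 + D) ^ n)%N => i X d X0 d0.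
set E := [set t | _]%SET.
(* Values of modulus at most d differ by at most 2d < h, so the multiples of h serve as
   translations; [k0] is the number of positive ones up to X. *)
pose h := (Num.truncn (2 * d)).+1; pose k0 := (X %/ h)%N.
have h0 : (0 < h)%N by [].
have hd : 2 * d < h%:R by rewrite /h truncnS_gt.
have hd' : h%:R <= 2 * d + 1.
  by rewrite /h -natr1 lerD2r; rewrite truncn_le mulr_ge0.
have /choice [q qP] : forall kt : 'I_k0.+1 * T X, exists u : T (X + D * X),
    box_pt u = box_pt kt.2 + (1 *+ (kt.1 * h)%N).
  move=> [k t]; apply: inboxP; apply: inboxD; first exact: box_pt_inbox.
  apply: inboxW (inboxMn (k * h) bD); rewrite mulnC leq_mul2l; apply/orP; right.
  have := ltn_ord k; rewrite /k0 ltnS => /= kk; apply: leq_trans (leq_divM X h).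
  by rewrite leq_mul2r kk orbT.
pose S := finset.setX [set: 'I_k0.+1]%SET E.
have qinj : {in S &, injective q}.
  move=> [k t] [l u]; rewrite !finset.in_setX !inE /= => Et Eu /(congr1 (@box_pt _)).
  rewrite !qP /= => e.
  have kl : k = l.
    apply/val_inj/eqP; apply: contraT => kl /=.
    have := congr1 (fun x : O => emb R i (val x)) e.
    rewrite /= !rmorphD /= !ringint_val_nat !rmorph_nat => e2.
    have e3 : emb R i (val (box_pt t)) - emb R i (val (box_pt u)) =
        ((l * h)%N%:Z - (k * h)%N%:Z)%:~R.
      rewrite rmorphB /= -!pmulrn; move/eqP: e2; rewrite -subr_eq => /eqP <-; ring.
    have : nc (emb R i (val (box_pt t)) - emb R i (val (box_pt u))) <= d + d.
      by apply: le_trans (ncD _ _) _; rewrite ncN lerD.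
    rewrite e3 nc_int; have -> : d + d = 2 * d by ring.
    move=> /le_lt_trans/(_ hd); rewrite -[h%:R]/((h%:Z)%:~R) ltr_int.
    by move: kl; rewrite -[_ != _]/(k != l :> nat); nia.
  by move: e; rewrite kl => /addIr/box_pt_inj ->.
have := max_card (q @: S)%SET; rewrite card_in_imset // card_box.
rewrite /S cardsX cardsT card_ord => le1.
have le2 : (k0.+1 * #|E| <= (1 + D) ^ n * #|{: T X}|)%N.
  apply: leq_trans le1 _; rewrite !card_box -expnMn leq_exp2r ?deg_gt0 //; lia.
have le3 : (X <= k0.+1 * h)%N by rewrite ltnW // /k0 -ltn_divLR.
have : (#|E| * X <= (1 + D) ^ n * #|{: T X}| * h)%N.
  apply: leq_trans (leq_mul le2 (leqnn h)); rewrite mulnAC mulnC leq_mul2r le3 orbT //.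
rewrite ?card_box -(ler_nat R) !natrM => le4; apply: le_trans le4 _.
by rewrite [leRHS]mulrAC ler_wpM2l // mulr_ge0.
Qed.

End Boxes.

(** * Integer n-th roots as summation weights *)

Section IntegerRoot.
Variable n : nat.
Hypothesis n0 : (0 < n)%N.

Definition iroot (N : nat) : nat := \max_(m < N.+1 | (m ^ n <= N)%N) m.

Lemma iroot_le N : (iroot N ^ n <= N)%N.
Proof.
rewrite /iroot; have [|m mN ->] := @eq_bigmax_cond _ [pred m : 'I_N.+1 | (m ^ n <= N)%N] (@nat_of_ord _).
  by apply/card_gt0P; exists ord0; rewrite inE exp0n.
by [].
Qed.

Lemma le_iroot m N : (m ^ n <= N)%N -> (m <= iroot N)%N.
Proof.
move=> le; have mN : (m < N.+1)%N.
  rewrite ltnS; apply: leq_trans le; case: n n0 => // k _; case: m => // m.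
  by rewrite expnS leq_pmulr // expn_gt0.
exact: (@leq_bigmax_cond _ (fun m : 'I_N.+1 => (m ^ n <= N)%N) (@nat_of_ord _) (Ordinal mN)).
Qed.

Lemma iroot_gt N : (N < (iroot N).+1 ^ n)%N.
Proof. by rewrite ltnNge; apply/negP => /le_iroot; rewrite ltnn. Qed.

Lemma iroot_homo : {homo iroot : M N / (M <= N)%N}.
Proof. by move=> M N MN; apply: le_iroot; apply: leq_trans (iroot_le M) MN. Qed.

Lemma iroot_gt0 N : (0 < N)%N -> (0 < iroot N)%N.
Proof. by move=> N0; apply: le_iroot; rewrite exp1n. Qed.

Lemma iroot_eq m N : (m ^ n <= N)%N -> (N < m.+1 ^ n)%N -> iroot N = m.
Proof.
move=> h1 h2; apply/eqP; rewrite eqn_leq (le_iroot h1) andbT -ltnS.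
by rewrite -(ltn_exp2r _ _ n0); apply: leq_ltn_trans h2; exact: iroot_le.
Qed.

Lemma expnS_diff b k : (b.+1 ^ k.+1 <= b ^ k.+1 + k.+1 * b.+1 ^ k)%N.
Proof.
elim: k => [|k IH]; first by rewrite !expn1 expn0 muln1 addn1.
rewrite expnS; apply: leq_trans (leq_mul (leqnn _) IH) _.
rewrite mulnDr (expnS b.+1 k) [in X in (X + _ <= _)%N]mulSn.
have : (b ^ k.+1 <= b.+1 ^ k.+1)%N by rewrite leq_exp2r.
rewrite !expnS; nia.
Qed.

Variable R : realType.

(** A step function of size m^(1/n - 1), constant between consecutive n-th powers. *)
Definition iroot_weight (m : nat) : R := (iroot m)%:R ^- n.-1.

Lemma iroot_weight_ge0 m : 0 <= iroot_weight m.
Proof. by rewrite invr_ge0 exprn_ge0. Qed.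

Lemma iroot_weight_le m : (0 < m)%N -> iroot_weight m.+1 <= iroot_weight m.
Proof.
move=> m0; rewrite lef_pV2 ?posrE ?exprn_gt0 ?ltr0n ?iroot_gt0 //.
by rewrite lerXn2r ?nnegrE // ler_nat iroot_homo.
Qed.

Lemma iroot_div_le m : (0 < m)%N -> (iroot m)%:R / m%:R <= iroot_weight m.
Proof.
move=> m0; have r0 := iroot_gt0 m0.
rewrite ler_pdivrMr ?ltr0n // /iroot_weight mulrC ler_pdivlMr ?exprn_gt0 ?ltr0n //.
by rewrite -exprS prednK // -natrX ler_nat iroot_le.
Qed.

(** Each block between consecutive n-th powers contributes O(1): it has at most n (J+2)^(n-1)
    members of weight (J+1)^(1-n), and J+2 <= 2 (J+1). *)
Lemma sum_iroot_weight J :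
  \sum_(1 <= m < J.+1 ^ n) iroot_weight m <= J%:R * (n * 2 ^ n.-1)%N%:R.
Proof.
elim: J => [|J IH]; first by rewrite exp1n big_geq // mul0r.
have le1 : (1 <= J.+1 ^ n)%N by rewrite expn_gt0.
rewrite (@big_cat_nat _ _ _ (J.+1 ^ n)) //=; last by rewrite leq_exp2r.
rewrite -[J.+1%:R]natr1 mulrDl mul1r lerD //.
have E m : (J.+1 ^ n <= m < J.+2 ^ n)%N -> iroot_weight m = J.+1%:R ^- n.-1.
  by case/andP=> h1 h2; rewrite /iroot_weight (iroot_eq h1 h2).
rewrite (eq_big_nat _ _ E) sumr_const_nat -[X in X <= _]mulr_natl ler_pdivrMr ?exprn_gt0 ?ltr0n //.
rewrite -natrX -natrM ler_nat leq_subLR -mulnA -expnMn.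
case: n n0 => // k _ /=; apply: leq_trans (expnS_diff J.+1 k) _.
rewrite leq_add2l leq_mul2l; case: k => // k; rewrite leq_exp2r //; lia.
Qed.

End IntegerRoot.

Section Layers.
Variable R : realType.

(** A dyadic layer formula, which turns a sum of logarithms over a box into counts of the points
    where an embedding is small. *)
Lemma ln_layers (r : R) J : 1 <= r -> r < 2 ^+ J ->
  ln r <= ln 2 * \sum_(j < J) (2 ^+ j <= r)%R%:R.
Proof.
move=> r1; have l2 : 0 <= ln (2 : R) by rewrite ln_ge0 // ler1n.
elim: J => [|J IH]; first by rewrite expr0 => /(le_lt_trans r1); rewrite ltxx.
move=> rJ; rewrite big_ord_recr /= mulrDr; have [le|lt] := leP (2 ^+ J) r; last first.
  by rewrite mulr0 addr0 IH.
have -> : \sum_(j < J) (2 ^+ j <= r)%R%:R = J%:R :> R.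
  rewrite -[RHS](_ : \sum_(j < J) 1 = _); last by rewrite sumr_const card_ord.
  apply: eq_bigr => j _; rewrite (le_trans _ le) //.
  by rewrite ler_weXn2l ?ler1n // ltnW.
rewrite -mulrDr natr1 mulr_natr -lnXn //.
have r0 : 0 < r := lt_le_trans ltr01 r1.
by rewrite ler_ln ?posrE ?exprn_gt0 // ltW.
Qed.

Lemma geometric_half (J : nat) : \sum_(j < J) (2 ^- j : R) <= 2.
Proof.
suff -> : \sum_(j < J) (2 ^- j : R) = 2 - 2 * 2 ^- J.
  by rewrite lerBlDr lerDl mulr_ge0 // invr_ge0 exprn_ge0.
elim: J => [|J IH]; first by rewrite big_ord0 expr0 invr1; ring.
by rewrite big_ord_recr /= IH exprS invfM mulrA divff ?pnatr_eq0 // mul1r; ring.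
Qed.

End Layers.

(** * Lower bound for the logarithms of norms over a box *)

Section LowerBound.
Variables (R : realType) (K : fieldExtType rat).
Local Notation n := (deg K).
Local Notation O := (ringint K).
Local Notation T X := {ffun 'I_n -> 'I_(X.*2.+1)}.
Local Notation av i x := (nc (emb R i (val (x : O)))).

Lemma emb_inbox_le : exists C : nat, (0 < C)%N /\
  forall X (x : O) i, inbox R X x -> av i x <= (C * X)%N%:R.
Proof.
pose S : R := \sum_(i < n) \sum_(j < n) av i (bas R j).
have term0 (i j : 'I_n) : 0 <= av i (bas R j) by exact: nc_ge0.
exists (Num.truncn S).+1; split=> // X x i bx.
rewrite -(zcoordK R x) emb_ofc; apply: le_trans (nc_sum _ _) _.
apply: (@le_trans _ _ (\sum_j X%:R * av i (bas R j))).
  apply: ler_sum => j _; rewrite Normc.normcM nc_int ler_wpM2r ?nc_ge0 //.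
  by rewrite -[X%:R]/((X%:Z)%:~R) ler_int bx.
rewrite -mulr_sumr mulnC natrM ler_wpM2l //; apply: le_trans (ltW (truncnS_gt S)).
rewrite /S [leRHS](bigD1 i) //= lerDl; apply: sumr_ge0 => k _; apply: sumr_ge0 => j _; exact: term0.
Qed.

(** Since Y = C X bounds all embeddings on the box, write ln |N(x)| as n ln Y minus the sum of the
    ln (Y / |x|_i). Each of these terms has bounded average: |x|_i <= Y / 2^j holds for a proportion
    O(2^-j + 1/X) of the points. *)
Lemma sum_ln_nrm_ge (C : nat) : (0 < C)%N ->
  (forall X (x : O) i, inbox R X x -> av i x <= (C * X)%N%:R) ->
  exists C1 : R, forall X, (0 < X)%N ->
   (n%:R * ln (C * X)%N%:R - C1) * #|{: T X}|%:R <=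
   \sum_(t : T X | box_pt R t != 0) ln (nrm R (box_pt R t))%:R.
Proof.
move=> C0 embC; have [D hD] := box_small_emb R K.
exists (n%:R * (ln 2 * D%:R * (4 + n%:R) * C%:R + C%:R)) => X X0.
set Y : R := (C * X)%N%:R.
have Y1 : 1 <= Y by rewrite ler1n muln_gt0 C0.
have Y0 : 0 < Y by apply: lt_le_trans Y1.
have lnY : 0 <= ln Y by rewrite ln_ge0.
have l2 : 0 <= ln (2 : R) by rewrite ln_ge0 // ler1n.
have XR : 0 < X%:R :> R by rewrite ltr0n.
have TX0 : (X.*2.+1 <= #|{: T X}|)%N.
  by rewrite card_box -{1}(expn1 X.*2.+1) leq_pexp2l // deg_gt0.
have av0 (i : 'I_n) (x : O) : x != 0 -> 0 < av i x.
  by move=> x0; rewrite nc_gt0 fmorph_eq0 val_eq0.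
have le1 (i : 'I_n) : \sum_(t : T X | box_pt R t != 0) ln (Y / av i (box_pt R t)) <=
    ln 2 * D%:R * (4 + n%:R) * C%:R * #|{: T X}|%:R.
  (* Enough layers: |N(x)| >= 1 forces Y / |x|_i <= Y^n < 2^J, while J = O(X) keeps the total of the
     terms 1/X bounded. *)
  pose J := (n * (C * X))%N.
  apply: (@le_trans _ _ (\sum_(t : T X | box_pt R t != 0)
      ln 2 * \sum_(j < J) (av i (box_pt R t) <= Y * 2 ^- j)%R%:R)).
    apply: ler_sum => t t0; set x := box_pt R t in t0 *.
    have x0 := av0 i x t0.
    have E (j : 'I_J) : (2 ^+ j <= Y / av i x) = (av i x <= Y * 2 ^- j).
      by rewrite ler_pdivlMr // ler_pdivlMr ?exprn_gt0 // mulrC.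
    under eq_bigr do rewrite -E; apply: ln_layers.
      by rewrite ler_pdivlMr // mul1r embC //; exact: box_pt_inbox.
    apply: (@le_lt_trans _ _ (Y ^+ n)); last first.
      rewrite /J mulnC exprM ltr_pXn2r ?deg_gt0 ?nnegrE ?exprn_ge0 //.
      by rewrite -natrX ltr_nat ltn_expl.
    rewrite ler_pdivrMr // -(prednK (deg_gt0 K)) exprS -mulrA ler_peMr //.
    have : 1 <= (nrm R x)%:R :> R by rewrite ler1n nrm_gt0.
    rewrite nrmE (bigD1 i) //= => /le_trans; apply; rewrite mulrC ler_wpM2r ?nc_ge0 //.
    have <- : #|[pred k : 'I_n | k != i]| = n.-1 by rewrite cardC1 card_ord.
    rewrite -prodr_const; apply: ler_prod => k _; rewrite nc_ge0 embC //.
    exact: box_pt_inbox.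
  rewrite -mulr_sumr -!mulrA ler_wpM2l // exchange_big /=.
  apply: (@le_trans _ _ (\sum_(j < J) (D%:R * (2 * (Y * 2 ^- j) + 1) * #|{: T X}|%:R / X%:R))).
    apply: ler_sum => j _; rewrite ler_pdivlMr //.
    have Yj : 0 <= Y * 2 ^- j by rewrite mulr_ge0 ?invr_ge0 ?exprn_ge0 // ltW.
    apply: le_trans (hD i X _ X0 Yj); rewrite ler_wpM2r // -sum1_card natr_sum.
    rewrite big_mkcond [leRHS]big_mkcond; apply: ler_sum => t _; rewrite inE.
    by case: ifP => _; case: ifP.
  rewrite -!mulr_suml -mulr_sumr -!mulrA ler_wpM2l //.
  rewrite big_split /= sumr_const card_ord -!mulr_sumr.
  set G := \sum_(j < J) _; have G2 : G <= 2 := geometric_half R J.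
  have JE : J%:R = n%:R * Y :> R by rewrite /J natrM.
  have YE : Y = C%:R * X%:R by rewrite /Y natrM.
  have -> : (2 * (Y * G) + J%:R) * (#|{: T X}|%:R / X%:R) =
      (2 * G + n%:R) * C%:R * #|{: T X}|%:R.
    by rewrite JE YE; field; rewrite gt_eqF.
  rewrite mulrA ler_wpM2r // ler_wpM2r // lerD2r; lra.
have le2 (t : T X) : box_pt R t != 0 ->
    ln (nrm R (box_pt R t))%:R = n%:R * ln Y - \sum_i ln (Y / av i (box_pt R t)).
  move=> t0; rewrite nrmE; have -> : n%:R * ln Y = \sum_(i < n) ln Y.
    by rewrite sumr_const card_ord mulr_natl.
  rewrite -sumrB; have : \prod_i av i (box_pt R t) > 0 by apply: prodr_gt0 => i _; exact: av0.
  elim/big_rec2: _ => [|i x y _ IH]; first by rewrite ln1.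
  rewrite pmulr_rgt0 ?av0 // => y0.
  have a0 := av0 i _ t0.
  have -> : ln (av i (box_pt R t) * y) = ln (av i (box_pt R t)) + ln y.
    by rewrite lnM ?posrE.
  have -> : ln (Y / av i (box_pt R t)) = ln Y - ln (av i (box_pt R t)).
    by rewrite ln_div ?posrE.
  by rewrite (IH y0); ring.
rewrite (eq_bigr _ le2) sumrB exchange_big /=.
have le3 : \sum_(i < n) \sum_(t : T X | box_pt R t != 0) ln (Y / av i (box_pt R t)) <=
    n%:R * (ln 2 * D%:R * (4 + n%:R) * C%:R * #|{: T X}|%:R).
  rewrite mulr_natl -[X in _ <= _ *+ X]card_ord -sumr_const.
  by apply: ler_sum => i _.
rewrite sumr_const -mulr_natl.
(* Leaving out the point 0 costs one term n ln Y, which is absorbed by the number of points. *)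
have card1 : (#|{: T X}| <= #|[pred t : T X | box_pt R t != 0%R]| .+1)%N.
  rewrite -(cardC [pred t : T X | box_pt R t != 0]) -[X in (_ <= X)%N]addn1 leq_add2l.
  apply/card_le1_eqP => t u; rewrite !inE !negbK => /eqP t0 /eqP u0.
  by apply: (@box_pt_inj R K X); rewrite t0 u0.
have card2 : #|{: T X}|%:R - 1 <= #|[pred t : T X | box_pt R t != 0%R]|%:R :> R.
  by rewrite lerBlDr natr1 ler_nat.
have lnYT : n%:R * ln Y <= n%:R * (C%:R * #|{: T X}|%:R).
  rewrite ler_wpM2l //; apply: le_trans (ltW (ln_sublinear Y0)) _.
  by rewrite /Y natrM ler_wpM2l // ler_nat; apply: leq_trans TX0; rewrite -addnn; lia.
have : (n%:R * ln Y) * (#|{: T X}|%:R - 1) <=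
    (n%:R * ln Y) * #|[pred t : T X | box_pt R t != 0%R]|%:R.
  by rewrite ler_wpM2l // mulr_ge0.
rewrite [leRHS]mulrC; move: le3 lnYT; set s1 := \sum_(i < n) _.
lra.
Qed.

End LowerBound.

(** * Mertens' lower bound *)

Section Mertens.
Variables (R : realType) (K : fieldExtType rat).
Local Notation n := (deg K).
Local Notation O := (ringint K).
Local Notation T X := {ffun 'I_n -> 'I_(X.*2.+1)}.
Local Notation av i x := (nc (emb R i (val (x : O)))).
Local Notation NP P := (ideal_norm P).

Lemma big_seq_count (I : eqType) (s S : seq I) (F : I -> R) : uniq S -> {subset s <= S} ->
  \sum_(P <- s) F P = \sum_(P <- S) (count_mem P s)%:R * F P.
Proof.
move=> uS; elim: s => [|Q s IH] sS.
  by rewrite big_nil big1 // => P _; rewrite mul0r.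
rewrite big_cons IH => [|P Ps]; last by apply: sS; rewrite in_cons Ps orbT.
under [RHS]eq_bigr do rewrite /= natrD mulrDl.
rewrite big_split /=; congr (_ + _).
have QS : Q \in S by apply: sS; rewrite mem_head.
rewrite (bigD1_seq Q) //= eqxx mul1r big1 ?addr0 // => P PQ.
by rewrite eq_sym (negPf PQ) mul0r.
Qed.

Lemma prime_pow_mem_norm P k (x : O) : prime_ideal P -> x != 0 -> prime_pow P k x ->
  (NP P ^ k <= nrm R x)%N.
Proof.
move=> pP x0 Px; rewrite -(prime_pow_norm R) // -(pid_norm R x0).
have [iP _] := prime_pow_nz k pP.
apply: (ideal_norm_sub R) => //; first exact: pid_nz.
by move=> _ [a ->]; apply: idealMr.
Qed.

(** The exponent of P in (x) is at most the number of k >= 1 with x in P^k, and it does not exceed Q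
    because 2^k <= NP^k <= |N(x)| for such k. *)
Lemma ln_nrm_le Q (x : O) : x != 0 -> (nrm R x <= Q)%N ->
  ln (nrm R x)%:R <= \sum_(P <- primes_le K Q) ln (NP P)%:R *
     \sum_(1 <= k < Q.+1) (`[< prime_pow P k x >] : bool)%:R :> R.
Proof.
move=> x0 xQ; have [s [ps sx]] := ideal_factorization R (pid_nz x0).
have xs : ideal_prod s x by rewrite -sx; exists 1; rewrite mulr1.
have pos P : P \in s -> (0 < NP P)%N.
  by move=> /ps /(ideal_norm_prime_gt1 R) /ltnW.
have cnt P : prime_ideal P -> (count_mem P s <= Q)%N.
  move=> pP; have Px := ideal_prod_nseq pP ps (leqnn _) xs.
  have le := leq_trans (prime_pow_mem_norm pP x0 Px) xQ.
  by apply: leq_trans le; exact: ltnW (ltn_expl _ (ideal_norm_prime_gt1 R pP)).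
have sub : {subset s <= primes_le K Q}.
  move=> P Ps; apply/(mem_primes_le R); split; first exact: ps.
  have c0 : (0 < count_mem P s)%N by rewrite -has_count has_pred1.
  have Px := ideal_prod_nseq (ps P Ps) ps c0 xs.
  by have := prime_pow_mem_norm (ps P Ps) x0 Px; rewrite expn1 => /leq_trans; apply.
rewrite -(pid_norm R x0) sx (ideal_norm_prod R ps) -sum_ln //.
rewrite (big_seq_count _ (primes_le_uniq K Q) sub).
rewrite big_seq [leRHS]big_seq; apply: ler_sum => P /(mem_primes_le R) [pP _].
rewrite mulrC ler_wpM2l ?ln_ge0 ?ler1n ?(ltnW (ideal_norm_prime_gt1 R pP)) //.
rewrite (@big_cat_nat _ _ _ (count_mem P s).+1) //=; last by rewrite ltnS cnt.
rewrite -[leLHS]addr0 lerD //; last by apply: sumr_ge0.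
rewrite big_seq (eq_bigr (fun=> 1)) => [|k].
  by rewrite -big_seq sumr_const_nat subSS subn0.
rewrite mem_index_iota ltnS => /andP[_ kc].
by rewrite asboolT //; exact: ideal_prod_nseq xs.
Qed.

Lemma geometric_tail (x : nat) L : (2 <= x)%N ->
  \sum_(2 <= k < L) (x%:R ^- k : R) <= 2 * x%:R ^- 2.
Proof.
move=> x2; have xR : 2 <= x%:R :> R by rewrite ler_nat.
have x0 : 0 < x%:R :> R by lra.
have [L2|L2] := leqP L 2; first by rewrite big_geq // mulr_ge0 // invr_ge0 exprn_ge0 // ltW.
suff : \sum_(2 <= k < L) (x%:R ^- k : R) <= 2 * x%:R ^- 2 - 2 * x%:R ^- L.
  by move=> h; apply: (le_trans h); rewrite lerBlDr lerDl mulr_ge0 // invr_ge0 exprn_ge0 // ltW.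
have y2 : x%:R^-1 <= 2^-1 :> R by rewrite lef_pV2 ?posrE.
have y0 : 0 <= x%:R^-1 :> R by rewrite invr_ge0 ltW.
under eq_bigr do rewrite -exprVn; rewrite -!exprVn; move: (x%:R^-1 : R) y0 y2 => y y0 y2.
have half w : 0 <= w -> y * w <= 2^-1 * w by move=> w0; rewrite ler_wpM2r.
elim: L L2 => [//|L IH]; rewrite ltnS leq_eqVlt => /orP[/eqP <-|L2].
  by rewrite big_nat1 [y ^+ 3]exprS; have := half _ (sqr_ge0 y); lra.
have L2' : (2 <= L)%N := ltnW L2.
rewrite (big_nat_recr L) //=; have := IH L2; have := half _ (exprn_ge0 L y0).
by rewrite [y ^+ L.+1]exprS; set S := bigop.body _ _ _; lra.
Qed.

(** The error is linear in z while the leading term stays 1; the cap Z only affects the constant. *)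
Lemma bernoulli_le (z Z : R) k : 0 <= z <= Z -> (1 + z) ^+ k <= 1 + k%:R * (1 + Z) ^+ k * z.
Proof.
case/andP=> z0 zZ; have Z0 := le_trans z0 zZ.
elim: k => [|k IH]; first by rewrite !expr0 !mul0r addr0.
have h1 : (1 + z) ^+ k <= (1 + Z) ^+ k by rewrite lerXn2r ?nnegrE ?addr_ge0 // lerD2l.
have h2 : (1 + Z) ^+ k <= (1 + Z) ^+ k.+1 by rewrite exprS ler_peMl ?exprn_ge0 ?addr_ge0 // lerDl.
rewrite exprS mulrDl mul1r -natr1.
have h3 : z * (1 + z) ^+ k <= z * (1 + Z) ^+ k.+1 by rewrite ler_wpM2l // (le_trans h1).
have h4 : k%:R * (1 + Z) ^+ k * z <= k%:R * (1 + Z) ^+ k.+1 * z.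
  by rewrite ler_wpM2r // ler_wpM2l.
apply: le_trans (lerD IH h3) _; lra.
Qed.

(** Here representatives are taken in a box of side proportional to C X, which is possible for all
    norms up to (C X)^n at the price of a constant factor. *)
Lemma box_pow_count (C X k : nat) P : (0 < X)%N -> prime_ideal P ->
  (NP P ^ k <= (C * X) ^ n)%N ->
  #|[set t : T X | (box_pt R t != 0) && `[< prime_pow P k (box_pt R t) >]]%SET|%:R <=
    (1 + structure_const R K * C)%:R ^+ n * #|{: T X}|%:R * (NP P)%:R ^- k :> R.
Proof.
move=> X0 pP leQ; have P0 : (0 < NP P)%N := ltnW (ideal_norm_prime_gt1 R pP).
rewrite ler_pdivlMr ?exprn_gt0 ?ltr0n // mulrC -natrX -natrM -natrX -natrM ler_nat.
have nP := prime_pow_nz k pP.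
have lt : (ideal_norm (prime_pow P k) < (C * X).+1 ^ n)%N.
  by rewrite (prime_pow_norm R) //; apply: leq_ltn_trans leQ _; rewrite ltn_exp2r ?deg_gt0.
apply: (@leq_trans (ideal_norm (prime_pow P k) * box_count R X (prime_pow P k))).
  rewrite (prime_pow_norm R) // leq_mul2l; apply/orP; right.
  by apply: subset_leq_card; apply/fintype.subsetP => t; rewrite !inE => /andP[].
apply: leq_trans (box_count_le R X nP lt) _.
by rewrite card_box -expnMn leq_exp2r ?deg_gt0 //; nia.
Qed.

(** The small element has size [m], the integer n-th root of NP, so representatives enlarge the box
    by the ratio sc m / X only; [bernoulli_le] separates the main term 1/NP from the error. *)
Lemma box_prime_count (C X : nat) P : (0 < X)%N -> prime_ideal P ->
  (NP P <= (C * X) ^ n)%N ->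
  #|[set t : T X | (box_pt R t != 0) && `[< prime_pow P 1 (box_pt R t) >]]%SET|%:R <=
    #|{: T X}|%:R * ((NP P)%:R^-1 +
      n%:R * (1 + (structure_const R K * C)%:R) ^+ n * (structure_const R K)%:R / X%:R * iroot_weight n R (NP P)) :> R.
Proof.
move=> X0 pP leQ; set Z : R := (structure_const R K * C)%:R; have P0 : (0 < NP P)%N := ltnW (ideal_norm_prime_gt1 R pP).
have PR : 0 < (NP P)%:R :> R by rewrite ltr0n.
have XR : 0 < X%:R :> R by rewrite ltr0n.
set sc := structure_const R K in Z *; pose m := iroot n (NP P).
have mC : (m <= C * X)%N.
  rewrite -(leq_exp2r _ _ (deg_gt0 K)); apply: leq_trans leQ; apply: iroot_le; exact: deg_gt0.
have nP := prime_nz pP.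
have le1 : #|[set t : T X | (box_pt R t != 0) && `[< prime_pow P 1 (box_pt R t) >]]%SET|%:R * (NP P)%:R <=
    (1 + sc%:R * m%:R / X%:R) ^+ n * #|{: T X}|%:R :> R.
  apply: (@le_trans _ _ ((X + sc * m).*2.+1 ^ n)%N%:R).
    rewrite -natrM ler_nat mulnC.
    apply: leq_trans (box_count_le R X nP (iroot_gt (deg_gt0 K) _)).
    rewrite leq_mul2l; apply/orP; right; apply: subset_leq_card; apply/fintype.subsetP => t.
    by rewrite !inE prime_pow1 // => /andP[].
  rewrite card_box !natrX -exprMn lerXn2r ?nnegrE ?mulr_ge0 ?addr_ge0 ?divr_ge0 ?mulr_ge0 //.
  rewrite mulrDl mul1r -[_.*2.+1%:R]natr1 -[X.*2.+1%:R]natr1 -!muln2 !natrM natrD natrM.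
  have -> : sc%:R * m%:R / X%:R * (X%:R * 2 + 1) = sc%:R * m%:R * 2 + sc%:R * m%:R / X%:R :> R.
    by field; rewrite gt_eqF.
  have : 0 <= sc%:R * m%:R / X%:R :> R by rewrite divr_ge0 // mulr_ge0.
  lra.
have zZ : (0 : R) <= sc%:R * m%:R / X%:R <= Z.
  apply/andP; split; first by apply: divr_ge0 => //; apply: mulr_ge0.
  rewrite ler_pdivrMr // /Z natrM -mulrA ler_wpM2l //.
  by rewrite -natrM ler_nat.
have le2 := bernoulli_le n zZ.
have le3 := iroot_div_le (deg_gt0 K) R P0; rewrite -/m in le3.
rewrite -(ler_pM2r PR); apply: (le_trans le1); rewrite [leLHS]mulrC -[leRHS]mulrA ler_wpM2l //.
apply: (le_trans le2); rewrite mulrDl mulVf ?gt_eqF // lerD2l.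
rewrite -!mulrA ler_wpM2l // ler_wpM2l ?exprn_ge0 ?addr_ge0 //.
rewrite ler_wpM2l // mulrC ler_wpM2l ?invr_ge0 //.
by rewrite -ler_pdivrMr.
Qed.

End Mertens.

(** * Upper bound prime by prime, and Mertens' inequality *)

Section MertensBound.
Variables (R : realType) (K : fieldExtType rat).
Local Notation n := (deg K).
Local Notation O := (ringint K).
Local Notation T X := {ffun 'I_n -> 'I_(X.*2.+1)}.
Local Notation av i x := (nc (emb R i (val (x : O)))).
Local Notation NP P := (ideal_norm P).

Lemma ln_norm_ge0 P : prime_ideal P -> 0 <= ln ((NP (P : set O))%:R : R).
Proof. by move=> pP; rewrite ln_ge0 // ler1n ltnW // (ideal_norm_prime_gt1 R). Qed.

Lemma sum_ln_nrm_le (C : nat) :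
  (forall X (x : O) i, inbox R X x -> av i x <= (C * X)%N%:R) ->
  exists C2 : R, forall X, (0 < X)%N ->
   \sum_(t : T X | box_pt R t != 0) ln (nrm R (box_pt R t))%:R <=
   #|{: T X}|%:R * (\sum_(P <- primes_le K ((C * X) ^ n)) ln (NP P)%:R / (NP P)%:R + C2).
Proof.
move=> embC.
set sc := structure_const R K.
pose C3 : R := (1 + sc * C)%:R ^+ n.
pose C4 : R := n%:R * (1 + (sc * C)%:R) ^+ n * sc%:R.
(* The first part sums the errors of k = 1, where the weights up to (C X)^n add up to O(X); the
   second bounds all k >= 2 by a geometric tail and the sum of m^-2. *)
exists (C4 * (theta_const R K * (C%:R * (n * 2 ^ n.-1)%N%:R)) + 2 * C3 * (theta_const R K * 2)) => X X0.
have XR : 0 < X%:R :> R by rewrite ltr0n.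
set Q := ((C * X) ^ n)%N; set S := primes_le K Q.
have pS P : P \in S -> prime_ideal P /\ (NP P <= Q)%N by move/(mem_primes_le R).
have nQ (t : T X) : (nrm R (box_pt R t) <= Q)%N.
  rewrite -(ler_nat R) nrmE /Q natrX.
  have <- : \prod_(i < n) (C * X)%N%:R = (C * X)%N%:R ^+ n :> R by rewrite prodr_const card_ord.
  apply: ler_prod => i _; rewrite nc_ge0 embC //; exact: box_pt_inbox.
pose D P k : R := #|[set t : T X | (box_pt R t != 0) && `[< prime_pow P k (box_pt R t) >]]%SET|%:R.
have D1 P : P \in S -> D P 1%N <= #|{: T X}|%:R * ((NP P)%:R^-1 + C4 / X%:R * iroot_weight n R (NP P)).
  by move=> /pS [pP leQ]; apply: box_prime_count.
have Dk P k : P \in S -> D P k <= #|{: T X}|%:R * (C3 * (NP P)%:R ^- k).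
  move=> /pS [pP _]; rewrite mulrCA mulrA; have [leQ|gtQ] := leqP (NP P ^ k) Q.
    exact: box_pow_count.
  (* Norms on the box are at most Q, so no nonzero point lies in P^k once NP^k > Q. *)
  rewrite /D (_ : [set t | _]%SET = finset.set0) ?cards0.
    by rewrite !mulr_ge0 ?exprn_ge0 // invr_ge0 exprn_ge0.
  apply/setP => t; rewrite !inE; apply/negP => /andP[t0 /asboolP Pt].
  by have := leq_trans (prime_pow_mem_norm R pP t0 Pt) (nQ t); rewrite leqNgt gtQ.
apply: (@le_trans _ _ (\sum_(P <- S) ln (NP P)%:R * \sum_(1 <= k < Q.+1) D P k)).
  apply: (@le_trans _ _ (\sum_(t : T X | box_pt R t != 0) \sum_(P <- S) ln (NP P)%:R *
     \sum_(1 <= k < Q.+1) (`[< prime_pow P k (box_pt R t) >] : bool)%:R)).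
    by apply: ler_sum => t t0; apply: ln_nrm_le.
  rewrite exchange_big /=; apply: ler_sum => P _.
  rewrite -mulr_sumr exchange_big /=; rewrite le_eqVlt; apply/orP; left; apply/eqP; congr (_ * _).
  apply: eq_bigr => k _; rewrite /D -sum1_card natr_sum big_mkcond [RHS]big_mkcond.
  by apply: eq_bigr => t _; rewrite inE; case: (box_pt R t != 0) => //=; case: asboolP.
have Q1 : (1 <= Q.+1)%N by [].
apply: (@le_trans _ _ (\sum_(P <- S) ln (NP P)%:R * (#|{: T X}|%:R *
    ((NP P)%:R^-1 + C4 / X%:R * iroot_weight n R (NP P) + 2 * C3 * (NP P)%:R ^- 2)))).
  rewrite big_seq [leRHS]big_seq; apply: ler_sum => P PS; have [pP leQ] := pS P PS.
  rewrite ler_wpM2l ?ln_norm_ge0 //.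
  have Q0 : (1 < Q.+1)%N by rewrite ltnS; apply: leq_trans leQ; exact: ltnW (ideal_norm_prime_gt1 R pP).
  rewrite (big_ltn Q0) mulrDr; apply: lerD; first exact: D1.
  apply: (@le_trans _ _ (\sum_(2 <= k < Q.+1) #|{: T X}|%:R * (C3 * (NP P)%:R ^- k))).
    by apply: ler_sum => k _; exact: Dk.
  rewrite -!mulr_sumr ler_wpM2l // [2 * C3]mulrC -mulrA ler_wpM2l ?exprn_ge0 //.
  exact/geometric_tail/(ideal_norm_prime_gt1 R).
rewrite (eq_bigr (fun P => #|{: T X}|%:R * (ln (NP P)%:R / (NP P)%:R +
   C4 / X%:R * (ln (NP P)%:R * iroot_weight n R (NP P)) +
   2 * C3 * (ln (NP P)%:R * (NP P)%:R ^- 2)))) => [|P _]; last by ring.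
rewrite -mulr_sumr ler_wpM2l // !big_split /= -!mulr_sumr -addrA lerD2l.
have leS P : P \in S -> (NP P <= Q)%N by move/pS => [].
have prS : primes_seq S by exact: primes_le_primes.
apply: lerD.
  have C40 : 0 <= C4 by rewrite !mulr_ge0 ?exprn_ge0 ?addr_ge0.
  rewrite -mulrA ler_wpM2l // mulrC ler_pdivrMr //.
  apply: le_trans (sum_primes_weight_le (N := Q) (primes_le_uniq K Q) prS leS _ _) _.
  - by move=> m m0; apply: iroot_weight_le => //; exact: deg_gt0.
  - by move=> m; exact: iroot_weight_ge0.
  rewrite -[leRHS]mulrA ler_wpM2l ?theta_const_ge0 //.
  apply: (@le_trans _ _ (\sum_(1 <= m < (C * X).+1 ^ n) iroot_weight n R m)).
    have QS : (Q.+1 <= (C * X).+1 ^ n)%N by rewrite ltn_exp2r ?deg_gt0.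
    rewrite [leRHS](@big_cat_nat _ _ _ Q.+1) //= lerDl; apply: sumr_ge0 => m _.
    exact: iroot_weight_ge0.
  apply: le_trans (sum_iroot_weight (deg_gt0 K) R (C * X)) _.
  by rewrite natrM mulrAC.
rewrite ler_wpM2l ?mulr_ge0 ?exprn_ge0 //.
apply: le_trans (sum_primes_weight_le (N := Q) (w := fun m => m%:R ^- 2) (primes_le_uniq K Q) prS leS _ _) _.
- move=> m m0; rewrite lef_pV2 ?posrE ?exprn_gt0 ?ltr0n //.
  by rewrite lerXn2r ?nnegrE // ler_nat.
- by move=> m; rewrite invr_ge0 exprn_ge0.
by rewrite ler_wpM2l ?theta_const_ge0 // sum_inv_sqr_le.
Qed.

Lemma ler_sum_sub_seq (I : eqType) (s t : seq I) (F : I -> R) : uniq s -> uniq t ->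
  {subset s <= t} -> (forall i, i \in t -> 0 <= F i) -> \sum_(i <- s) F i <= \sum_(i <- t) F i.
Proof.
move=> us ut st F0; have ps : perm_eq s [seq i <- t | i \in s].
  apply: uniq_perm => // [|i]; first exact: filter_uniq.
  by rewrite mem_filter; case si: (i \in s) => //=; rewrite st.
rewrite (perm_big _ ps) big_filter big_mkcond big_seq [leRHS]big_seq; apply: ler_sum => i it.
by case: ifP => // _; apply: F0.
Qed.

(** The average of ln |N(x)| over a box is at least n ln (C X) - C1 and at most the prime sum up to
    (C X)^n plus C2; X is chosen with (C X)^n <= Q < (2 C X)^n. *)
Theorem mertens : exists C : R, forall Q : nat, (0 < Q)%N ->
  ln Q%:R - C <= \sum_(P <- primes_le K Q) ln (NP P)%:R / (NP P)%:R.
Proof.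
have [C [C0 embC]] := emb_inbox_le R K.
have [C1 low] := sum_ln_nrm_ge C0 embC; have [C2 up] := sum_ln_nrm_le embC.
have CR : 0 < C%:R :> R by rewrite ltr0n.
have n0 := deg_gt0 K.
have pos Q' P : P \in primes_le K Q' -> 0 <= ln (NP P)%:R / (NP P)%:R :> R.
  by move=> /(mem_primes_le R) [pP _]; rewrite divr_ge0 ?ln_norm_ge0.
(* The second entry covers the Q whose integer n-th root is below C, where the left side is not
   positive. *)
exists (Num.max (n%:R * ln 2 + C1 + C2) (n%:R * ln C%:R)) => Q Q0.
have r0 := iroot_gt0 n0 Q0; set r := iroot n Q in r0.
have lnQ : ln Q%:R <= n%:R * ln r.+1%:R :> R.
  rewrite mulr_natl -lnXn ?ltr0n // -natrX; apply: ler_ln_nat => //.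
  by apply: ltnW; exact: iroot_gt.
have [rC|Cr] := ltnP r C.
  apply: (@le_trans _ _ 0); last by rewrite big_seq; apply: sumr_ge0 => P /pos.
  rewrite subr_le0 le_max; apply/orP; right; apply: (le_trans lnQ).
  by rewrite ler_wpM2l // ler_ln_nat.
pose X := (r %/ C)%N; have X0 : (0 < X)%N by rewrite divn_gt0.
have CX : (C * X <= r)%N by rewrite mulnC leq_divM.
have rCX : (r.+1 <= 2 * (C * X))%N.
  have : (r < X.+1 * C)%N by rewrite -ltn_divLR.
  have : (C <= C * X)%N by rewrite leq_pmulr.
  lia.
have T0 : 0 < #|{: T X}|%:R :> R by rewrite ltr0n card_box expn_gt0.
have := le_trans (low X X0) (up X X0); rewrite [leRHS]mulrC ler_pM2r // => main.
have CX0 : (0 < C * X)%N by rewrite muln_gt0 C0.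
have lnr : ln r.+1%:R <= ln 2 + ln (C * X)%N%:R :> R.
  have <- : ln (2 * (C * X))%N%:R = ln 2 + ln (C * X)%N%:R :> R.
    by rewrite natrM lnM ?posrE ?ltr0n.
  by apply: ler_ln_nat.
have mono : \sum_(P <- primes_le K ((C * X) ^ n)) ln (NP P)%:R / (NP P)%:R <=
    \sum_(P <- primes_le K Q) ln (NP P)%:R / (NP P)%:R :> R.
  apply: ler_sum_sub_seq; rewrite ?primes_le_uniq //; last exact: pos.
  move=> P /(mem_primes_le R) [pP le]; apply/(mem_primes_le R); split=> //.
  apply: (leq_trans le); apply: leq_trans (iroot_le n0 Q).
  by rewrite leq_exp2r.
apply: le_trans mono; move: main lnQ.
have := ler_wpM2l (ler0n R n) lnr; rewrite mulrDr.
have : n%:R * ln 2 + C1 + C2 <= Num.max (n%:R * ln 2 + C1 + C2) (n%:R * ln C%:R) :> R.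
  by rewrite le_max lexx.
lra.
Qed.

End MertensBound.

(** * The larger sieve *)

Section LargerSieve.
Variables (R : realType) (K : fieldExtType rat).
Local Notation O := (ringint K).
Local Notation NP P := (ideal_norm P).

Lemma sum_sqr_ge (I : finType) (D : {set I}) (F : I -> R) :
  (\sum_(i in D) F i) ^+ 2 <= #|D|%:R * \sum_(i in D) F i ^+ 2.
Proof.
have [D0|D0] := posnP #|D|.
  by rewrite (cards0_eq D0) !big_set0 expr0n mulr0.
have k0 : 0 < #|D|%:R :> R by rewrite ltr0n.
set Z := \sum_(i in D) F i; set k : R := #|D|%:R in k0 *.
have : 0 <= \sum_(i in D) (F i - Z / k) ^+ 2 by apply: sumr_ge0 => i _; exact: sqr_ge0.
under eq_bigr do rewrite sqrrB; rewrite big_split sumrB /= sumr_const sumrMnl -mulr_suml -/Z.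
set S := \sum_(i in D) F i ^+ 2; rewrite -[_ *+ #|D|]mulr_natr -/k => h.
have : 0 <= k * (S - Z * (Z / k) *+ 2 + (Z / k) ^+ 2 * k) by rewrite mulr_ge0 // ltW.
have -> : k * (S - Z * (Z / k) *+ 2 + (Z / k) ^+ 2 * k) = k * S - Z ^+ 2.
  by field; rewrite gt_eqF.
by rewrite subr_ge0.
Qed.

(** Cauchy-Schwarz over the occupied classes: the number of pairs congruent modulo P is the sum of
    the squares of the class sizes. *)
Lemma congruent_pairs_ge (A : seq O) P : prime_ideal P -> uniq A ->
  (size A)%:R ^+ 2 <= (card_mod P [set a | a \in A])%:R *
    \sum_(a <- A) \sum_(b <- A) (`[< P (a - b) >] : bool)%:R :> R.
Proof.
move=> pP uA; have [f [g [gK fI]]] := norm_index R (prime_nz pP).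
rewrite (card_modE _ (prime_is_ideal pP) gK fI); set D := [set i | _]%SET.
pose F i : R := (count (fun a => f a == i) A)%:R.
have fD a : a \in A -> f a \in D.
  by move=> aA; rewrite inE; apply/asboolP; exists a.
have cE (G : 'I_(NP P) -> R) : \sum_(a <- A) G (f a) = \sum_(i in D) F i * G i.
  rewrite big_seq (partition_big f (fun i => i \in D)) /=; last exact: fD.
  apply: eq_bigr => i _; rewrite (eq_bigr (fun=> G i)) => [|a /andP[_ /eqP <-]//].
  rewrite -big_seq_cond big_const_seq iter_addr_0 /F mulr_natl; congr (_ *+ _).
have -> : (size A)%:R = \sum_(i in D) F i :> R.
  have := cE (fun=> 1); under [RHS]eq_bigr do rewrite mulr1; move=> <-.
  by rewrite big_const_seq count_predT iter_addr_0.
apply: le_trans (sum_sqr_ge D F) _; rewrite ler_wpM2l //.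
under [leLHS]eq_bigr do rewrite expr2; rewrite -(cE F) le_eqVlt; apply/orP; left; apply/eqP.
apply: eq_bigr => a _; rewrite /F -sum1_count natr_sum big_mkcond /=.
apply: eq_bigr => b _; case: asboolP => [/fI|nP]; first by move=> ->; rewrite eqxx.
by case: eqP => // e; case: nP; apply/fI.
Qed.

Lemma sum_primes_containing_le (s : seq (set O)) (x : O) : primes_seq s -> uniq s -> x != 0 ->
  \sum_(P <- s) ln (NP P)%:R * (`[< P x >] : bool)%:R <= ln (nrm R x)%:R :> R.
Proof.
move=> ps us x0; rewrite (eq_bigr (fun P => if `[< P x >] then ln (NP P)%:R else 0)); last first.
  by move=> P _; case: asboolP => _; rewrite ?mulr1 ?mulr0.
rewrite -big_mkcond -big_filter /=.
have pf P : P \in [seq P <- s | `[< P x >]] -> prime_ideal P.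
  by rewrite mem_filter => /andP[_ /ps].
rewrite sum_ln => [|P /pf pP]; last exact: ltnW (ideal_norm_prime_gt1 R pP).
apply: ler_ln_nat.
  by rewrite big_seq; apply: prodn_cond_gt0 => P /pf pP; exact: ltnW (ideal_norm_prime_gt1 R pP).
apply: prod_primes_norm_le; rewrite ?filter_uniq // => P.
by rewrite mem_filter => /andP[/asboolP].
Qed.

Theorem larger_sieve (c alpha : R) : 0 < alpha -> exists2 C : R, 0 < C &
  forall (A : seq O) (M : R), uniq A -> 1 <= M ->
   (forall a b, a \in A -> b \in A -> a != b -> (nrm R (a - b))%:R <= M) ->
   (forall P, prime_ideal P -> c < (NP P)%:R ->
      (card_mod P [set a | a \in A])%:R <= alpha * (NP P)%:R) ->
   (size A)%:R <= C * M `^ alpha.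
Proof.
move=> alpha0; have [C0 mert] := mertens R K.
pose S0 := primes_le K (Num.truncn c).
(* Removing the primes of norm at most c from the Mertens sum costs a constant. *)
pose C5 : R := C0 + \sum_(P <- S0) ln (NP P)%:R / (NP P)%:R.
pose th := theta_const R K; have th0 : 0 <= th := theta_const_ge0 R K.
exists (th * (expR (C5 + alpha) + 1) + 1).
  by rewrite ltr_wpDl // mulr_ge0 // addr_ge0 // expR_ge0.
move=> A M uA M1 hM hP; have M0 : 0 < M := lt_le_trans ltr01 M1.
have lnM0 : 0 <= ln M by rewrite ln_ge0.
(* Chosen so that (ln Q - C5) / alpha >= ln M + 1: the coefficient of |A|^2 on the left of the
   comparison exceeds the one on the right, ln M, by at least 1, which leaves |A| <= th Q with Q =
   O(M^alpha). *)
pose y : R := expR (C5 + alpha * (ln M + 1)).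
pose Q := (Num.truncn y).+1.
have yQ : y < Q%:R by rewrite truncnS_gt.
have Qy : Q%:R <= y + 1 by rewrite /Q -natr1 lerD2r truncn_le expR_ge0.
have lnQ : C5 + alpha * (ln M + 1) <= ln Q%:R.
  by rewrite -[leLHS]expRK -/y ler_ln ?posrE ?expR_gt0 ?ltr0n // ltW.
have yM : y = expR (C5 + alpha) * M `^ alpha.
  rewrite /y /powR gt_eqF // -expRD; congr expR; ring.
have M1a : 1 <= M `^ alpha by rewrite -(powRr0 M) ler_powR // ltW.
have Qle : Q%:R <= (expR (C5 + alpha) + 1) * M `^ alpha.
  by apply: (le_trans Qy); rewrite yM mulrDl mul1r lerD2l.
set Z := size A; have [Z0|Zpos] := posnP Z.
  by rewrite Z0 mulr_ge0 ?powR_ge0 // addr_ge0 // mulr_ge0 // addr_ge0 // expR_ge0.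
pose S' := [seq P <- primes_le K Q | c < (NP P)%:R].
have pS' P : P \in S' -> [/\ prime_ideal P, (NP P <= Q)%N & c < (NP P)%:R].
  by rewrite mem_filter => /andP[? /(mem_primes_le R) []].
have uS' : uniq S' by rewrite filter_uniq ?primes_le_uniq.
have prS' : primes_seq S' by move=> P /pS' [].
have leS' P : P \in S' -> (NP P <= Q)%N by move=> /pS' [].
have low : ln Q%:R - C5 <= \sum_(P <- S') ln (NP P)%:R / (NP P)%:R.
  have := mert Q isT; rewrite (bigID (fun P => c < (NP P)%:R)) /= -big_filter -/S' => h.
  have le0 : \sum_(P <- primes_le K Q | ~~ (c < (NP P)%:R)) ln (NP P)%:R / (NP P)%:R <=
      \sum_(P <- S0) ln (NP P)%:R / (NP P)%:R :> R.
    rewrite -big_filter; apply: ler_sum_sub_seq.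
    - by rewrite filter_uniq ?primes_le_uniq.
    - exact: primes_le_uniq.
    - move=> P; rewrite mem_filter -leNgt => /andP[le /(mem_primes_le R) [pP _]].
      apply/(mem_primes_le R); split=> //; rewrite truncn_ge_nat //.
      by apply: le_trans le.
    - by move=> P /(mem_primes_le R) [pP _]; rewrite divr_ge0 ?ln_norm_ge0.
  by move: h le0; rewrite /C5; lra.
pose E P : R := \sum_(a <- A) \sum_(b <- A) (`[< P (a - b) >] : bool)%:R.
have Elow P : P \in S' -> Z%:R ^+ 2 * (alpha * (NP P)%:R)^-1 <= E P.
  move=> /pS' [pP _ cP]; have NP0 : 0 < (NP P)%:R :> R by rewrite ltr0n ltnW ?(ideal_norm_prime_gt1 R).
  rewrite ler_pdivrMr ?mulr_gt0 // mulrC.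
  apply: le_trans (congruent_pairs_ge pP uA) _; rewrite ler_wpM2r ?hP //.
  by apply: sumr_ge0 => a _; apply: sumr_ge0.
(* A diagonal pair contributes at most the Chebyshev bound th Q, any other pair at most ln |N(a -
   b)| <= ln M. *)
have Eup : \sum_(P <- S') ln (NP P)%:R * E P <= Z%:R * (th * Q%:R) + Z%:R ^+ 2 * ln M.
  have -> : \sum_(P <- S') ln (NP P)%:R * E P = \sum_(a <- A) \sum_(b <- A)
      \sum_(P <- S') ln (NP P)%:R * (`[< P (a - b) >] : bool)%:R.
    under eq_bigr do rewrite mulr_sumr.
    rewrite exchange_big /=; apply: eq_bigr => a _.
    under eq_bigr do rewrite mulr_sumr.
    by rewrite exchange_big.
  apply: (@le_trans _ _ (\sum_(a <- A) (th * Q%:R + Z%:R * ln M))).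
    rewrite big_seq [leRHS]big_seq; apply: ler_sum => a aA.
    rewrite (bigD1_seq a) //= lerD //.
      apply: le_trans (theta_bound R uS' prS' leS').
      rewrite big_seq [leRHS]big_seq; apply: ler_sum => P /pS' [pP _ _].
      by rewrite ler_piMr ?ln_norm_ge0 //; case: asboolP.
    apply: (@le_trans _ _ (\sum_(b <- A) ln M)); last first.
      by rewrite big_const_seq count_predT iter_addr_0 mulr_natl.
    rewrite big_mkcond big_seq [leRHS]big_seq; apply: ler_sum => b bA.
    case: eqVneq => //= ba; have ab0 : a - b != 0 by rewrite subr_eq0 eq_sym.
    apply: le_trans (sum_primes_containing_le prS' uS' ab0) _.
    rewrite ler_ln ?posrE ?ltr0n ?nrm_gt0 //; apply: hM => //.
    by rewrite eq_sym.
  rewrite big_const_seq count_predT iter_addr_0 -[leLHS]mulr_natl -/Z.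
  by rewrite le_eqVlt; apply/orP; left; apply/eqP; ring.
have ZR : 0 < Z%:R :> R by rewrite ltr0n.
have main : Z%:R ^+ 2 * (alpha^-1 * (ln Q%:R - C5)) <= Z%:R * (th * Q%:R) + Z%:R ^+ 2 * ln M.
  apply: le_trans Eup.
  apply: (@le_trans _ _ (\sum_(P <- S') ln (NP P)%:R * (Z%:R ^+ 2 * (alpha * (NP P)%:R)^-1))).
    rewrite (eq_bigr (fun P => (Z%:R ^+ 2 * alpha^-1) * (ln (NP P)%:R / (NP P)%:R))) => [|P _].
      rewrite -mulr_sumr mulrA ler_wpM2l // mulr_ge0 ?sqr_ge0 // invr_ge0 ltW //.
    by rewrite invfM; ring.
  rewrite big_seq [leRHS]big_seq; apply: ler_sum => P PS.
  by rewrite ler_wpM2l ?Elow //; case: (pS' P PS) => pP _ _; exact: ln_norm_ge0.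
have le1 : ln M + 1 <= alpha^-1 * (ln Q%:R - C5).
  by rewrite mulrC ler_pdivlMr // mulrC lerBrDl.
have : Z%:R ^+ 2 * (ln M + 1) <= Z%:R * (th * Q%:R) + Z%:R ^+ 2 * ln M.
  by apply: le_trans main; rewrite ler_wpM2l ?sqr_ge0.
rewrite mulrDr mulr1 addrC lerD2r expr2 ler_pM2l // => ZQ.
apply: (le_trans ZQ); rewrite mulrDl mul1r -mulrA.
apply: (le_trans (ler_wpM2l th0 Qle)); rewrite lerDl; exact: powR_ge0.
Qed.

End LargerSieve.

(** * Local degrees and the height *)

Section LocalDegrees.
Variable R : realType.

(** The limit is the supremum of the eventual lower bounds. *)
Lemma real_cauchy (u : nat -> R) :
  (forall e : R, 0 < e -> exists N, forall m k, (N <= m)%N -> (N <= k)%N -> `|u m - u k| < e) ->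
  exists l, forall e : R, 0 < e -> exists N, forall k, (N <= k)%N -> `|u k - l| < e.
Proof.
move=> cu; pose S := [set x : R | exists N, forall k, (N <= k)%N -> x <= u k].
have S_low e : 0 < e -> exists N, S (u N - e) /\ (forall x, S x -> x <= u N + e) /\
    forall k, (N <= k)%N -> `|u k - u N| < e.
  move=> e0; have [N hN] := cu e e0; exists N; split.
    by exists N => k Nk; have := hN _ _ Nk (leqnn N); rewrite ltr_norml; lra.
  split; last by move=> k Nk; apply: hN.
  move=> x [M hM]; have := hN (maxn M N) N (leq_maxr _ _) (leqnn _).
  by have := hM (maxn M N) (leq_maxl _ _); rewrite ltr_norml; lra.
have hS : has_sup S.
  have [N [SN [ubN _]]] := S_low 1 ltr01; split; first by exists (u N - 1).
  by exists (u N + 1) => x /ubN.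
exists (sup S) => e e0; have e20 : 0 < e / 2 by rewrite divr_gt0.
have [N [SN [ubN hN]]] := S_low _ e20; exists N => k Nk.
have h1 := sup_upper_bound hS SN.
have h2 : sup S <= u N + e / 2 by apply: ge_sup => //; case: hS.
by have := hN k Nk; rewrite !ltr_norml; lra.
Qed.

Lemma rat_approx (x e : R) : 0 < e -> exists q : rat, `|x - ratr q| < e.
Proof.
move=> e0; have [|q] := @rat_in_itvoo R (x - e) (x + e); first lra.
by rewrite in_itv /= => h; exists q; rewrite ltr_norml; lra.
Qed.

Lemma nc_le_ReIm (z : R[i]) : nc z <= `|complex.Re z| + `|complex.Im z|.
Proof.
case: z => a b /=; rewrite -[leRHS]ger0_norm ?addr_ge0 // -sqrtr_sqr ler_wsqrtr //.
rewrite sqrrD !real_normK ?num_real // lerD2r lerDl mulrn_wge0 // mulr_ge0 //.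
Qed.

Lemma nc_absolute_value : absolute_value (fun z : R[i] => nc z).
Proof.
split.
- exact: nc_ge0.
- by move=> x; split=> [/eqP|->]; [rewrite nc_eq0 => /eqP | exact: nc0].
- exact: Normc.normcM.
- exact: ncD.
Qed.

Lemma nc_complete : abs_complete (fun z : R[i] => nc z).
Proof.
move=> u cu.
have [|a ha] := @real_cauchy (fun k => complex.Re (u k)).
  move=> e e0; have [N hN] := cu e e0; exists N => m k Nm Nk.
  have := hN m k Nm Nk; apply: le_lt_trans; have := ge_Re_nc (u m - u k).
  by rewrite raddfB.
have [|b hb] := @real_cauchy (fun k => complex.Im (u k)).
  move=> e e0; have [N hN] := cu e e0; exists N => m k Nm Nk.
  have := hN m k Nm Nk; apply: le_lt_trans; have := ge_Im_nc (u m - u k).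
  by rewrite raddfB.
exists (a +i* b) => e e0; have e20 : 0 < e / 2 by rewrite divr_gt0.
have [N1 h1] := ha _ e20; have [N2 h2] := hb _ e20.
exists (maxn N1 N2) => k; rewrite geq_max => /andP[k1 k2].
apply: le_lt_trans (nc_le_ReIm _) _; rewrite !raddfB /=.
by have := h1 k k1; have := h2 k k2; lra.
Qed.

Lemma closure_rat_complex (z : R[i]) :
  abs_closure (fun z => nc z) (range (ratr : rat -> R[i])) z <-> complex.Im z = 0.
Proof.
split=> [h|z0 e e0].
  apply/eqP; rewrite -normr_le0; apply/ler_addgt0Pl => e e0; rewrite addr0.
  have [_ [q _ <-] lt] := h e e0; apply: le_trans (ltW lt).
  have -> : complex.Im z = complex.Im (z - ratr q) by rewrite ratrC raddfB /= subr0.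
  exact: ge_Im_nc.
have [q hq] := rat_approx (complex.Re z) e0; exists (ratr q); first by exists q.
apply: le_lt_trans (nc_le_ReIm _) _; rewrite ratrC !raddfB /= z0 subr0 normr0 addr0 //.
Qed.

Variable K : fieldExtType rat.
Implicit Type s : {rmorphism K -> R[i]}.

Lemma emb_ratr s q : s (ratr q) = (ratr q : R)%:C.
Proof. by rewrite -ratrC; exact: (fmorph_rat s q). Qed.

Definition real_emb s := forall x, complex.Im (s x) = 0.

Definition re_emb s (x : K) : R := complex.Re (s x).

(** The image of K is dense in C: an x0 with non-real image lets the imaginary part be approximated
    by a rational multiple of x0, and a rational then corrects the real part. *)
Lemma complex_completion_degree s : ~ real_emb s ->
  is_completion (arch_abs s) (fun z : R[i] => nc z) s /\
  has_degree (abs_closure (fun z => nc z) (range (ratr : rat -> R[i]))) 2%N.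
Proof.
move=> /existsNP [x0 /eqP sx0]; split.
  split; [exact: nc_absolute_value|exact: nc_complete|by []|].
  apply/seteqP; split=> // z _ e e0.
  pose M := `|complex.Re (s x0)| + `|complex.Im (s x0)| + 1.
  have M0 : 0 < M by rewrite ltr_wpDl ?addr_ge0.
  have d0 : 0 < e / (2 * M) by rewrite divr_gt0 // mulr_gt0.
  have [q2 h2] := rat_approx (complex.Im z / complex.Im (s x0)) d0.
  have e20 : 0 < e / 2 by rewrite divr_gt0.
  have [q1 h1] := rat_approx (complex.Re z - ratr q2 * complex.Re (s x0)) e20.
  exists (s (ratr q1 + ratr q2 * x0)); first by eexists.
  have -> : s (ratr q1 + ratr q2 * x0) = (ratr q1)%:C + (ratr q2)%:C * s x0.
    by rewrite (rmorphD s) [s (_ * x0)](rmorphM s) !emb_ratr.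
  apply: le_lt_trans (nc_le_ReIm _) _.
  have -> : complex.Re (z - ((ratr q1)%:C + (ratr q2)%:C * s x0)) =
      complex.Re z - ratr q2 * complex.Re (s x0) - ratr q1.
    by case: (z) => a b; case: (s x0) => c d /=; ring.
  have -> : complex.Im (z - ((ratr q1)%:C + (ratr q2)%:C * s x0)) =
      (complex.Im z / complex.Im (s x0) - ratr q2) * complex.Im (s x0).
    move: sx0; case: (z) => a b; case: (s x0) => c d /= d0'; field.
    exact: d0'.
  rewrite normrM.
  have h3 : `|complex.Im z / complex.Im (s x0) - ratr q2| * `|complex.Im (s x0)| <=
      e / (2 * M) * M.
    by apply: ler_pM => //; [exact: ltW | have := normr_ge0 (complex.Re (s x0)); rewrite /M; lra].
  have h4 : e / (2 * M) * M = e / 2 by field; rewrite gt_eqF.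
  by move: h1 h3; rewrite h4; lra.
exists (fun i : 'I_2 => if i == 0 then 1 else 'i%C) => x.
have Fr (r : R) : abs_closure (fun z => nc z) (range (ratr : rat -> R[i])) r%:C.
  exact/closure_rat_complex.
pose c0 : {ffun 'I_2 -> R[i]} := [ffun i : 'I_2 => if i == 0 then (complex.Re x)%:C else (complex.Im x)%:C].
exists c0; split.
  split; first by move=> i; rewrite ffunE; case: ifP => _; exact: Fr.
  rewrite big_ord_recl big_ord1 !ffunE /= mulr1 {1}[x]complexE; congr (_ + _).
  by rewrite mulrC.
move=> c [cF xE]; apply/ffunP => i; rewrite ffunE.
have cr j : c j = (complex.Re (c j))%:C.
  by have /closure_rat_complex := cF j; case: (c j) => a b /= ->.
move: xE; rewrite big_ord_recl big_ord1 /= mulr1 cr (cr (lift ord0 ord0)) => ->.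
have e1 u v : complex.Re (u%:C * 1 + v%:C * 'i%C) = u :> R by rewrite /=; ring.
have e2 u v : complex.Im (u%:C * 1 + v%:C * 'i%C) = v :> R by rewrite /=; ring.
rewrite -[(complex.Re (c ord0))%:C]mulr1 e1 e2.
case: (unliftP ord0 i) => [j ->|->]; first by rewrite (ord1 j) /= -cr.
by rewrite eqxx -cr.
Qed.

Lemma real_completion_degree s : real_emb s ->
  exists iota : {rmorphism K -> R},
  is_completion (arch_abs s) (fun z : R => `|z|) iota /\
  has_degree (abs_closure (fun z : R => `|z|) (range (ratr : rat -> R))) 1%N.
Proof.
move=> rs.
have sE x : s x = (re_emb s x)%:C.
  by have := rs x; rewrite /re_emb; case: (s x) => a b /= ->.
have fB : zmod_morphism (re_emb s) by move=> x y; rewrite /re_emb !raddfB.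
have fM : monoid_morphism (re_emb s).
  split; first by rewrite /re_emb rmorph1.
  by move=> x y; apply: (@complexI R); rewrite -sE rmorphM /= !sE rmorphM.
pose faM := GRing.isZmodMorphism.Build _ _ _ fB.
pose fmM := GRing.isMonoidMorphism.Build _ _ _ fM.
pose iota : {rmorphism K -> R} := HB.pack (re_emb s) faM fmM.
have clT : abs_closure (fun z : R => `|z|) (range (ratr : rat -> R)) = setT.
  apply/seteqP; split=> // x _ e e0; have [q hq] := rat_approx x e0.
  by exists (ratr q) => //; exists q.
exists iota; split.
  split.
  - split=> //; [by move=> x; split=> [/normr0_eq0|->]; rewrite ?normr0|exact: normrM|exact: ler_normD].
  - exact: real_cauchy.
  - by move=> x; rewrite /arch_abs sE nc_real.
  - apply/seteqP; split=> // x _ e e0; have [q hq] := rat_approx x e0.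
    by exists (ratr q) => //; exists (ratr q) => //; rewrite fmorph_rat.
exists (fun=> 1) => x; exists [ffun=> x]; split.
  by rewrite clT big_ord1 ffunE mulr1.
by move=> c [_ ->]; apply/ffunP => i; rewrite big_ord1 mulr1 ffunE (ord1 i).
Qed.

(** [local_degree] is read off an arbitrary completion, so the bound is shown for each of them. In
    degree 1 every [iota x] would be a limit of rationals, and [s x] would be real. *)
Lemma completion_degree s (L : fieldType) (w : L -> R) (iota : {rmorphism K -> L}) m :
  is_completion (arch_abs s) w iota ->
  has_degree (abs_closure w (range (ratr : rat -> L))) m ->
  (0 < m)%N /\ (~ real_emb s -> (1 < m)%N).
Proof.
move=> [[w0 weq wM wD] _ wi _]; set F := abs_closure _ _ => -[b hb].
have m0 : (0 < m)%N.
  case: m b hb => // b hb; have [c [[_ e] _]] := hb 1.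
  by move/eqP: e; rewrite big_ord0 oner_eq0.
split=> // nreal; rewrite ltnNge; apply/negP => m1; apply: nreal => x.
have {m0}m1 : m = 1%N by apply/eqP; rewrite eqn_leq m1 m0.
subst m; have [c1 [[F1 e1] _]] := hb 1; have [cx [[Fx ex] _]] := hb (iota x).
move: e1 ex (F1 ord0) (Fx ord0); rewrite !big_ord1; move: (c1 ord0) (cx ord0) (b ord0).
move=> {c1 cx F1 Fx hb} c0 c b0 e1 ex Fc0 Fc.
have wn1 : w (-1) = 1.
  have : w (-1) ^+ 2 = 1.
    have w1 : w 1 = 1.
      have : w 1 != 0 by apply/eqP => /weq /eqP; rewrite oner_eq0.
      by move=> h; apply: (mulIf h); rewrite -wM !mul1r.
    by rewrite expr2 -wM mulrNN mulr1.
  by move/eqP; rewrite sqrf_eq1 => /orP[/eqP //|/eqP h]; have := w0 (-1); rewrite h; lra.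
have wN y : w (- y) = w y by rewrite -mulN1r wM wn1 mul1r.
have wc0 : 0 < w c0.
  rewrite lt_def w0 andbT; apply/eqP => /weq c00.
  by move/eqP: e1; rewrite c00 mul0r oner_eq0.
have xc0 : iota x * c0 = c by rewrite ex -mulrA [b0 * c0]mulrC -e1 mulr1.
apply/eqP; rewrite -normr_le0; apply/ler_addgt0Pl => e e0; rewrite addr0.
set B := w (iota x) + 1; have B0 : 0 < B by rewrite ltr_wpDl.
(* [iota x] is the quotient c / c0 of two limits of rationals. The first bound keeps q0 away from 0,
   the second makes q1 / q0 approximate the quotient within e. *)
pose d := Num.min (w c0 / 2) (e * w c0 / (2 * B)).
have d0 : 0 < d by rewrite lt_min !divr_gt0 ?mulr_gt0.
have [_ [q0 _ <-] h0] := Fc0 d d0; have [_ [q1 _ <-] h1] := Fc d d0.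
have wq0 : w c0 / 2 <= w (ratr q0).
  have : w c0 <= w (c0 - ratr q0) + w (ratr q0) by rewrite -{1}(subrK (ratr q0) c0) wD.
  have : d <= w c0 / 2 by rewrite ge_min lexx.
  by move: h0; lra.
have q00 : ratr q0 != 0 :> L.
  by apply/eqP => z; move: wq0; rewrite z (proj2 (weq 0) erefl); lra.
have le1 : w (iota x * ratr q0 - ratr q1) <= B * d.
  have -> : iota x * ratr q0 - ratr q1 = (iota x * - (c0 - ratr q0)) + (c - ratr q1).
    by rewrite -xc0; ring.
  apply: le_trans (wD _ _) _; rewrite wM wN mulrDl mul1r lerD //; last exact: ltW.
  by rewrite ler_wpM2l // ltW.
have le2 : w (iota x - ratr (q1 / q0)) * (w c0 / 2) <= e * (w c0 / 2).
  apply: (@le_trans _ _ (w (iota x - ratr (q1 / q0)) * w (ratr q0))).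
    by rewrite ler_wpM2l.
  rewrite -wM mulrBl.
  have -> : ratr (q1 / q0) * ratr q0 = ratr q1 :> L.
    have eL q : ratr q = (iota \o in_alg K) q :> L by rewrite (fmorph_eq_rat (iota \o in_alg K)).
    rewrite !eL -rmorphM divfK //.
    by apply: contra_neq q00 => ->; rewrite eL rmorph0.
  apply: (le_trans le1); apply: (@le_trans _ _ (B * (e * w c0 / (2 * B)))).
    by rewrite ler_wpM2l ?(ltW B0) // /d ge_min lexx orbT.
  by rewrite le_eqVlt; apply/orP; left; apply/eqP; field; rewrite gt_eqF.
move: le2; rewrite ler_pM2r ?divr_gt0 //; apply: le_trans.
rewrite -(fmorph_rat iota) -rmorphB wi /arch_abs rmorphB emb_ratr.
apply: le_trans (ge_Im_nc _); by rewrite raddfB /= subr0.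
Qed.

Lemma local_degree_ge s : (0 < local_degree (arch_abs s : K -> R))%N /\
  (~ real_emb s -> (1 < local_degree (arch_abs s : K -> R))%N).
Proof.
have hdeg m : (exists (L : fieldType) (w : L -> R) (iota : {rmorphism K -> L}),
    is_completion (arch_abs s) w iota /\
    has_degree (abs_closure w (range (ratr : rat -> L))) m) ->
    (0 < m)%N /\ (~ real_emb s -> (1 < m)%N).
  by move=> [L [w [iota [h1 h2]]]]; exact: completion_degree h1 h2.
have ex : exists m, exists (L : fieldType) (w : L -> R) (iota : {rmorphism K -> L}),
    is_completion (arch_abs s) w iota /\
    has_degree (abs_closure w (range (ratr : rat -> L))) m.
  have [rs|nrs] := pselect (real_emb s).
    have [iota h] := real_completion_degree rs.
    by exists 1%N, R, (fun z => `|z|), iota.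
  by exists 2%N, R[i], (fun z => nc z), s; exact: complex_completion_degree.
rewrite /local_degree; case: xgetP => [m _ /hdeg //|no].
by case: ex => m /(no m).
Qed.

End LocalDegrees.

(** * Archimedean places and the lower bound for the height *)

Section PlaceRepresentatives.
Variables (R : realType) (K : fieldExtType rat).
Local Notation n := (deg K).
Local Notation O := (ringint K).
Local Notation e := (@emb R K).
Local Notation pl i := (arch_abs (e i)).

(** Conjugate embeddings give the same place, and [rho] selects one embedding for each place. The
    default is never reached, as i itself qualifies. *)
Definition rho (i : 'I_n) : 'I_n := odflt i [pick j | `[< pl j = pl i >]].

Lemma rho_place i : pl (rho i) = pl i.
Proof. by rewrite /rho; case: pickP => [j /asboolP|]. Qed.

Lemma rho_eq i j : pl i = pl j -> rho i = rho j.
Proof.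
move=> ij; rewrite /rho ij; case: pickP => [k|/(_ j)] //.
by rewrite asboolT.
Qed.

Lemma rhoK i : rho (rho i) = rho i.
Proof. exact/rho_eq/rho_place. Qed.

Lemma rho_abs i x : nc (e (rho i) x) = nc (e i x).
Proof. exact: (congr1 (fun v => v x) (rho_place i)). Qed.

Definition place_reps : {set 'I_n} := [set i | rho i == i]%SET.

Lemma rho_reps i : rho i \in place_reps.
Proof. by rewrite inE rhoK. Qed.

Lemma nc_sqr (z : R[i]) : nc z ^+ 2 = complex.Re z ^+ 2 + complex.Im z ^+ 2.
Proof. by case: z => a b /=; rewrite sqr_sqrtr // addr_ge0 ?sqr_ge0. Qed.

(* [|w| = |z|] and [|w + 1| = |z + 1|] determine [Re w], hence [w] up to conjugation. *)
Lemma same_place_conj (z w : R[i]) : nc z = nc w -> nc (z + 1) = nc (w + 1) ->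
  w = z \/ w = (z^*)%C.
Proof.
move=> h1 h2; have := congr1 (fun t => t ^+ 2) h1; have := congr1 (fun t => t ^+ 2) h2.
rewrite /= !nc_sqr; case: z w {h1 h2} => a b [c d] /=; rewrite !addr0 !sqrrD !expr1n !mulr1 => h2 h1.
have ac : a = c by move: h1 h2; rewrite !mulr2n; lra.
move: h1; rewrite ac => /addrI /eqP; rewrite eqf_sqr => /orP[/eqP ->|/eqP ->]; first by left.
by right; rewrite opprK.
Qed.

(** An embedding at the same place agrees with [e i] up to conjugation at the separating element t,
    so there are at most two, and only one if [e i] is real. *)
Lemma fibre_card_le i : (#|[set j | rho j == i]%SET| <= local_degree (pl i : K -> R))%N.
Proof.
have [t tinj] := emb_inj R K; have [ld1 ld2] := local_degree_ge (e i).
set F := [set j | _]%SET.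
have Fz j : j \in F -> e j t = e i t \/ e j t = ((e i t)^*)%C.
  rewrite inE => /eqP ji; have h x : nc (e i x) = nc (e j x) by rewrite -ji rho_abs.
  have e1 k : e k (t + 1) = e k t + 1 by rewrite (rmorphD (e k)) rmorph1.
  by apply: same_place_conj => //; rewrite -!e1.
have uF : uniq [seq e j t | j <- enum F].
  by rewrite map_inj_uniq ?enum_uniq // => j k /tinj.
rewrite cardE -(size_map (fun j => e j t)).
have [re|nre] := pselect (real_emb (e i)).
  apply: leq_trans ld1; apply: (@uniq_leq_size _ _ [:: e i t]) => // z /mapP [j].
  rewrite mem_enum => /Fz h ->; rewrite inE; apply/eqP; case: h => // ->.
  by have := re t; case: (e i t) => a b /= ->; rewrite oppr0.
apply: leq_trans (ld2 nre); apply: (@uniq_leq_size _ _ [:: e i t; ((e i t)^*)%C]) => // z /mapP [j].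
by rewrite mem_enum => /Fz h ->; rewrite !inE; case: h => ->; rewrite eqxx ?orbT.
Qed.

Lemma nonarch_abs_ge0 P (x : K) : 0 <= nonarch_abs R P x.
Proof. by rewrite /nonarch_abs; case: ifP => // _; exact: powR_ge0. Qed.

(** Finite places contribute the factor 1 at an integer, and at an archimedean place the exponent is
    at least the number of embeddings defining it. *)
Lemma height_ge (x : O) :
  \prod_(i < n) Num.max 1 (nc (e i (val x))) <= height R (val x).
Proof.
pose G (v : K -> R) := Num.max 1 (v (val x) ^+ local_degree v).
pose r := [seq (pl i : K -> R) | i <- enum place_reps].
have -> : height R (val x) = \prod_(v <- r) G v.
  have rp : [set` r] `<=` @places R K.
    by move=> _ /mapP [ i _ -> ]; left; exists (e i).
  transitivity (\prod_(v <- r | v \in @places R K) G v); last first.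
    rewrite big_seq_cond [RHS]big_seq; apply: eq_bigl => v.
    by case vr: (v \in r) => //=; apply: mem_set; exact: rp.
  apply: (@fsbigE R 1 *%R _ (@places R K) r G) => //.
  - rewrite map_inj_in_uniq ?enum_uniq // => i j; rewrite !mem_enum !inE => /eqP {2}<- /eqP {2}<-.
    exact: rho_eq.
  - move=> v [[s ->]|[P [pP ->]]] vr.
      exfalso; move/negP: vr; apply; have [ i si ] := embP s.
      apply/mapP; exists (rho i); first by rewrite mem_enum rho_reps.
      by rewrite rho_place; apply/funext => y; rewrite /arch_abs si.
    apply/max_idPl; apply: exprn_ile1; first exact: nonarch_abs_ge0.
    by apply: nonarch_abs_le1 => //; exact: valP.
rewrite big_map big_enum /= (partition_big rho (fun i => i \in place_reps)) /=; last by move=> i _; exact: rho_reps.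
apply: ler_prod => i iT; apply/andP; split.
  by apply: prodr_ge0 => j _; rewrite le_max ler01.
rewrite (eq_bigr (fun=> Num.max 1 (nc (e i (val x))))) => [|j /eqP <-]; last by rewrite rho_abs.
rewrite prodr_const; have := fibre_card_le i; rewrite cardsE /G => le.
rewrite /arch_abs; set a := nc _; have a0 : 0 <= a := nc_ge0 _.
have [a1|a1] := leP a 1.
  by rewrite expr1n le_max lexx.
by rewrite le_max; apply/orP; right; rewrite ler_weXn2l // ltW.
Qed.

End PlaceRepresentatives.

(** * Units *)

Section Units.
Variables (R : realType) (K : fieldExtType rat).
Local Notation n := (deg K).
Local Notation O := (ringint K).
Local Notation e := (@emb R K).
Local Notation rho := (@rho R K).

Lemma nc_embM j (x y : O) : nc (e j (val (x * y))) = nc (e j (val x)) * nc (e j (val y)).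
Proof. by rewrite -Normc.normcM -(rmorphM (e j)). Qed.

Lemma nc_emb1 j : nc (e j (val (1 : O))) = 1.
Proof. by rewrite (rmorph1 (e j)) nc1. Qed.

Lemma nc_embX j (x : O) k : nc (e j (val (x ^+ k))) = nc (e j (val x)) ^+ k.
Proof.
by elim: k => [|k IH]; [rewrite !expr0 nc_emb1 | rewrite !exprS nc_embM IH].
Qed.

Lemma conj_emb i : exists j, forall x, e j x = ((e i x)^*)%C.
Proof.
have [j ji] := embP ((@conjc R : {rmorphism R[i] -> R[i]}) \o e i).
by exists j => x; rewrite -ji.
Qed.

(* Each complex place contributes two real coordinates: the real part at its
   representative and the imaginary part at the conjugate embedding. *)
Definition minkowski_coord (j : 'I_n) (x : O) : R :=
  if rho j == j then complex.Re (e j (val x)) else complex.Im (e j (val x)).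

Lemma minkowski_coordB j x y :
  minkowski_coord j (x - y) = minkowski_coord j x - minkowski_coord j y.
Proof.
have E : e j (val (x - y)) = e j (val x) - e j (val y) by rewrite -(rmorphB (e j)).
by rewrite /minkowski_coord; case: ifP => _; rewrite E raddfB.
Qed.

Lemma minkowski_coord_le j x : `|minkowski_coord j x| <= nc (e j (val x)).
Proof. by rewrite /minkowski_coord; case: ifP => _; [exact: ge_Re_nc|exact: ge_Im_nc]. Qed.

(** The coordinates at w and at its conjugate supply the real and the imaginary part, and |z| <= |Re
    z| + |Im z| gives the factor 2. *)
Lemma emb_le_minkowski v (x : O) d : 0 <= d ->
  (forall j, rho j != v -> `|minkowski_coord j x| <= d) ->
  forall j, rho j != v -> nc (e j (val x)) <= 2 * d.
Proof.
move=> d0 h j jv; rewrite -rho_abs; set w := rho j in jv *.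
have ww : rho w = w by rewrite rhoK.
apply: le_trans (nc_le_ReIm _) _; rewrite [leRHS](_ : _ = d + d); last by ring.
apply: lerD; first by have := h w; rewrite /minkowski_coord ww eqxx => /(_ jv).
have [k kE] := conj_emb w.
have kw : rho k = w.
  rewrite -ww; apply: rho_eq; apply/funext => y.
  by rewrite /arch_abs kE nc_conj.
have ImE : complex.Im (e k (val x)) = - complex.Im (e w (val x)).
  by rewrite kE; case: (e w (val x)).
have [kk|kk] := eqVneq w k.
  have -> : complex.Im (e w (val x)) = 0 by move: ImE; rewrite -kk; lra.
  by rewrite normr0.
have := h k; rewrite /minkowski_coord kw (negPf kk) ImE normrN.
exact.
Qed.

Lemma truncn_eq_lt1 (a b : R) : 0 <= a -> 0 <= b -> Num.truncn a = Num.truncn b -> `|a - b| < 1.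
Proof.
move=> a0 b0 ab; have := truncn_itv a0; have := truncn_itv b0.
by rewrite ab -[_.+1%:R]natr1 ltr_norml; lra.
Qed.

(** Pigeonhole in Minkowski's manner, on the a coordinates away from v: with M = y^a and N0 = y^n,
    the (M+1)^n points outnumber the N0^a = M^n cells. A coincidence gives size O(M / N0) = O(1/y)
    away from v and O(M) at v, hence norm O(M^n / N0^a) = O(1). *)
Lemma place_small_element : exists C : nat, (0 < C)%N /\
  forall v, rho v = v -> forall y, (0 < y)%N -> exists x : O,
  [/\ x != 0, forall j, rho j != v -> nc (e j (val x)) <= C%:R / y%:R &
      (nrm R x <= C ^ n)%N].
Proof.
have [Cw [Cw0 embC]] := emb_inbox_le R K.
exists (2 * (2 * Cw + 1))%N; split; first by rewrite muln_gt0 addn_gt0 orbT.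
move=> v vv y y0; set C := (2 * _)%N.
pose A : {set 'I_n} := [set j | rho j != v]%SET; pose a := #|A|.
have an : (a < n)%N.
  rewrite -[n]card_ord -cardsT; apply: proper_card; apply/properP; split; first exact: finset.subsetT.
  by exists v; rewrite ?finset.in_setT // inE vv eqxx.
pose M := (y ^ a)%N; pose N0 := (y ^ n)%N.
have M0 : (0 < M)%N by rewrite expn_gt0 y0.
have N00 : (0 < N0)%N by rewrite expn_gt0 y0.
pose B : R := (Cw * M)%N%:R; have B0 : 0 <= B by [].
have B1 : 0 < 2 * B + 1 by rewrite ltr_wpDl // mulr_ge0.
have N0R : 0 < N0%:R :> R by rewrite ltr0n.
pose p (t : {ffun 'I_n -> 'I_M.+1}) : O := ofc R (\row_j (t j : nat)%:Z).
have pbox t : inbox R M (p t).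
  by move=> j; rewrite ofcK mxE; have := ltn_ord (t j); lia.
have pcoord t j : - B <= minkowski_coord j (p t) <= B.
  by rewrite -ler_norml; apply: le_trans (minkowski_coord_le _ _) _; exact: embC.
(* The range [-B, B] is rescaled into [0, N0); the denominator 2B + 1 instead of 2B makes the upper
   inequality strict. *)
pose s t j : R := (minkowski_coord j (p t) + B) * N0%:R / (2 * B + 1).
have s0 t j : 0 <= s t j.
  by rewrite divr_ge0 ?mulr_ge0 ?(ltW B1) //; have := pcoord t j; lra.
have sN t j : s t j < N0%:R.
  rewrite ltr_pdivrMr // mulrC ltr_pM2l //; have := pcoord t j; lra.
pose cell t : {ffun 'I_a -> 'I_N0.-1.+1} := [ffun k => inord (Num.truncn (s t (enum_val k)))].
have /injectivePn [t [u tu ctu]] : ~~ injectiveb cell.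
  apply/injectiveP => /leq_card; rewrite !card_ffun !card_ord prednK // leqNgt.
  apply/negP/negPn; rewrite /N0 -expnM mulnC expnM -/M ltn_exp2r ?deg_gt0 //.
pose x := p t - p u.
have x0 : x != 0.
  rewrite subr_eq0; apply: contra tu => /eqP /(can_inj (@ofcK R K)) /rowP h.
  by apply/eqP/ffunP => j; apply: val_inj; have := h j; rewrite !mxE => -[].
have xbox : inbox R M x.
  move=> j; rewrite /x /p -raddfB ofcK !mxE.
  move: (nat_of_ord (t j)) (ltn_ord (t j)) (nat_of_ord (u j)) (ltn_ord (u j)) => a' la b' lb.
  clear -la lb; lia.
pose d : R := (2 * B + 1) / N0%:R.
have d0 : 0 <= d by rewrite divr_ge0 // ltW.
have xd j : rho j != v -> `|minkowski_coord j x| <= d.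
  move=> jv; have jA : j \in A by rewrite inE.
  have := congr1 (fun c : {ffun 'I_a -> 'I_N0.-1.+1} => nat_of_ord (c (enum_rank_in jA j))) ctu.
  rewrite !ffunE enum_rankK_in // !inordK ?prednK ?truncn_lt_nat // => tr.
  have := truncn_eq_lt1 (s0 t j) (s0 u j) tr.
  have -> : s t j - s u j = minkowski_coord j x / d.
    by rewrite minkowski_coordB /s /d; clearbody B; field; rewrite !gt_eqF.
  by rewrite normrM normfV (ger0_norm d0) ltr_pdivrMr ?divr_gt0 // mul1r => /ltW.
have dC : 2 * d <= C%:R * (M%:R / N0%:R).
  rewrite /d !mulrA ler_pM2r ?invr_gt0 //.
  have : 1 <= M%:R :> R by rewrite ler1n.
  have CE : C%:R = 2 * (2 * Cw%:R + 1) :> R by rewrite /C natrM natrD natrM.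
  have BE : B = Cw%:R * M%:R by rewrite /B natrM.
  by rewrite CE BE; lra.
have small j : rho j != v -> nc (e j (val x)) <= C%:R * (M%:R / N0%:R).
  by move=> jv; apply: le_trans dC; apply: emb_le_minkowski jv => // k; exact: xd.
exists x; split=> //.
  move=> j jv; apply: (le_trans (small j jv)); rewrite ler_wpM2l // ler_pdivrMr //.
  rewrite mulrC ler_pdivlMr ?ltr0n // -natrM ler_nat /M /N0 -expnSr leq_pexp2l //.
rewrite -(ler_nat R) nrmE.
apply: (@le_trans _ _ (\prod_(j < n) (C%:R * M%:R * (if j \in A then N0%:R^-1 else 1)))).
  apply: ler_prod => j _; rewrite nc_ge0 /=; case: ifP => [|/negbT]; rewrite inE.
    by move=> jv; apply: le_trans (small j jv) _; rewrite mulrA.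
  move=> _; rewrite mulr1; apply: le_trans (embC _ _ _ xbox) _.
  rewrite -natrM ler_nat leq_mul2r; apply/orP; right; rewrite /C; lia.
rewrite big_split /= prodr_const card_ord -big_mkcond prodr_const -/a.
have MN : (M ^ n = N0 ^ a)%N by rewrite /M /N0 -!expnM mulnC.
have N0a : 0 < (N0 ^ a)%N%:R :> R by rewrite ltr0n expn_gt0 N00.
by rewrite exprMn exprVn -!natrX MN mulfK ?gt_eqF.
Qed.

(** Among elements of bounded norm that shrink away from v, two are congruent modulo D. Each divides
    its norm, which divides D, so each divides the other. Their quotient is a unit, and it is less
    than 1 away from v if the second element is small enough. *)
Lemma place_unit v : rho v = v -> exists u : O, u \is a GRing.unit /\
  forall j, rho j != v -> nc (e j (val u)) < 1.
Proof.
move=> vv; have [C [C0 /(_ v vv) sm]] := place_small_element.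
have /choice [X hX] : forall y : nat, exists x : O, [/\ x != 0,
    forall j, rho j != v -> nc (e j (val x)) <= C%:R / y.+1%:R & (nrm R x <= C ^ n)%N].
  by move=> y; apply: sm.
set D := ((C ^ n)`!)%N; have D0 : (D%:R : O) != 0 by rewrite (natr_ringint_eq0 R) -lt0n fact_gt0.
have [f [g [gK fI]]] := norm_index R (pid_nz D0).
have [l hl] : exists l, forall Y, exists y, (Y <= y)%N /\ f (X y) = l.
  apply: contrapT => no.
  have /choice [Y hY] : forall l, exists Y, forall y, (Y <= y)%N -> f (X y) <> l.
    move=> l; apply: contrapT => nl; apply: no; exists l => Y; apply: contrapT => ny.
    by apply: nl; exists Y => y Yy fy; apply: ny; exists y.
  pose y := (\max_l Y l)%N; apply: (hY (f (X y)) y) => //.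
  exact: (@leq_bigmax _ Y).
have [y0 [_ fy0]] := hl 0%N; have [x00 _ nx0] := hX y0.
set x0 := X y0 in fy0 x00 nx0.
have pos j : 0 < nc (e j (val x0)) by rewrite nc_gt0 fmorph_eq0 val_eq0.
pose S : R := \sum_j (nc (e j (val x0)))^-1.
have Sj j : (nc (e j (val x0)))^-1 <= S.
  rewrite /S (bigD1 j) //= lerDl; apply: sumr_ge0 => k _; by rewrite invr_ge0 ltW.
(* [S] bounds all 1/|x0|_j, so y + 1 > C S forces |x|_j <= C / (y + 1) < |x0|_j away from v. *)
have [y [Yy fy]] := hl (Num.truncn (C%:R * S)); have [xy0 xsm nx] := hX y.
set x := X y in fy xy0 xsm nx.
have dvd (a b : O) : a != 0 -> (nrm R a <= C ^ n)%N -> pid D%:R (b - a) -> exists q, b = a * q.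
  move=> a0 na [z bz]; have [c ac] := nrm_mem R a.
  have /dvdnP [k Dk] : (nrm R a %| D)%N by rewrite dvdn_fact // nrm_gt0 a0.
  exists (1 + k%:R * c * z); rewrite mulrDr mulr1 -[LHS](subrK a) addrC bz Dk natrM ac; congr (_ + _).
  by ring.
have [q xq] := dvd x0 x x00 nx0 ((fI _ _).1 (etrans fy (esym fy0))).
have [q' xq'] := dvd x x0 xy0 nx ((fI _ _).1 (etrans fy0 (esym fy))).
exists q; split.
  apply/unitrPr; exists q'; have /eqP : x0 * (1 - q * q') = 0.
    by rewrite mulrBr mulr1 mulrA -xq -xq' subrr.
  by rewrite ringint_mulf_eq0 (negPf x00) /= subr_eq0 => /eqP.
move=> j jv; have := xsm j jv; rewrite xq nc_embM.
move=> le; rewrite -(@ltr_pM2l _ (nc (e j (val x0)))) // mulr1; apply: le_lt_trans le _.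
have CS : C%:R * S < y.+1%:R.
  by apply: lt_le_trans (truncnS_gt _) _; rewrite ler_nat ltnS.
rewrite ltr_pdivrMr ?ltr0n // -ltr_pdivrMl // mulrC.
by apply: le_lt_trans CS; rewrite ler_wpM2l.
Qed.

Lemma ln_prod (I : finType) (F : I -> R) : (forall i, 0 < F i) ->
  ln (\prod_i F i) = \sum_i ln (F i).
Proof.
move=> F0; suff [] : 0 < \prod_i F i /\ ln (\prod_i F i) = \sum_i ln (F i) by [].
elim/big_rec2: _ => [|i x y _ [y0 IH]]; first by rewrite ln1.
by split; [exact: mulr_gt0 | rewrite lnM ?posrE // IH].
Qed.

Lemma unit_neq0 (u : O) : u \is a GRing.unit -> u != 0.
Proof. by move=> /unitrPr [w uw]; apply: contraTneq (oner_neq0 O) => u0; rewrite -uw u0 mul0r eqxx. Qed.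

Lemma emb_unit_gt0 (u : O) j : u \is a GRing.unit -> 0 < nc (e j (val u)).
Proof. by move=> /unit_neq0 u0; rewrite nc_gt0 fmorph_eq0 val_eq0. Qed.

Lemma sum_ln_unit (u : O) : u \is a GRing.unit -> \sum_j ln (nc (e j (val u))) = 0.
Proof.
move=> uu; rewrite -ln_prod => [|j]; last exact: emb_unit_gt0.
have /unitrPr [w uw] := uu.
have : (nrm R u * nrm R w)%N = 1%N.
  apply/eqP; rewrite -(eqr_nat R) natrM !nrmE -big_split /=; apply/eqP.
  by rewrite big1 // => j _; rewrite -nc_embM uw nc_emb1.
by rewrite -nrmE => /eqP; rewrite muln_eq1 => /andP[/eqP -> _]; rewrite ln1.
Qed.

Lemma ln_emb_exprz (u : O) (z : int) j : u \is a GRing.unit ->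
  ln (nc (e j (val (u ^ z)))) = z%:~R * ln (nc (e j (val u))).
Proof.
move=> uu; have u0 := emb_unit_gt0 j uu.
have lnX (k : nat) : ln (nc (e j (val (u ^+ k)))) = k%:R * ln (nc (e j (val u))).
  by rewrite nc_embX lnXn // mulr_natl.
case: z => k; first by rewrite -exprnP lnX.
rewrite NegzE -exprnN rmorphN /= mulNr -[k.+1%:~R]/(k.+1%:R) -lnX.
set w := u ^+ k.+1; have wu : w \is a GRing.unit by rewrite unitrX.
have wV : w^-1 \is a GRing.unit by rewrite unitrV.
apply/eqP; rewrite -addr_eq0 -lnM ?posrE ?emb_unit_gt0 //.
by rewrite -nc_embM mulVr // nc_emb1 ln1.
Qed.

(** The logarithms of each unit are negative away from its own place and sum to zero over all
    embeddings; dropping one place v0 makes the matrix diagonally dominant, hence the units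
    independent. *)
Lemma place_reps_le_unit_rank r : unit_group_rank K r -> (#|place_reps R K| <= r.+1)%N.
Proof.
move=> [_ rmax]; pose v0 := rho (Ordinal (deg_gt0 K)).
have v0T : v0 \in place_reps R K by exact: rho_reps.
have v0v0 : rho v0 = v0 by rewrite rhoK.
pose S := (place_reps R K :\ v0)%SET.
have cS : #|place_reps R K| = #|S|.+1 by rewrite (cardsD1 v0) v0T.
rewrite cS ltnS.
have /choice [U hU] : forall k : 'I_#|S|, exists u : O, u \is a GRing.unit /\
    forall j, rho j != enum_val k -> nc (e j (val u)) < 1.
  move=> k; apply: place_unit; have := enum_valP k; rewrite {1}/S !inE => /andP[_ /eqP //].
have Uu k : U k \is a GRing.unit by case: (hU k).
pose L j k := ln (nc (e j (val (U k)))).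
have Lneg j k : rho j != enum_val k -> L j k < 0.
  by move=> h; apply: ln_lt0; rewrite emb_unit_gt0 //=; apply: (hU k).2.
have Sv0 (k : 'I_#|S|) : (enum_val k : 'I_n) != v0.
  by have := enum_valP k; rewrite {1}/S !inE => /andP[].
have npos (z : 'I_#|S| -> int) : (forall j, \sum_k (z k)%:~R * L j k = 0) -> forall k, z k <= 0.
  move=> hz k0; rewrite leNgt; apply/negP => zk0.
  (* Sum the relation over the embeddings at places with positive exponent. A positive exponent
     multiplies a positive sum, v0 being left out of it, and a nonpositive exponent multiplies a
     nonpositive one, so the total would be positive. *)
  have [q qE] : {q : pred 'I_n &
      forall j, reflect (exists2 k, rho j = enum_val k & 0 < z k) (q j)}.
    exists (fun j => [exists k, (rho j == enum_val k) && (0 < z k)]) => j.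
    apply: (iffP existsP) => -[k]; first by move=> /andP[/eqP]; exists k.
    by move=> /eqP jk zk; exists k; rewrite jk.
  have Lq k : 0 < z k -> 0 < \sum_(j | q j) L j k.
    move=> zk.
    have qv0 j : q j -> rho j != v0 by move=> /qE [l -> _]; exact: Sv0.
    have : \sum_j L j k = 0 by exact: sum_ln_unit.
    rewrite (bigID q) /= [X in _ + X = _](bigD1 v0) /=; last first.
      by apply/negP => /qv0; rewrite v0v0 eqxx.
    have h1 : L v0 k < 0 by apply: Lneg; rewrite v0v0 eq_sym.
    have h2 : \sum_(j | ~~ q j && (j != v0)) L j k <= 0.
      apply: sumr_le0 => j /andP[nq _]; apply/ltW/Lneg.
      by apply: contra nq => /eqP jk; apply/qE; exists k.
    lra.
  have : \sum_(j | q j) \sum_k (z k)%:~R * L j k = 0 by rewrite big1.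
  rewrite exchange_big /= (bigD1 k0) //= -mulr_sumr.
  have h1 : 0 < (z k0)%:~R * \sum_(j | q j) L j k0 by rewrite mulr_gt0 ?ltr0z ?Lq.
  have h2 : 0 <= \sum_(k < #|S| | k != k0) \sum_(j | q j) (z k)%:~R * L j k.
    apply: sumr_ge0 => k _; rewrite -mulr_sumr; have [zk|zk] := ltP 0 (z k).
      by rewrite mulr_ge0 ?ler0z ?ltW // Lq.
    rewrite mulr_le0 ?lerz0 //; apply: sumr_le0 => j /qE [l jl zl].
    apply/ltW/Lneg; rewrite jl; apply: contraTneq zl => /enum_val_inj ->.
    by rewrite -leNgt.
  lra.
apply: (rmax _ U); split=> // z uz.
have rel j : \sum_k (z k)%:~R * L j k = 0.
  transitivity (ln (nc (e j (val (\prod_k U k ^ z k))))); last by rewrite uz nc_emb1 ln1.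
  have -> : nc (e j (val (\prod_k U k ^ z k))) = \prod_k nc (e j (val (U k ^ z k))).
    by elim/big_rec2: _ => [|k a b _ <-]; rewrite ?nc_emb1 ?nc_embM.
  rewrite ln_prod; first by apply: eq_bigr => k _; rewrite -ln_emb_exprz.
  by move=> k; apply: emb_unit_gt0; case: (z k) => m; rewrite ?unitrV unitrX.
move=> k; apply/eqP; rewrite eq_le npos //=.
have := npos (fun k => - z k) _ k; rewrite oppr_le0; apply=> j.
by under eq_bigr do rewrite rmorphN mulNr; rewrite sumrN rel oppr0.
Qed.

End Units.

(** * Counting elements of bounded height *)

Lemma dyadic_bounds (R : realType) (y : R) : 1 <= y ->
  2 ^+ trunc_log 2 (Num.truncn y) <= y < 2 ^+ (trunc_log 2 (Num.truncn y)).+1.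
Proof.
move=> y1; have y0 : 0 <= y := le_trans ler01 y1.
rewrite -!natrX -truncn_ge_nat // -truncn_lt_nat //.
by apply: trunc_log_bounds; rewrite ?truncn_gt0.
Qed.

Lemma size_le_fibres (R : realType) (T : eqType) (I : finType) (F : T -> I) (s : seq T) (X : R) :
  (forall i, (size [seq x <- s | F x == i])%:R <= X) -> (size s)%:R <= #|I|%:R * X.
Proof.
move=> h; rewrite -sum1_size (partition_big F xpredT) //= natr_sum.
rewrite mulr_natl -sumr_const; apply: ler_sum => i _.
by rewrite sum1_count -size_filter.
Qed.

Section Final.
Variables (R : realType) (K : fieldExtType rat).
Local Notation n := (deg K).
Local Notation O := (ringint K).
Local Notation e := (@emb R K).
Local Notation rho := (@rho R K).

Lemma card_mod_sub (P A B : set O) : prime_ideal P -> A `<=` B ->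
  (card_mod P A <= card_mod P B)%N.
Proof.
move=> pP AB; have iP := prime_is_ideal pP.
have [f [g [gK fI]]] := norm_index R (prime_nz pP).
rewrite !(card_modE _ iP gK fI); apply/subset_leq_card/fintype.subsetP => i.
by rewrite !inE => /asboolP [a /AB Ba <-]; apply/asboolP; exists a.
Qed.

Definition size_at (j : 'I_n) (x : O) : R := Num.max 1 (nc (e j (val x))).
Definition dyadic_at (j : 'I_n) (x : O) : nat := trunc_log 2 (Num.truncn (size_at j x)).

Lemma size_at_ge1 j x : 1 <= size_at j x.
Proof. by rewrite le_max lexx. Qed.

Lemma size_at_rho j x : size_at (rho j) x = size_at j x.
Proof. by rewrite /size_at rho_abs. Qed.

Lemma size_at_le_prod j x : size_at j x <= \prod_i size_at i x.
Proof.
rewrite (bigD1 j) //= ler_peMr ?(le_trans ler01) ?size_at_ge1 //.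
by elim/big_ind: _ => [|u v|i _]; [exact: lexx | exact: mulr_ege1 | exact: size_at_ge1].
Qed.

(** At v0 one may assume that a is the larger; elsewhere equal dyadic labels make the size of b at
    most twice that of a. So |a - b| is at most 3 times the size of a at every embedding. *)
Lemma nrm_le_of_dyadic (v0 : 'I_n) (H : R) (a b : O) :
  \prod_j size_at j a <= H -> \prod_j size_at j b <= H ->
  (forall j, rho j != v0 -> dyadic_at j a = dyadic_at j b) ->
  (nrm R (a - b))%:R <= 3 ^+ n * H.
Proof.
wlog ba : a b / size_at v0 b <= size_at v0 a => [wl|] aH bH lab.
  have [ba|/ltW ab] := leP (size_at v0 b) (size_at v0 a); first exact: wl.
  have -> : (nrm R (a - b))%:R = (nrm R (b - a))%:R :> R.
    rewrite !nrmE; apply: eq_bigr => j _; rewrite -opprB (rmorphN (e j)) /=.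
    by rewrite ncN.
  by apply: wl => // j jv; rewrite lab.
rewrite nrmE; apply: le_trans (_ : 3 ^+ n * \prod_j size_at j a <= _); last first.
  by rewrite ler_wpM2l // exprn_ge0.
have -> : 3 ^+ n = \prod_(j < n) 3 :> R by rewrite prodr_const card_ord.
rewrite -big_split; apply: ler_prod => j _ /=; rewrite nc_ge0 /=.
have h : size_at j b <= 2 * size_at j a.
  have a1 := size_at_ge1 j a.
  have [jv|jv] := eqVneq (rho j) v0.
    move: ba a1; rewrite -jv !size_at_rho.
    by move: (size_at j a) (size_at j b) => x y; lra.
  have /andP[a2 _] := dyadic_bounds a1.
  have /andP[_ b2] := dyadic_bounds (size_at_ge1 j b).
  move: a2 b2; rewrite -/(dyadic_at j a) -/(dyadic_at j b) lab // exprS.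
  by move: (_ ^+ _) (size_at j a) (size_at j b) => z x y; lra.
have ha : nc (e j (val a)) <= size_at j a by rewrite le_max lexx orbT.
have hb : nc (e j (val b)) <= size_at j b by rewrite le_max lexx orbT.
apply: le_trans (_ : nc (e j (val a)) + nc (e j (val b)) <= _).
  by rewrite (rmorphB (e j)) -[X in _ <= _ + X]ncN; exact: ncD.
apply: le_trans (lerD ha hb) _; move: h (size_at_ge1 j a).
by move: (size_at j a) (size_at j b) => x y; lra.
Qed.

Lemma count_of_sieve (r : nat) (c alpha : R) : unit_group_rank K r -> 0 < alpha ->
  exists2 C : R, 0 < C & forall (H : R) (s : seq O), uniq s -> 2 <= H ->
    (forall a, a \in s -> height R (val a) <= H) ->
    (forall P, prime_ideal P -> c < (ideal_norm P)%:R ->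
       (card_mod P [set a | a \in s])%:R <= alpha * (ideal_norm P)%:R) ->
    (size s)%:R <= C * H `^ alpha * ln H ^+ r.
Proof.
move=> hr alpha0; have [C C0 sieve] := larger_sieve (R := R) K c alpha0.
have ln2 : 0 < ln 2 :> R by rewrite ln_gt0 // ltr1n.
(* (2 / ln 2)^r comes from the number of classes, the rest from the sieve with M = 3^n H. *)
exists ((2 / ln 2) ^+ r * C * (3 ^+ n) `^ alpha).
  by rewrite !mulr_gt0 ?powR_gt0 ?exprn_gt0 // divr_gt0.
move=> H s us H2 sH hs.
pose v0 := rho (Ordinal (deg_gt0 K)).
pose S := (place_reps R K :\ v0)%SET.
have cS : (#|S| <= r)%N.
  have := place_reps_le_unit_rank R hr.
  by rewrite (cardsD1 v0) rho_reps add1n ltnS.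
pose L := trunc_log 2 (Num.truncn H).
have H1 : 1 <= H by apply: le_trans H2; rewrite ler1n.
have H0 : 0 <= H by exact: le_trans ler01 H1.
have sP a : a \in s -> \prod_j size_at j a <= H.
  by move=> /sH; apply: le_trans; exact: height_ge.
have labL a j : a \in s -> (dyadic_at j a <= L)%N.
  move=> /sP aH; apply/leq_trunc_log/le_truncn.
  exact: le_trans (size_at_le_prod j a) aH.
pose F a := [ffun k : 'I_#|S| => inord (dyadic_at (enum_val k) a) : 'I_L.+1].
have M1 : 1 <= 3 ^+ n * H.
  by apply: le_trans H1 _; rewrite ler_peMl // exprn_ege1 // ler1n.
have X f : (size [seq a <- s | F a == f])%:R <= C * (3 ^+ n * H) `^ alpha.
  apply: sieve => //; first exact: filter_uniq.
    move=> a b; rewrite !mem_filter => /andP[/eqP Fa as_] /andP[/eqP Fb bs] _.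
    apply: (@nrm_le_of_dyadic v0); rewrite ?sP // => j jv.
    have jS : rho j \in S by rewrite !inE jv rhoK eqxx.
    have /ffunP/(_ (enum_rank_in jS (rho j))) : F a = F b by rewrite Fa Fb.
    rewrite !ffunE enum_rankK_in // => /(congr1 val).
    by rewrite /= !inordK ?ltnS ?labL // /dyadic_at !size_at_rho.
  move=> P pP cP; apply: le_trans (hs P pP cP); rewrite ler_nat.
  by apply: card_mod_sub => // a /=; rewrite mem_filter => /andP[].
apply: le_trans (size_le_fibres X) _.
rewrite card_ffun !card_ord powRM ?exprn_ge0 //.
(* H >= 2 lets the extra 1 be absorbed: both L ln 2 and ln 2 are at most ln H. *)
have LH : L.+1%:R <= 2 / ln 2 * ln H.
  have /andP[LH _] := dyadic_bounds H1.
  have H3 : 0 < H by exact: lt_le_trans ltr01 H1.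
  have l1 : L%:R * ln 2 <= ln H.
    by rewrite mulr_natl -lnXn // ler_ln ?posrE ?exprn_gt0.
  have l2 : ln 2 <= ln H by rewrite ler_ln ?posrE.
  by rewrite mulrAC ler_pdivlMr // -natr1 mulrDl mul1r [2 * _]mulr_natl mulr2n lerD.
have Lr : (L.+1 ^ #|S|)%:R <= (2 / ln 2) ^+ r * ln H ^+ r :> R.
  rewrite -exprMn; apply: le_trans (_ : (L.+1 ^ r)%:R <= _).
    by rewrite ler_nat leq_pexp2l.
  by rewrite natrX lerXn2r ?nnegrE ?ler0n //; apply: le_trans LH; exact: ler0n.
have Y0 : 0 <= C * ((3 ^+ n) `^ alpha * H `^ alpha).
  by rewrite !mulr_ge0 ?powR_ge0 // ltW.
apply: le_trans (ler_wpM2r Y0 Lr) _.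
rewrite le_eqVlt; apply/orP; left; apply/eqP; move: (_ `^ _) (_ `^ _) (ln H ^+ r) (_ ^+ r) => x y z w; ring.
Qed.

End Final.

Theorem corollary1p1 (R : realType) (K : fieldExtType rat) (r : nat)
    (hr : unit_group_rank K r) (c alpha : R)
    (hc : 0 < c) (halpha : 0 < alpha < 1) :
  exists2 B : R, 0 < B &
    forall (H : R) (A : set (ringint K)),
      2 <= H ->
      A `<=` [set a | height R (val a) <= H] ->
      (forall P : set (ringint K), prime_ideal P -> c < (ideal_norm P)%:R ->
         (card_mod P A)%:R <= alpha * (ideal_norm P)%:R) ->
      finite_set A /\
      #|` fset_set A|%:R <= B * H `^ alpha * ln H ^+ r.
Proof.
have /andP[alpha0 _] := halpha.
have [B B0 count] := count_of_sieve c hr alpha0.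
exists B => // H A H2 AH hA.
(* The hypotheses pass to finite subsets of A, and a uniform bound on their sizes makes A finite. *)
have bound (s : {fset ringint K}) : [set` s] `<=` A -> #|` s|%:R <= B * H `^ alpha * ln H ^+ r.
  move=> sA; apply: count => //; [exact: fset_uniq | by move=> a /sA /AH |].
  move=> P pP cP; apply: le_trans (hA P pP cP); rewrite ler_nat.
  exact: (card_mod_sub R pP sA).
have fA : finite_set A.
  apply: contrapT => /(infinite_set_fset (Num.truncn (B * H `^ alpha * ln H ^+ r)).+1).
  move=> [s sA ls]; have := bound s sA; apply/negP; rewrite -ltNge.
  apply: lt_le_trans (truncnS_gt _) _; first by rewrite ler_nat.
split=> //; apply: bound => a /=.
by rewrite in_fset_set // => /set_mem.
Qed.
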